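(* Let $(M,g)$ be a closed Riemannian spin manifold of even dimension $n$ with spinor bundle $\Sigma M=\Sigma^+M\oplus\Sigma^-M$, $p\in M$, and $U_p$ a normal geodesic neighborhood of $p$. For any differential operator $P\in\mathrm{Diff}(M,\Sigma M)$ of order $m$ with Agmon angle $\theta$ which is even for the $\mathbb Z_2$-grading $\Sigma M=\Sigma^+M\oplus\Sigma^-M$, and for $0<\lambda<1$, one has on $U_p$ $$\widetilde\omega^{\rm Res}_{\log_\theta(U_\lambda^\sharp\mathfrak f_\lambda^\sharp(c^g(P)))}=(j_g\circ\mathfrak f_\lambda)\,(-2i)^{-n/2}\,\omega^{\rm sRes}_{\log_\theta(P)}\circ\mathfrak f_\lambda,$$ where $j_g(x)=\sqrt{\det(g_{ij}(x))}$.
   Context: **Coordinates.** $U_p=\exp_p(B_r)$ carries normal geodesic coordinates $x=(x^1,\dots,x^n)\leftrightarrow\exp_p(\sum_ix^ie_i(p))$ for an oriented orthonormal basis $(e_i(p))$ of $T_pM$; $g_{ij}=g(\partial_{x^i},\partial_{x^j})$. $\mathfrak f_\lambda:U_p\to\exp_p(B_{\lambda r})$ is $x\mapsto\lambda x$. Let $e_1,\dots,e_n$ be the orthonormal frame on $U_p$ obtained by Levi-Civita parallel transport of $(e_i(p))$ along geodesics from $p$, with dual coframe $e^1,\dots,e^n$. **Operators.** Clifford multiplication satisfies $v\cdot_gv\,\cdot_g=-|v|^2$; $\mathrm{C}\ell(TM)\otimes\mathbb C\simeq\mathrm{End}(\Sigma M)$; $\Sigma^\pm M$ are the $\pm1$-eigenbundles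 of $i^{n/2}e^1\cdot_g\cdots\cdot_ge^n\cdot_g$. $\Sigma M$ is trivialised over $U_p$ by parallel transport along geodesics from $p$; in it the operators $e^i\cdot_g$ are constant. $D^\gamma$ is the coordinate partial derivative with multi-index $\gamma$ acting componentwise. Write $P=\sum_{|\gamma|\le m}\sum_I(P_\gamma)_Ie^I\cdot_gD^\gamma$, $e^I=e^{i_1}\cdot_g\cdots\cdot_ge^{i_k}$, $i_1<\dots<i_k$. $P$ is even if it maps sections of $\Sigma^\pm M$ to sections of $\Sigma^\pm M$. $c^g:\mathrm{C}\ell(T_xM)\to\mathrm{End}(\Lambda T_x^*M)$ is the algebra morphism with $c^g(v)=v\wedge\cdot-v^{\sharp_g}\lrcorner\,\cdot$ for covectors $v$; $c^g(P):=\sum_{\gamma,I}(P_\gamma)_Ic^g(e^I)D^\gamma$ acts on sections of $\Lambda T^*M\otimes\mathbb C$ over $U_p$, trivialised by the parallel frame $e^{i_1}\wedge\dots\wedge e^{i_k}$, with $D^\gamma$ acting componentwise. **Rescaling.** $(\mathfrak f_\lambda^\sharp Q)s=Q(s\circ\mathfrak f_\lambda^{-1})\circ\mathfrak f_\lambda$ acts on sections of the pull-back bundle $\mathfrak f_\lambda^*\Lambda T^*M$ over $U_p$, which is identified with $\Lambda T^*U_p$ via $dx^I\circ\mathfrak f_\lambda\leftrightarrow dx^I$ (so $e^l\circ\mathfrak f_\lambda$ corresponds to the form with coefficients those of $e^l$ evaluated at $\mathfrak f_\lambda(x)$). $U_\lambda$ acts on $\Lambda^kT^*M$ as $\lambda^{-k}$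 and $U_\lambda^\sharp Q=U_\lambda QU_\lambda^{-1}$, applied to the coefficients of a differential operator. **Agmon angle and logarithm.** $P$ of order $m>0$ has Agmon angle $\theta$ if its leading symbol $\sigma_m(P)(x,\xi)$, $\xi\ne0$, has no eigenvalue on $L_\theta=\{re^{i\theta}:r\ge0\}$ and there is $\varepsilon>0$ such that $P$ has no eigenvalue in $\{re^{i\alpha}:r\ge0,|\alpha-\theta|\le\varepsilon\}$. For an operator $Q$ of order $m$ on $U_p$ whose leading symbol has no eigenvalue on $L_\theta$ for $\xi\ne0$, the homogeneous symbol components of $\log_\theta Q$ are determined by the local symbol of $Q$: with $r_{-m}=(\sigma_m(Q)-\mu)^{-1}$ and $r_{-m-j}=-r_{-m}\sum_{a+b+|\alpha|=j,\,b<j}\frac{(-i)^{|\alpha|}}{\alpha!}\partial_\xi^\alpha\sigma_{m-a}(Q)\,\partial_x^\alpha r_{-m-b}$, one puts, for $\mathrm{Re}\,z<0$, $\sigma_{mz-j}(Q_\theta^z)=\frac{i}{2\pi}\int_{\Gamma_\theta}\mu_\theta^z\,r_{-m-j}\,d\mu$, where $\Gamma_\theta$ comes in from infinity along $L_\theta$ (argument $\theta$), goes clockwise around a small circle about $0$ and returns to infinity along the same ray (argument $\theta-2\pi$); this extends holomorphically to $z=0$, and $\sigma_{-j}(\log_\theta Q)(x,\xi)=|\xi|^{-j}\partial_z\big(\sigma_{mz-j}(Q_\theta^z)(x,\xi/|\xi|)\big)|_{z=0}$. **Densities.** With $|\xi|$ the Euclidean norm in the coordinates and $d_S\xi$ the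 standard volume form on the unit sphere, $\omega^{\rm sRes}_{\log_\theta(P)}(x)=\frac1{(2\pi)^n}\Big(\int_{|\xi|=1}\mathrm{str}\big(\sigma_{-n}(\log_\theta P)(x,\xi)\big)d_S\xi\Big)dx^1\wedge\dots\wedge dx^n$, $\mathrm{str}=\mathrm{tr}^{\Sigma^+}-\mathrm{tr}^{\Sigma^-}$; for $Q$ acting on forms $\widetilde\omega^{\rm Res}_{\log_\theta(Q)}(x)=\frac1{(2\pi)^n}\int_{|\xi|=1}\big[\sigma_{-n}(\log_\theta Q)(x,\xi)\mathbf 1_x\big]_{[n]}d_S\xi$, where $\mathbf 1_x\in\Lambda^0T_x^*M$ is the constant $1$ and $[\cdot]_{[n]}$ the degree-$n$ part. If $\omega(x)=w(x)\,dx^1\wedge\dots\wedge dx^n$, then $(\omega\circ\mathfrak f_\lambda)(x):=w(\mathfrak f_\lambda(x))\,dx^1\wedge\dots\wedge dx^n$. *)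

(* Defs.v *)
From HB Require Import structures.
From mathcomp Require Import all_boot all_order all_algebra complex.
From mathcomp Require Import all_classical all_reals all_analysis.

Set Implicit Arguments.
Unset Strict Implicit.
Unset Printing Implicit Defensive.

Import Order.TTheory GRing.Theory Num.Theory numFieldNormedType.Exports.
Local Open Scope classical_set_scope.
Local Open Scope complex_scope.
Local Open Scope ring_scope.

Section Calculus.
Variables (R : realType) (n : nat).
Local Notation C := R[i].

Definition enorm (x : 'rV[R]_n) : R := Num.sqrt (\sum_i x 0 i ^+ 2).

Definition eball (r : R) : set 'rV[R]_n := [set x | enorm x < r].

Definition iter_partial (s : seq 'I_n) (f : 'rV[R]_n -> R) : 'rV[R]_n -> R :=
  foldr (fun i h x => 'D_(delta_mx 0 i) h x) f s.

Definition smooth_on (V : set 'rV[R]_n) (f : 'rV[R]_n -> R) : Prop :=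
  forall (s : seq 'I_n) x, V x ->
    {for x, continuous (iter_partial s f)} /\
    forall i, derivable (iter_partial s f) x (delta_mx 0 i).

Definition smooth_mx_on a b (V : set 'rV[R]_n) (F : 'rV[R]_n -> 'M[C]_(a, b)) :
    Prop :=
  forall i j, smooth_on V (fun x => complex.Re (F x i j)) /\
              smooth_on V (fun x => complex.Im (F x i j)).

(* Multi-indices with entries at most m, which include all those of weight at
   most m. *)
Definition mindex (m : nat) := {ffun 'I_n -> 'I_m.+1}.

Definition weight m (al : mindex m) : nat := \sum_i al i.

Definition mfact m (al : mindex m) : nat := \prod_i (al i)`!.

Definition Dmx m (al : mindex m) a b (F : 'rV[R]_n -> 'M[C]_(a, b)) :
    'rV[R]_n -> 'M[C]_(a, b) := fun x =>
  let s := flatten [seq nseq (al i) i | i <- enum 'I_n] in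
  \matrix_(i, j) (iter_partial s (fun y => complex.Re (F y i j)) x
                  +i* iter_partial s (fun y => complex.Im (F y i j)) x).

(* Local differential operators of order m with d x d matrix coefficients; the
   coefficients of weight greater than m are never used. *)
Definition coeffs (m d : nat) := mindex m -> 'rV[R]_n -> 'M[C]_d.

Definition diff_apply m d (a : coeffs m d) (u : 'rV[R]_n -> 'cV[C]_d) :
    'rV[R]_n -> 'cV[C]_d := fun x =>
  \sum_(al : mindex m | (weight al <= m)%N) a al x *m Dmx al u x.

(* The coefficient of D^al at x of a differential operator L: the value at x of
   L on the functions (y - x)^al / al! times a basis vector. *)
Definition op_coeffs m d (L : ('rV[R]_n -> 'cV[C]_d) -> 'rV[R]_n -> 'cV[C]_d) :
    coeffs m d := fun al x =>
  \matrix_(i, j)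
    L (fun y => (\prod_k ((y 0 k - x 0 k) ^+ al k / (al k)`!%:R))%:C
                *: delta_mx j 0) x i 0.

Definition cint (D : set R) (f : R -> C) : C :=
  Rintegral lebesgue_measure D (fun t => complex.Re (f t))
  +i* Rintegral lebesgue_measure D (fun t => complex.Im (f t)).

(* Integral over the unit sphere of R^(d+1) for its standard volume form, in
   spherical coordinates (cos phi, sin phi * w) with w in the sphere of one
   dimension less; the sphere of R^1 carries the counting measure. *)
Fixpoint sphere_int_rec (d : nat) : ('rV[R]_d.+1 -> R) -> R :=
  match d with
  | 0 => fun f => f (const_mx 1) + f (const_mx (-1))
  | e.+1 => fun f =>
      Rintegral lebesgue_measure `[0, pi] (fun phi : R =>
        sin phi ^+ e * sphere_int_rec (fun w : 'rV[R]_e.+1 =>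
          f (row_mx (const_mx (cos phi) : 'rV[R]_1) (sin phi *: w))))
  end.

End Calculus.

Definition sphere_int (R : realType) (d : nat) : ('rV[R]_d -> R[i]) -> R[i] :=
  match d with
  | 0 => fun _ => 0
  | e.+1 => fun f =>
      sphere_int_rec (fun xi => complex.Re (f xi))
      +i* sphere_int_rec (fun xi => complex.Im (f xi))
  end.

Section Symbols.
Variables (R : realType) (n : nat).
Local Notation C := R[i].

Definition cexp (z : C) : C :=
  (expR (complex.Re z))%:C * (cos (complex.Im z) +i* sin (complex.Im z)).

Definition ray (t theta : R) : C := t%:C * cexp (0 +i* theta).

(* Component of degree m - a of the full symbol. *)
Definition hom_symbol m d (Q : coeffs R n m d) (a : nat) (x xi : 'rV[R]_n) :
    'M[C]_d :=
  \sum_(al : mindex n m | (weight al + a == m)%N)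
    (\prod_k ('i * (xi 0 k)%:C) ^+ al k) *: Q al x.

(* resolvent_symbol Q j x xi mu is r_{-m-j}; the auxiliary function computes
   the components of index at most k. *)
Fixpoint resolvent_upto m d (Q : coeffs R n m d) (k : nat) :
    nat -> 'rV[R]_n -> 'rV[R]_n -> C -> 'M[C]_d :=
  match k with
  | 0 => fun _ x xi mu => invmx (hom_symbol Q 0 x xi - mu%:M)
  | k'.+1 => fun j x xi mu =>
      if (j <= k')%N then resolvent_upto Q k' j x xi mu else
      - invmx (hom_symbol Q 0 x xi - mu%:M) *m
        \sum_(b < j) \sum_(a < j.+1)
          \sum_(al : mindex n j | (a + b + weight al == j)%N)
            ((- 'i) ^+ weight al / (mfact al)%:R) *:
            (Dmx al (fun eta => hom_symbol Q a x eta) xi *m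
             Dmx al (fun y => resolvent_upto Q k' b y xi mu) x)
  end.

Definition resolvent_symbol m d (Q : coeffs R n m d) (j : nat) :=
  resolvent_upto Q j j.

(* Integral of mu_theta^z f(mu) over the contour Gamma_theta whose circular
   part has radius rho: inward along the ray with argument theta, clockwise
   along the circle, outward along the ray with argument theta - 2 pi. *)
Definition contour_int (theta rho : R) (z : C) (f : C -> C) : C :=
  - cint `[rho, +oo[ (fun t =>
      cexp (z * (ln t +i* theta)) * f (ray t theta) * ray 1 theta)
  - cint `[theta - 2 * pi, theta] (fun al =>
      cexp (z * (ln rho +i* al)) * f (ray rho al) * ('i * ray rho al))
  + cint `[rho, +oo[ (fun t =>
      cexp (z * (ln t +i* (theta - 2 * pi))) * f (ray t theta) * ray 1 theta).

(* sigma_{mz-j}(Q_theta^z)(x, xi), meant for Re z < 0: the value which the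
   contour integral takes for all small radii. *)
Definition power_symbol m d (Q : coeffs R n m d) (theta : R) (j : nat)
    (x xi : 'rV[R]_n) (z : C) : 'M[C]_d :=
  xget 0 [set v : 'M[C]_d | \forall rho \near (0 : R)^'+,
    v = \matrix_(a, b) ('i / (2 * pi)%:C *
          contour_int theta rho z (fun mu => resolvent_symbol Q j x xi mu a b))].

(* Derivative at 0 of the holomorphic extension to a neighbourhood of 0 of a
   function considered on the half-plane Re z < 0. *)
Definition ext_deriv0 d (h : C -> 'M[C]_d) : 'M[C]_d :=
  xget 0 [set v : 'M[C]_d | exists2 e : R, 0 < e & exists H : C -> 'M[C]_d,
    [/\ forall z a b, `|z| < e%:C ->
          derivable ((fun w => H w a b) : C^o -> C^o) z (1 : C^o),
        forall z, `|z| < e%:C -> complex.Re z < 0 -> H z = h z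
      & forall a b, v a b =
          derive ((fun w => H w a b) : C^o -> C^o) (0 : C^o) (1 : C^o)]].

(* sigma_{-j}(log_theta Q)(x, xi) *)
Definition log_symbol m d (Q : coeffs R n m d) (theta : R) (j : nat)
    (x xi : 'rV[R]_n) : 'M[C]_d :=
  ((enorm xi) ^- j)%:C *:
  ext_deriv0 (power_symbol Q theta j x ((enorm xi)^-1 *: xi)).

End Symbols.

Section Clifford.
Variables (R : realType) (n : nat).
Local Notation C := R[i].

Definition clifford_rep d (ga : 'I_n -> 'M[C]_d) : Prop :=
  forall i j, ga i *m ga j + ga j *m ga i = (- 2%:R *+ (i == j))%:M.

Definition cliff_vec d (ga : 'I_n -> 'M[C]_d) (v : 'rV[R]_n) : 'M[C]_d :=
  \sum_i (v 0 i)%:C *: ga i.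

(* Spin(n) as a subgroup of the invertible elements of the Clifford algebra,
   seen through the representation ga (faithful on it, n being even). *)
Definition Spin d (ga : 'I_n -> 'M[C]_d) : set 'M[C]_d :=
  [set h | exists s : seq 'rV[R]_n,
    [/\ ~~ odd (size s), forall v, v \in s -> enorm v = 1
      & h = \big[mulmx/1%:M]_(v <- s) cliff_vec ga v]].

(* A is the image of h under the double cover Spin(n) -> SO(n). *)
Definition spin_cover d (ga : 'I_n -> 'M[C]_d) (h : 'M[C]_d) (A : 'M[R]_n) :=
  forall j, h *m ga j *m invmx h = \sum_i (A i j)%:C *: ga i.

Definition cliff_prod d (c : 'I_n -> 'M[C]_d) (I : {set 'I_n}) : 'M[C]_d :=
  \big[mulmx/1%:M]_(i <- enum I) c i.

Definition grading d (ga : 'I_n -> 'M[C]_d) : 'M[C]_d :=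
  'i ^+ n./2 *: cliff_prod ga [set: 'I_n].

(* The projectors on the +1 and -1 eigenspaces of the grading are
   (1 + grading) / 2 and (1 - grading) / 2. *)
Definition str d (ga : 'I_n -> 'M[C]_d) (A : 'M[C]_d) : C :=
  \tr ((2^-1 *: (1%:M + grading ga)) *m A)
  - \tr ((2^-1 *: (1%:M - grading ga)) *m A).

(* Exterior forms are columns of components in the basis of the products
   e^{i_1} /\ ... /\ e^{i_k} of a coframe, indexed by subsets of 'I_n. *)
Definition fdim : nat := #|{set 'I_n}|.

Definition fidx (I : {set 'I_n}) : 'I_fdim := enum_rank I.

Definition fset_of (a : 'I_fdim) : {set 'I_n} := enum_val a.

Definition koszul (i : 'I_n) (J : {set 'I_n}) : C :=
  (-1) ^+ #|[set j in J | (j < i)%N]|.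

Definition wedge_mx (i : 'I_n) : 'M[C]_fdim :=
  \matrix_(a, b) (let J := fset_of b in
    koszul i J *+ ((i \notin J) && (fset_of a == i |: J))).

Definition contract_mx (i : 'I_n) : 'M[C]_fdim :=
  \matrix_(a, b) (let J := fset_of b in
    koszul i J *+ ((i \in J) && (fset_of a == J :\ i))).

(* c^g(e^i) in an orthonormal coframe. *)
Definition form_cliff (i : 'I_n) : 'M[C]_fdim := wedge_mx i - contract_mx i.

End Clifford.

Section Manifold.
Variables (R : realType) (n : nat) (M : topologicalType).
Local Notation C := R[i].

(* A chart is given by its inverse, a parametrization of an open subset of M
   by an open subset of R^n; the values of par outside dom are irrelevant. *)
Record chart := Chart { dom : set 'rV[R]_n ; par : 'rV[R]_n -> M }.

Definition is_chart (c : chart) : Prop :=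
  [/\ open (dom c), {in dom c &, injective (par c)},
      {in dom c, continuous (par c)}
    & forall W, open W -> W `<=` dom c -> open (par c @` W)].

Definition overlap (c c' : chart) : set 'rV[R]_n :=
  [set x | dom c x /\ (par c' @` dom c') (par c x)].

Definition transition (c c' : chart) (x : 'rV[R]_n) : 'rV[R]_n :=
  xget 0 [set y | dom c' y /\ par c' y = par c x].

Definition jacobian (c c' : chart) (x : 'rV[R]_n) : 'M[R]_n :=
  \matrix_(k, l) 'D_(delta_mx 0 l) (fun y => transition c c' y 0 k) x.

Definition chart_compat (c c' : chart) : Prop :=
  forall k, smooth_on (overlap c c') (fun x => transition c c' x 0 k).

Record smooth_structure := SmoothStructure {
  charts : set chart ;
  charts_ok : forall c, charts c -> is_chart c ;
  charts_cover : forall y, exists2 c, charts c & (par c @` dom c) y ;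
  charts_compat : forall c c', charts c -> charts c' -> chart_compat c c' ;
  charts_max : forall c, is_chart c ->
    (forall c', charts c' -> chart_compat c c' /\ chart_compat c' c) ->
    charts c }.

Variable X : smooth_structure.

Record riemannian_metric := RiemannianMetric {
  metric : chart -> 'rV[R]_n -> 'M[R]_n ;
  metric_sym : forall c x, charts X c -> dom c x -> (metric c x)^T = metric c x ;
  metric_pos : forall c x (v : 'rV[R]_n), charts X c -> dom c x -> v != 0 ->
    0 < (v *m metric c x *m v^T) 0 0 ;
  metric_smooth : forall c, charts X c ->
    forall i j, smooth_on (dom c) (fun x => metric c x i j) ;
  metric_law : forall c c' x, charts X c -> charts X c' -> overlap c c' x ->
    metric c x = (jacobian c c' x)^T *m metric c' (transition c c' x)
                 *m jacobian c c' x }.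

Variable g : riemannian_metric.

(* christoffel c k i j is Gamma^k_ij. *)
Definition christoffel (c : chart) (k i j : 'I_n) (x : 'rV[R]_n) : R :=
  let dg l a b := 'D_(delta_mx 0 l) (fun y => metric g c y a b) x in
  2^-1 * \sum_l invmx (metric g c x) k l * (dg i j l + dg j i l - dg l i j).

(* Levi-Civita parallelism, for times in T, of the vector field Y along the
   curve u, both read in the chart c. *)
Definition parallel_along (c : chart) (u Y : R -> 'rV[R]_n) (T : set R) : Prop :=
  forall t, T t -> forall k,
    derive1 (fun s => Y s 0 k) t
    + \sum_i \sum_j christoffel c k i j (u t)
        * derive1 (fun s => u s 0 i) t * Y t 0 j = 0.

Definition geodesic (c : chart) (u : R -> 'rV[R]_n) (T : set R) : Prop :=
  parallel_along c u (fun t => \row_k derive1 (fun s => u s 0 k) t) T.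

Section SpinStructure.
Variables (d : nat) (ga : 'I_n -> 'M[C]_d).

(* A Spin(n)-principal bundle spt -> M with right action act, together with an
   equivariant map fr to the orthonormal frames: column i of fr q c holds the
   components in the chart c of the i-th vector of the frame at base q.
   The image of fr in each fibre is one SO(n)-orbit of frames, and the frames in
   it are the oriented ones.  The smooth structure is given by the maximal
   collection lsec of smooth local sections, taken over charts. *)
Record spin_structure := SpinStructure {
  spt : Type ;
  base : spt -> M ;
  act : spt -> 'M[C]_d -> spt ;
  act1 : forall q, act q 1%:M = q ;
  actM : forall q h k, Spin ga h -> Spin ga k ->
    act (act q h) k = act q (h *m k) ;
  base_act : forall q h, Spin ga h -> base (act q h) = base q ;
  act_trans : forall q q', base q = base q' ->
    exists2 h, Spin ga h & q' = act q h ;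
  act_free : forall q h k, Spin ga h -> Spin ga k -> act q h = act q k -> h = k ;
  fr : spt -> chart -> 'M[R]_n ;
  fr_law : forall q c c' x, charts X c -> charts X c' -> overlap c c' x ->
    base q = par c x -> fr q c' = jacobian c c' x *m fr q c ;
  fr_orthonormal : forall q c x, charts X c -> dom c x -> base q = par c x ->
    (fr q c)^T *m metric g c x *m fr q c = 1%:M ;
  fr_act : forall q c x h A, charts X c -> dom c x -> base q = par c x ->
    Spin ga h -> spin_cover ga h A -> fr (act q h) c = fr q c *m A ;
  lsec : chart -> ('rV[R]_n -> spt) -> Prop ;
  lsec_base : forall c s, lsec c s ->
    charts X c /\ forall x, dom c x -> base (s x) = par c x ;
  lsec_fr : forall c s, lsec c s ->
    forall k i, smooth_on (dom c) (fun x => fr (s x) c k i) ;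
  lsec_cover : forall y, exists c s, lsec c s /\ (par c @` dom c) y ;
  lsec_compat : forall c s c' s', lsec c s -> lsec c' s' ->
    exists2 h : 'rV[R]_n -> 'M[C]_d, smooth_mx_on (overlap c c') h &
      forall x, overlap c c' x ->
        Spin ga (h x) /\ s x = act (s' (transition c c' x)) (h x) ;
  lsec_max : forall c s, charts X c ->
    (forall x, dom c x -> base (s x) = par c x) ->
    (forall c' s', lsec c' s' ->
      exists2 h : 'rV[R]_n -> 'M[C]_d, smooth_mx_on (overlap c c') h &
        forall x, overlap c c' x ->
          Spin ga (h x) /\ s x = act (s' (transition c c' x)) (h x)) ->
    lsec c s }.

Variable S : spin_structure.

(* Smooth sections of the associated bundle spt x_Spin(n) C^d, as equivariant
   functions: psi q is the component of the section in the spinor frame q, in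
   which Clifford multiplication by the i-th vector of the frame fr q is ga i. *)
Definition spinor_field (psi : spt S -> 'cV[C]_d) : Prop :=
  (forall q h, Spin ga h -> psi (act q h) = invmx h *m psi q) /\
  (forall c s, lsec c s -> smooth_mx_on (dom c) (psi \o s)).

Definition spinor_op := (spt S -> 'cV[C]_d) -> spt S -> 'cV[C]_d.

Definition represents m (P : spinor_op) (c : chart) (s : 'rV[R]_n -> spt S)
    (a : coeffs R n m d) : Prop :=
  (forall al, smooth_mx_on (dom c) (a al)) /\
  forall psi, spinor_field psi ->
    forall x, dom c x -> P psi (s x) = diff_apply a (psi \o s) x.

Definition diff_op m (P : spinor_op) : Prop :=
  (forall psi, spinor_field psi -> spinor_field (P psi)) /\
  (forall c s, lsec c s -> exists a : coeffs R n m d, represents P c s a).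

Definition op_eigenvalue (P : spinor_op) (mu : C) : Prop :=
  exists psi, [/\ spinor_field psi, exists q, psi q != 0
                & forall q, P psi q = mu *: psi q].

Definition agmon_angle m (P : spinor_op) (theta : R) : Prop :=
  (forall c s (a : coeffs R n m d), lsec c s -> represents P c s a ->
     forall x xi t, dom c x -> xi != 0 -> 0 <= t ->
       ~~ eigenvalue (hom_symbol a 0 x xi) (ray t theta)) /\
  exists2 e : R, 0 < e &
    forall t al, 0 <= t -> `|al - theta| <= e -> ~ op_eigenvalue P (ray t al).

Definition even_op (P : spinor_op) : Prop :=
  forall psi (e : bool), spinor_field psi ->
    (forall q, grading ga *m psi q = (-1) ^+ e *: psi q) ->
    forall q, grading ga *m P psi q = (-1) ^+ e *: P psi q.

(* c is the chart of normal geodesic coordinates on exp_p(B_r), centred at p and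
   attached to the oriented orthonormal basis e_i(p) = fr (s 0): the straight
   segment from 0 to x is the geodesic with initial velocity sum_i x^i e_i(p).
   s is the local section of the spin bundle that lifts the frame obtained from
   e_i(p) by parallel transport along these geodesics.  As the spin connection
   is the lift of the Levi-Civita connection, s is parallel along them, so psi
   |-> psi \o s is the trivialisation of the spinor bundle by parallel
   transport. *)
Definition normal_frame (p : M) (r : R) (c : chart) (s : 'rV[R]_n -> spt S) :
    Prop :=
  let T x := [set t : R | eball r (t *: x)] in
  [/\ 0 < r, dom c = eball r, par c 0 = p & lsec c s] /\
  [/\ forall x, eball r x -> geodesic c (fun t => t *: x) (T x),
      fr (s 0) c = 1%:M
    & forall x i, eball r x ->
        parallel_along c (fun t => t *: x)
          (fun t => (col i (fr (s (t *: x)) c))^T) (T x)].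

End SpinStructure.
End Manifold.

Section FormOperators.
Variables (R : realType) (n : nat).
Local Notation C := R[i].

(* Operators on sections of the exterior bundle trivialised by a coframe: fop
   acts on columns of components with respect to the coframe
   e^l = sum_k (cof x) l k dx^k. *)
Record form_op := FormOp {
  cof : 'rV[R]_n -> 'M[R]_n ;
  fop : ('rV[R]_n -> 'cV[C]_(fdim n)) -> 'rV[R]_n -> 'cV[C]_(fdim n) }.

(* c^g(P) for P = sum_al sum_I (P al I) e^I D^al *)
Definition cg m (P : mindex n m -> {set 'I_n} -> 'rV[R]_n -> C)
    (theta : 'rV[R]_n -> 'M[R]_n) : form_op :=
  FormOp theta (diff_apply (fun al x =>
    \sum_(I : {set 'I_n}) P al I x *: cliff_prod (@form_cliff R n) I)).

(* The pull-back of e^l by f_lambda, with dx^k o f_lambda identified with dx^k,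
   has the coefficients of e^l evaluated at lambda x. *)
Definition f_sharp (la : R) (Q : form_op) : form_op :=
  FormOp (fun x => cof Q (la *: x))
         (fun u x => fop Q (fun y => u (la^-1 *: y)) (la *: x)).

Definition U_mul (la : R) (v : 'cV[C]_(fdim n)) : 'cV[C]_(fdim n) :=
  \col_a ((la ^- #|fset_of a|)%:C * v a 0).

Definition U_inv (la : R) (v : 'cV[C]_(fdim n)) : 'cV[C]_(fdim n) :=
  \col_a ((la ^+ #|fset_of a|)%:C * v a 0).

Definition U_sharp (la : R) (Q : form_op) : form_op :=
  FormOp (cof Q)
         (fun u x => U_mul la (fop Q (fun y => U_inv la (u y)) x)).

(* The densities are given by their coefficient on dx^1 /\ ... /\ dx^n. *)
Definition omega_sRes m d (ga : 'I_n -> 'M[C]_d) (a : coeffs R n m d)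
    (theta : R) (x : 'rV[R]_n) : C :=
  ((2 * pi) ^- n)%:C * sphere_int (fun xi => str ga (log_symbol a theta n x xi)).

(* The determinant is the coefficient of e^1 /\ ... /\ e^n. *)
Definition omega_Res m (Q : form_op) (theta : R) (x : 'rV[R]_n) : C :=
  ((2 * pi) ^- n)%:C *
  (sphere_int (fun xi =>
     log_symbol (@op_coeffs R n m _ (fop Q)) theta n x xi
       (fidx [set: 'I_n]) (fidx finset.set0))
   * (\det (cof Q x))%:C).

End FormOperators.

Arguments omega_Res {R n} m Q theta x.

(* Main.v *)
(* Identifying the forms with the Clifford algebra through the parallel frame,
   the Clifford action on forms becomes the left regular representation, so
   c^g is induced by a fibrewise constant algebra morphism from the spinor
   endomorphisms. Together with U_lambda it yields an algebra morphism Phi, and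
   the coefficients of the rescaled operator at x are lambda^-|alpha| times the
   images under Phi of those of P at lambda x. By induction on j the resolvent
   symbols satisfy r'_{-m-j}(x, xi, mu) =
   lambda^(m+j) Phi (r_{-m-j}(lambda x, xi, lambda^m mu)), and the substitution
   mu -> lambda^m mu in the contour integral turns this into the factor
   lambda^(j-mz) for the power symbols when z < 0. Both sides extend
   holomorphically to 0, so the derivatives at 0 are related in the same way,
   up to a term in which log lambda multiplies sigma_{-j}(P^0). This term is 0
   for j > 0: as z -> 0- the contour integral tends to 0, since the contributions
   of the two sides of the cut cancel in the limit and the small circle, on which
   the resolvent symbol is bounded, contributes O(rho^(1/2)).
   Finally the degree-n component of c^g(A) 1 is (-2i)^(-n/2) str A; its
   factor lambda^-n coming from U_lambda cancels lambda^j for j = n, and the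
   volume e^1 /\ ... /\ e^n is the positive square root of det (g_ij) in the
   coordinates because the frame determinant is 1 at the origin and does not
   vanish on the ball. *)

Require Import Defs.
From HB Require Import structures.
From mathcomp Require Import all_boot all_order all_algebra complex.
From mathcomp Require Import all_classical all_reals all_analysis.
From mathcomp Require Import measurable_realfun ring lra.

Set Implicit Arguments.
Unset Strict Implicit.
Unset Printing Implicit Defensive.

Import Order.TTheory GRing.Theory Num.Theory numFieldNormedType.Exports.
Local Open Scope classical_set_scope.
Local Open Scope complex_scope.
Local Open Scope ring_scope.

(** The power symbol and the derivative at 0 are chosen by [xget] with default 0, so an identity
    between them must also hold when no admissible value exists. Neither the independence of the
    contour integral from the radius nor the existence of the holomorphic extension is proved.
    Instead Phi comes with a linear left inverse Psi: a value or an extension found for the rescaled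
    operator is carried back by Psi to one for P, so both sides exist or default together. The
    vanishing at z = 0 rests on a degree count. For j > 0 every monomial of r_{-m-j} contains at
    least two resolvents, hence decays like (1+t)^-2 along the ray, and t^-u (1+t)^-2 is dominated
    for all 0 <= u <= 1/2 by t^(-1/2)/(1+t), whose integral over the half-line is pi. To keep track
    of this degree the resolvent symbols are placed in a class of noncommutative polynomials stable
    under derivation; the same class provides the iterated x-derivatives needed in the recursion. No
    integrability is known on the sphere, so constants leave that integral only through operations
    that do not use additivity. *)

(** * Products of Clifford generators *)

Section CliffordAlgebra.
Variables (R : realType) (n : nat).
Local Notation C := R[i].

Lemma big_mulmx_cat d (c : 'I_n -> 'M[C]_d) s t :
  \big[mulmx/1%:M]_(j <- s ++ t) c j =
  \big[mulmx/1%:M]_(j <- s) c j *m \big[mulmx/1%:M]_(j <- t) c j.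
Proof.
elim: s => [|j s IH]; first by rewrite big_nil mul1mx.
by rewrite /= !big_cons IH mulmxA.
Qed.

Lemma clifford_sq d (c : 'I_n -> 'M[C]_d) (cc : clifford_rep c) i :
  c i *m c i = - 1%:M.
Proof.
have := cc i i; rewrite eqxx mulr1n -mulr2n -scaler_nat.
move=> /(congr1 (fun M => 2^-1 *: M)).
rewrite scalerA mulVf ?pnatr_eq0// scale1r => ->.
by rewrite scale_scalar_mx mulrN mulVf ?pnatr_eq0// raddfN.
Qed.

Lemma clifford_anti d (c : 'I_n -> 'M[C]_d) (cc : clifford_rep c) i j :
  i != j -> c i *m c j = - (c j *m c i).
Proof.
move=> /negbTE ij; have := cc i j; rewrite ij mulr0n raddf0.
by move/eqP; rewrite addr_eq0 => /eqP.
Qed.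

Lemma clifford_anti_seq d (c : 'I_n -> 'M[C]_d) (cc : clifford_rep c) i s :
  i \notin s ->
  c i *m \big[mulmx/1%:M]_(j <- s) c j
  = (-1) ^+ size s *: (\big[mulmx/1%:M]_(j <- s) c j *m c i).
Proof.
elim: s => [|j s IH]; first by rewrite !big_nil mulmx1 mul1mx scale1r.
rewrite inE negb_or => /andP[ij /IH {}IH].
rewrite big_cons -(mulmxA (c j)) mulmxA clifford_anti// mulNmx -mulmxA IH /=.
by rewrite exprS -scalemxAr -scalerA scaleN1r.
Qed.

Lemma enum_ord_split (i : 'I_n) :
  enum 'I_n = take i (enum 'I_n) ++ i :: drop i.+1 (enum 'I_n).
Proof.
have si : (i < size (enum 'I_n))%N by rewrite size_enum_ord.
rewrite -{1}(cat_take_drop i (enum 'I_n)) (drop_nth i si).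
by rewrite nth_ord_enum.
Qed.

Lemma mem_take_enum (i j : 'I_n) : (j \in take i (enum 'I_n)) = (j < i)%N.
Proof.
rewrite -(mem_map val_inj) map_take val_enum_ord take_iota mem_iota /= add0n.
by rewrite leq_min ltn_ord andbT.
Qed.

(** Cutting the increasing enumeration at i exposes the factors that [c i] has to cross;
    [nseq (i \in K) i] treats membership and non-membership of i together. *)
Lemma enum_set_split (i : 'I_n) (K : {set 'I_n}) :
  enum K = [seq j <- take i (enum 'I_n) | j \in K] ++ nseq (i \in K) i
           ++ [seq j <- drop i.+1 (enum 'I_n) | j \in K].
Proof.
rewrite {1}/enum_mem -enumT (enum_ord_split i) filter_cat /=.
rewrite take_size_cat ?size_take ?size_enum_ord ?ltn_ord//.
rewrite -cat_rcons drop_size_cat ?size_rcons ?size_take ?size_enum_ord ?ltn_ord//.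
by case: (i \in K).
Qed.

(** Crossing the factors of index below i costs the Koszul sign; then [c i] is either inserted or
    meets itself and squares to -1. These are the wedge and the contraction term of [form_cliff]. *)
Lemma clifford_mul_prod d (c : 'I_n -> 'M[C]_d) (cc : clifford_rep c) i K :
  c i *m cliff_prod c K =
  koszul R i K *:
    (if i \in K then - cliff_prod c (K :\ i) else cliff_prod c (i |: K)).
Proof.
have iuniq : uniq (enum 'I_n) by rewrite enum_uniq.
have iT : i \notin take i (enum 'I_n) by rewrite mem_take_enum ltnn.
have iD : i \notin drop i.+1 (enum 'I_n).
  move: iuniq; rewrite {1}(enum_ord_split i) cat_uniq /=.
  by move=> /and3P[_ _ /andP[]].
have E (K' : {set 'I_n}) s : i \notin s ->
    (forall j, j != i -> (j \in K') = (j \in K)) ->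
    [seq j <- s | j \in K'] = [seq j <- s | j \in K].
  move=> ni eK; apply: eq_in_filter => j js; apply: eK.
  by apply: contraNneq ni => <-.
have sz : size ([seq j <- take i (enum 'I_n) | j \in K])
    = #|[set j in K | (j < i)%N]|.
  rewrite -(card_uniqP _); last by rewrite filter_uniq// take_uniq.
  by apply: eq_card => j; rewrite mem_filter mem_take_enum inE.
rewrite /cliff_prod (enum_set_split i K) big_mulmx_cat /= mulmxA.
rewrite clifford_anti_seq ?mem_filter ?(negbTE iT) ?andbF// sz -/(koszul R i K).
rewrite -scalemxAl; congr (_ *: _); rewrite -mulmxA big_mulmx_cat /=.
case: ifP => iK.
  rewrite (enum_set_split i (K :\ i)) !inE eqxx /= !big_mulmx_cat /= big_cons !big_nil.
  rewrite mulmx1 ?mul1mx (mulmxA (c i)) clifford_sq// mulNmx mul1mx mulmxN.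
  by rewrite !(E (K :\ i)) // => j ji; rewrite !inE ji.
rewrite (enum_set_split i (i |: K)) !inE eqxx /= !big_mulmx_cat /= big_cons !big_nil.
by rewrite mul1mx !(E (i |: K)) // => j ji; rewrite !inE (negbTE ji).
Qed.

(** [c i] anticommutes with every factor except itself, so the number of sign changes is the size of
    K, corrected by one if i lies in K. *)
Lemma clifford_commute_prod d (c : 'I_n -> 'M[C]_d) (cc : clifford_rep c) i K :
  c i *m cliff_prod c K =
  (-1) ^+ (#|K| + (i \in K)) *: (cliff_prod c K *m c i).
Proof.
rewrite /cliff_prod cardE (enum_set_split i K).
set s1 := seq.filter _ _; set s2 := seq.filter _ (drop _ _).
have iuniq : uniq (enum 'I_n) by rewrite enum_uniq.
have i1 : i \notin s1 by rewrite mem_filter mem_take_enum ltnn andbF.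
have i2 : i \notin s2.
  rewrite mem_filter negb_and; apply/orP; right.
  move: iuniq; rewrite {1}(enum_ord_split i) cat_uniq /=.
  by move=> /and3P[_ _ /andP[]].
rewrite !big_mulmx_cat /= mulmxA clifford_anti_seq// -scalemxAl -!mulmxA.
rewrite (_ : c i *m _ = (-1) ^+ size s2 *:
   (\big[mulmx/1%:M]_(i0 <- nseq (i \in K) i) c i0 *m
    (\big[mulmx/1%:M]_(i0 <- s2) c i0 *m c i))).
  rewrite -!scalemxAr scalerA -exprD !size_cat size_nseq; congr (_ *: _).
  rewrite -[LHS]signr_odd -[RHS]signr_odd !oddD !oddb.
  by case: (i \in K); case: (odd _); case: (odd _).
rewrite (mulmxA (c i)).
rewrite (_ : c i *m _ = \big[mulmx/1%:M]_(i0 <- nseq (i \in K) i) c i0 *m c i).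
  by rewrite -mulmxA clifford_anti_seq// -scalemxAr.
by case: (i \in K); rewrite ?big_cons !big_nil ?mulmx1 ?mul1mx.
Qed.

Lemma clifford_unit d (c : 'I_n -> 'M[C]_d) (cc : clifford_rep c) i :
  c i \in unitmx.
Proof. by apply: (mulmx1_unit (B := - c i) _).1; rewrite mulmxN clifford_sq// opprK. Qed.

Lemma cliff_prod_unit d (c : 'I_n -> 'M[C]_d) (cc : clifford_rep c) K :
  cliff_prod c K \in unitmx.
Proof.
rewrite /cliff_prod; elim/big_ind : _ => [|A B uA uB|i _].
- exact: unitmx1.
- by rewrite unitmx_mul uA.
- exact: clifford_unit.
Qed.

End CliffordAlgebra.

(** * Spinor endomorphisms and the left regular representation on forms *)

Section SpinorModule.
Variables (R : realType) (n : nat) (n_even : ~~ odd n).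
Local Notation C := R[i].
Local Notation d := (2 ^ n./2)%N.
Variables (ga : 'I_n -> 'M[C]_(2 ^ n./2)) (cc : clifford_rep ga).

(** A pairing for the normalized trace form, dual to the products of generators because distinct
    products are orthogonal for it. *)
Definition cliff_coef (J : {set 'I_n}) (A : 'M[C]_d) : C :=
  d%:R^-1 * \tr (invmx (cliff_prod ga J) *m A).

Lemma cliff_coef_is_linear J : scalar (cliff_coef J).
Proof.
move=> a A B; rewrite /cliff_coef mulmxDr -scalemxAr mxtraceD mxtraceZ.
by rewrite mulrDr mulrCA.
Qed.

HB.instance Definition _ J :=
  GRing.isLinear.Build C 'M[C]_d C _ (cliff_coef J) (cliff_coef_is_linear J).

(** The trace of [ga i *m X *m ga i] is [\tr X] by anticommutation and [- \tr X] by cyclicity. *)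
Lemma mxtrace_clifford_anti (X : 'M[C]_d) i :
  ga i *m X = - (X *m ga i) -> \tr X = 0.
Proof.
move=> aX; have E : \tr (ga i *m X *m ga i) = \tr X.
  by rewrite aX mulNmx -mulmxA clifford_sq// mulmxN mulmx1 opprK.
have : \tr (ga i *m X *m ga i) = - \tr X.
  by rewrite mxtrace_mulC mulmxA clifford_sq// mulNmx mul1mx raddfN.
rewrite E => /eqP; rewrite -addr_eq0 -mulr2n mulrn_eq0 /=.
by move/eqP.
Qed.

Lemma clifford_commute_inv_prod i K :
  ga i *m invmx (cliff_prod ga K) =
  (-1) ^+ (#|K| + (i \in K)) *: (invmx (cliff_prod ga K) *m ga i).
Proof.
have uK := cliff_prod_unit cc K.
apply: (can_inj (mulKmx uK)); rewrite -scalemxAr mulmxA mulKVmx//.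
apply: (can_inj (mulmxK uK)); rewrite mulmxKV// -scalemxAl.
by rewrite clifford_commute_prod// scalerA -exprD addnn -mul2n exprM sqrrN !expr1n scale1r.
Qed.

(** For J different from K it suffices to find one generator that anticommutes with the inverse of
    the first product times the second. *)
Lemma cliff_coef_prod (J K : {set 'I_n}) :
  cliff_coef J (cliff_prod ga K) = (J == K)%:R.
Proof.
rewrite /cliff_coef; case: eqVneq => [<-|JK].
  by rewrite mulVmx ?cliff_prod_unit// mxtrace1 mulVf// pnatr_eq0 expn_eq0.
suff [i oi] : exists i, odd (#|J| + (i \in J) + (#|K| + (i \in K))).
  rewrite (@mxtrace_clifford_anti _ i) ?mulr0//.
  rewrite mulmxA clifford_commute_inv_prod -scalemxAl -mulmxA.
  rewrite clifford_commute_prod// -scalemxAr scalerA -exprD mulmxA.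
  by rewrite -signr_odd oi scaleN1r.
(* The sign picked up by the generator i depends only on the symmetric difference D: its exponent
   has the parity of the size of D plus the membership of i in D. *)
pose D := (J :\: K) :|: (K :\: J).
have iD i : (i \in D) = (i \in J) (+) (i \in K).
  by rewrite !inE; case: (i \in J); case: (i \in K).
have oD : odd #|D| = odd #|J| (+) odd #|K|.
  rewrite cardsU (_ : _ :&: _ = finset.set0); last first.
    by apply/setP => i; rewrite !inE; case: (i \in J); case: (i \in K).
  rewrite cards0 subn0 oddD -(cardsID K J) -(cardsID J K) !oddD (finset.setIC K J).
  by case: (odd #|J :&: K|); case: (odd _); case: (odd _).
have E i : odd (#|J| + (i \in J) + (#|K| + (i \in K))) = odd #|D| (+) (i \in D).
  rewrite !oddD !oddb oD iD.
  by case: (odd _); case: (odd _); case: (i \in J); case: (i \in K).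
(* If D has odd size, an i outside D works; it exists because n is even, so D is not everything. If
   D has even size, an i inside D works; it exists because J and K differ. *)
case odD : (odd #|D|).
  have [i iND] : exists i, i \notin D.
    apply/existsP; rewrite -negb_forall; apply: contraNN n_even => /forallP DT.
    by rewrite -(card_ord n) -cardsT -(_ : D = [set: 'I_n]%SET)//; apply/setP => i; rewrite DT inE.
  by exists i; rewrite E odD (negbTE iND).
have [i iD'] : exists i, i \in D.
  apply/set0Pn; apply: contraNneq JK => D0; apply/eqP/setP => i.
  by move: (iD i); rewrite D0 inE; case: (i \in J); case: (i \in K).
by exists i; rewrite E odD iD'.
Qed.

Lemma fdimE : fdim n = (d * d)%N.
Proof.
rewrite /fdim -cardsT -powersetT card_powerset cardsT card_ord -expnD addnn.
by rewrite even_halfK.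
Qed.

Lemma fset_of_inj : injective (@fset_of n).
Proof. exact: enum_val_inj. Qed.

(** The two dimensions stay separate variables so that the lemma applies across the equality
    [fdim n = d * d]. *)
Lemma mulmx1C_rect p q (A : 'M[C]_(p, q)) (B : 'M[C]_(q, p)) :
  p = q -> A *m B = 1%:M -> B *m A = 1%:M.
Proof. by move=> pq; case: _ / pq A B => A B; apply: mulmx1C. Qed.

(** Completeness by counting: orthogonality reads [G *m H = 1], and since there are as many products
    as matrix entries, also [H *m G = 1]. *)
Lemma cliff_coefK (A : 'M[C]_d) :
  \sum_(a < fdim n) cliff_coef (fset_of a) A *: cliff_prod ga (fset_of a) = A.
Proof.
pose G : 'M[C]_(fdim n, d * d) := \matrix_a mxvec (cliff_prod ga (fset_of a)).
pose H : 'M[C]_(d * d, fdim n) :=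
  \matrix_(k, a) cliff_coef (fset_of a) (vec_mx (delta_mx 0 k)).
have HE B a : (mxvec B *m H) 0 a = cliff_coef (fset_of a) B.
  rewrite -[in RHS](mxvecK B) {2}(row_sum_delta (mxvec B)) !linear_sum mxE.
  by apply: eq_bigr => k _; rewrite mxE !linearZ; reflexivity.
have GH : G *m H = 1%:M.
  apply/matrixP => b e.
  transitivity (row b (G *m H) 0 e); first by rewrite [RHS]mxE.
  rewrite row_mul rowK HE cliff_coef_prod mxE.
  by rewrite (inj_eq fset_of_inj) eq_sym.
have HG := mulmx1C_rect fdimE GH.
apply: (can_inj mxvecK); rewrite -[RHS]mulmx1 -HG mulmxA mulmx_sum_row.
rewrite linear_sum; apply: eq_bigr => a _.
by rewrite HE rowK linearZ.
Qed.

(* Left multiplication by A in the basis of the products of the ga i; the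
   Clifford action on forms is the left regular representation of the Clifford
   algebra. *)
Definition spin_to_form (A : 'M[C]_d) : 'M[C]_(fdim n) :=
  \matrix_(a, b) cliff_coef (fset_of a) (A *m cliff_prod ga (fset_of b)).

Lemma spin_to_form_is_linear : linear spin_to_form.
Proof.
move=> a A B; apply/matrixP => i j.
by rewrite !mxE mulmxDl -scalemxAl linearP.
Qed.

HB.instance Definition _ :=
  GRing.isLinear.Build C 'M[C]_d 'M[C]_(fdim n) _ spin_to_form
    spin_to_form_is_linear.

Lemma spin_to_form1 : spin_to_form 1%:M = 1%:M.
Proof.
apply/matrixP => a b.
by rewrite !mxE mul1mx cliff_coef_prod (inj_eq fset_of_inj).
Qed.

Lemma spin_to_formM A B :
  spin_to_form (A *m B) = spin_to_form A *m spin_to_form B.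
Proof.
apply/matrixP => a b; rewrite !mxE -mulmxA.
rewrite -[B *m _]cliff_coefK mulmx_sumr linear_sum.
by apply: eq_bigr => e _; rewrite -scalemxAr linearZ mulrC !mxE.
Qed.

(** A left multiplication is determined by its value on the unit, here the column of the empty set;
    this gives a linear left inverse of [spin_to_form] defined on all matrices. *)
Definition form_to_spin (B : 'M[C]_(fdim n)) : 'M[C]_d :=
  \sum_(a < fdim n) B a (fidx finset.set0) *: cliff_prod ga (fset_of a).

Lemma form_to_spin_is_linear : linear form_to_spin.
Proof.
move=> a A B; rewrite /form_to_spin scaler_sumr -big_split /=.
by apply: eq_bigr => b _; rewrite !mxE scalerDl scalerA.
Qed.

HB.instance Definition _ :=
  GRing.isLinear.Build C 'M[C]_(fdim n) 'M[C]_d _ form_to_spin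
    form_to_spin_is_linear.

Lemma fidxK : cancel (@fidx n) (@fset_of n).
Proof. exact: enum_rankK. Qed.

Lemma cliff_prod0 p (c : 'I_n -> 'M[C]_p) : cliff_prod c finset.set0 = 1%:M.
Proof. by rewrite /cliff_prod enum_set0 big_nil. Qed.

Lemma spin_to_formK : cancel spin_to_form form_to_spin.
Proof.
move=> A; rewrite -[RHS]cliff_coefK; apply: eq_bigr => a _.
by rewrite mxE fidxK cliff_prod0 mulmx1.
Qed.

Lemma spin_to_form_clifford i : spin_to_form (ga i) = form_cliff R i.
Proof.
apply/matrixP => a b; rewrite !mxE clifford_mul_prod// linearZ /=.
case: ifP => iK /=; last first.
  by rewrite cliff_coef_prod mulr_natr mulr0n subr0.
by rewrite linearN /= cliff_coef_prod mulrN mulr_natr mulr0n sub0r.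
Qed.

Lemma spin_to_form_prod I :
  spin_to_form (cliff_prod ga I) = cliff_prod (@form_cliff R n) I.
Proof.
rewrite /cliff_prod; elim: (enum I) => [|i s IH].
  by rewrite !big_nil spin_to_form1.
by rewrite !big_cons spin_to_formM IH spin_to_form_clifford.
Qed.

(** Bringing the two copies of the first factor together costs [size s] swaps and one square equal
    to -1, so the exponent grows by [size s + 1]. *)
Lemma clifford_rev_seq s : uniq s ->
  (\big[mulmx/1%:M]_(j <- s) ga j) *m (\big[mulmx/1%:M]_(j <- s) ga j)
  = (-1) ^+ ((size s).+1 * size s)./2 *: 1%:M.
Proof.
elim: s => [|i s IH]; first by rewrite big_nil mulmx1 muln0 scale1r.
rewrite cons_uniq [size (_ :: _)]/= => /andP[ins us]; rewrite !big_cons.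
set P := \big[_/_]_(j <- s) _.
have PE : P *m ga i = (-1) ^+ size s *: (ga i *m P).
  by rewrite clifford_anti_seq// scalerA -expr2 sqrr_sign scale1r.
rewrite -mulmxA (mulmxA P) PE -scalemxAl -scalemxAr !mulmxA clifford_sq//.
rewrite mulNmx mul1mx mulNmx IH// scalerN scalerA -scaleNr -mulN1r -exprD -exprS.
congr (_ ^+ _ *: _).
rewrite (_ : ((size s).+2 * _)%N = (size s).+1.*2 + (size s).+1 * size s)%N.
  by rewrite halfD odd_double doubleK.
by rewrite -muln2 -mulnDr add2n mulnC.
Qed.

(* (e^1 ... e^n)^2 = (-1)^(n(n+1)/2) = (-1)^(n/2), hence
   str (e^1 ... e^n) = i^(n/2) (-1)^(n/2) 2^(n/2) = (-2i)^(n/2). *)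
Lemma spin_to_form_str A :
  spin_to_form A (fidx [set: 'I_n]) (fidx finset.set0)
  = (- (2 * 'i)) ^- (n./2) * str ga A.
Proof.
rewrite mxE !fidxK cliff_prod0 mulmx1 /cliff_coef /str -raddfB /= -mulmxBl.
rewrite -scalerBr opprB addrC addrA subrK -mulr2n -(scaler_nat 2 (grading _)).
rewrite scalerA.
rewrite mulVf ?pnatr_eq0// scale1r /grading -scalemxAl mxtraceZ.
have n2 : n = n./2.*2 by rewrite even_halfK.
have sq : cliff_prod ga [set: 'I_n] *m cliff_prod ga [set: 'I_n]
    = (-1) ^+ n./2 *: 1%:M.
  rewrite /cliff_prod clifford_rev_seq ?enum_uniq// -cardE cardsT card_ord.
  congr (_ *: _); rewrite -[LHS]signr_odd -[RHS]signr_odd; congr (_ ^+ _).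
  rewrite {1 2}n2 -doubleMr doubleK -muln2.
  by rewrite oddM /= oddM andbF.
have -> : invmx (cliff_prod ga [set: 'I_n]) =
    (-1) ^+ n./2 *: cliff_prod ga [set: 'I_n].
  have u := cliff_prod_unit cc [set: 'I_n].
  apply: (can_inj (mulKmx u)); rewrite mulmxV// -scalemxAr sq scalerA.
  by rewrite -expr2 sqrr_sign scale1r.
rewrite -scalemxAl mxtraceZ !mulrA; congr (_ * _).
rewrite natrX -!exprVn -!exprMn; congr (_ ^+ _).
rewrite invrN invfM mulrN1 mulNr -mulrA; congr (- _).
by rewrite mulVf ?neq0Ci// mulr1.
Qed.

End SpinorModule.

(** * Closure properties shared by continuity and derivability *)

Section ComplexFunctions.
Variables (R : realType) (T : topologicalType) (x0 : T).
Local Notation C := R[i].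
Variable good : (T -> R) -> Prop.
Hypothesis good_cst : forall a, good (fun _ => a).
Hypothesis goodD : forall f g, good f -> good g -> good (fun x => f x + g x).
Hypothesis goodM : forall f g, good f -> good g -> good (fun x => f x * g x).
Hypothesis goodV : forall f, f x0 != 0 -> good f -> good (fun x => (f x)^-1).
Hypothesis good_near : forall f g,
  (\forall x \near x0, f x = g x) -> good f -> good g.

(** [good] is later either continuity at x0 or derivability at x0 in a coordinate direction, so
    stability under determinants and inverses is proved once for both. *)
Definition cgood (f : T -> C) : Prop :=
  good (fun x => complex.Re (f x)) /\ good (fun x => complex.Im (f x)).

Lemma cgood_cst a : cgood (fun _ => a). Proof. by split. Qed.

Lemma goodN f : good f -> good (fun x => - f x).
Proof.
move=> gf; rewrite (_ : (fun x => _) = fun x => -1 * f x); first exact: goodM.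
by apply/funext => x; rewrite mulN1r.
Qed.

Lemma cgoodD f g : cgood f -> cgood g -> cgood (fun x => f x + g x).
Proof.
move=> [f1 f2] [g1 g2]; split.
  rewrite (_ : (fun x => _) = fun x => complex.Re (f x) + complex.Re (g x)).
    exact: goodD.
  by apply/funext => x; case: (f x) (g x) => [? ?] [? ?].
rewrite (_ : (fun x => _) = fun x => complex.Im (f x) + complex.Im (g x)).
  exact: goodD.
by apply/funext => x; case: (f x) (g x) => [? ?] [? ?].
Qed.

Lemma cgoodM f g : cgood f -> cgood g -> cgood (fun x => f x * g x).
Proof.
move=> [f1 f2] [g1 g2]; split.
  rewrite (_ : (fun x => _) = fun x =>
      complex.Re (f x) * complex.Re (g x) - complex.Im (f x) * complex.Im (g x)).
    by apply: goodD; [exact: goodM|apply: goodN; exact: goodM].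
  by apply/funext => x; case: (f x) (g x) => [? ?] [? ?].
rewrite (_ : (fun x => _) = fun x =>
    complex.Re (f x) * complex.Im (g x) + complex.Im (f x) * complex.Re (g x)).
  by apply: goodD; exact: goodM.
by apply/funext => x; case: (f x) (g x) => [? ?] [? ?].
Qed.

Lemma cgoodV f : f x0 != 0 -> cgood f -> cgood (fun x => (f x)^-1).
Proof.
move=> f0 [f1 f2].
pose q x := (complex.Re (f x) * complex.Re (f x)
             + complex.Im (f x) * complex.Im (f x)).
have gq : good (fun x => (q x)^-1).
  apply: goodV; last by apply: goodD; exact: goodM.
  rewrite /q -!expr2 paddr_eq0 ?sqr_ge0// !sqrf_eq0.
  by apply: contraNN f0; case: (f x0) => a b /= /andP[/eqP -> /eqP ->].
split.
  rewrite (_ : (fun x => _) = fun x => complex.Re (f x) * (q x)^-1).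
    exact: goodM.
  by apply/funext => x; rewrite /q -!expr2; case: (f x).
rewrite (_ : (fun x => _) = fun x => - complex.Im (f x) * (q x)^-1).
  by apply: goodM => //; exact: goodN.
by apply/funext => x; rewrite /q -!expr2 mulNr; case: (f x).
Qed.

Lemma cgood_sum I (s : seq I) (P : pred I) (F : I -> T -> C) :
  (forall i, cgood (F i)) -> cgood (fun x => \sum_(i <- s | P i) F i x).
Proof.
move=> gF; elim: s => [|i s IH].
  rewrite (_ : (fun x => _) = fun=> 0); first exact: cgood_cst.
  by apply/funext => x; rewrite big_nil.
have [Pi|Pi] := boolP (P i).
  rewrite (_ : (fun x => _) = fun x => F i x + \sum_(j <- s | P j) F j x).
    exact: cgoodD.
  by apply/funext => x; rewrite big_cons Pi.
rewrite (_ : (fun x => _) = fun x => \sum_(j <- s | P j) F j x)//.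
by apply/funext => x; rewrite big_cons (negbTE Pi).
Qed.

Lemma cgood_prod I (s : seq I) (F : I -> T -> C) :
  (forall i, cgood (F i)) -> cgood (fun x => \prod_(i <- s) F i x).
Proof.
move=> gF; elim: s => [|i s IH].
  rewrite (_ : (fun x => _) = fun=> 1); first exact: cgood_cst.
  by apply/funext => x; rewrite big_nil.
rewrite (_ : (fun x => _) = fun x => F i x * \prod_(j <- s) F j x).
  exact: cgoodM.
by apply/funext => x; rewrite big_cons.
Qed.

Definition mxgood a b (F : T -> 'M[C]_(a, b)) : Prop :=
  forall i j, cgood (fun x => F x i j).

Lemma mxgoodM a b c (F : T -> 'M[C]_(a, b)) (G : T -> 'M[C]_(b, c)) :
  mxgood F -> mxgood G -> mxgood (fun x => F x *m G x).
Proof.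
move=> gF gG i j.
rewrite (_ : (fun x => _) = fun x => \sum_k F x i k * G x k j).
  by apply: cgood_sum => k; exact: cgoodM.
by apply/funext => x; rewrite mxE.
Qed.

Lemma mxgoodD a b (F G : T -> 'M[C]_(a, b)) :
  mxgood F -> mxgood G -> mxgood (fun x => F x + G x).
Proof.
move=> gF gG i j; rewrite (_ : (fun x => _) = fun x => F x i j + G x i j).
  exact: cgoodD.
by apply/funext => x; rewrite mxE.
Qed.

Lemma mxgoodZ a b (f : T -> C) (F : T -> 'M[C]_(a, b)) :
  cgood f -> mxgood F -> mxgood (fun x => f x *: F x).
Proof.
move=> gf gF i j; rewrite (_ : (fun x => _) = fun x => f x * F x i j).
  exact: cgoodM.
by apply/funext => x; rewrite mxE.
Qed.

Lemma mxgood_cst a b (A : 'M[C]_(a, b)) : mxgood (fun=> A).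
Proof. by move=> i j; exact: cgood_cst. Qed.

Lemma cgood_det a (F : T -> 'M[C]_a) : mxgood F -> cgood (fun x => \det (F x)).
Proof.
move=> gF; rewrite /determinant; apply: cgood_sum => s.
by apply: cgoodM; [exact: cgood_cst|exact: cgood_prod].
Qed.

Lemma mxgood_inv a (F : T -> 'M[C]_a) :
  (\forall x \near x0, F x \in unitmx) -> mxgood F ->
  mxgood (fun x => invmx (F x)).
Proof.
move=> uF gF i j.
(* [invmx] returns its argument when that is not a unit, so the cofactor formula is available only
   near x0; hence the hypothesis [good_near]. *)
have near_eq : \forall x \near x0,
    (\det (F x))^-1 * cofactor (F x) j i = invmx (F x) i j.
  by near=> x; rewrite /invmx (near uF x)// !mxE.
suff : cgood (fun x => (\det (F x))^-1 * cofactor (F x) j i).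
  move=> [g1 g2]; split; [apply: good_near g1|apply: good_near g2];
    by near=> x; rewrite (near near_eq x).
apply: cgoodM.
  apply: cgoodV; last exact: cgood_det.
  by rewrite -unitfE -unitmxE; exact: nbhs_singleton uF.
rewrite /cofactor; apply: cgoodM; first exact: cgood_cst.
by apply: cgood_det => k l; rewrite (_ : (fun x => _) =
  (fun x => F x (lift j k) (lift i l)))//; apply/funext => x; rewrite !mxE.
Unshelve. all: by end_near. Qed.

End ComplexFunctions.

(** * Continuity of matrix-valued functions *)

Section Continuity.
Variables (R : realType) (T : topologicalType).
Local Notation C := R[i].

Definition mxcont a b (x0 : T) (F : T -> 'M[C]_(a, b)) :=
  mxgood (fun f : T -> R => {for x0, continuous f}) F.

Definition ccont (x0 : T) (f : T -> C) :=
  cgood (fun f : T -> R => {for x0, continuous f}) f.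

Variable x0 : T.

Let contC (a : R) : {for x0, continuous (fun _ : T => a)}.
Proof. exact: cvg_cst. Qed.

Let contD (f g : T -> R) : {for x0, continuous f} -> {for x0, continuous g} ->
  {for x0, continuous (fun x => f x + g x)}.
Proof. by move=> cf cg; exact: continuousD. Qed.

Let contM (f g : T -> R) : {for x0, continuous f} -> {for x0, continuous g} ->
  {for x0, continuous (fun x => f x * g x)}.
Proof. by move=> cf cg; exact: continuousM. Qed.

Let contV (f : T -> R) : f x0 != 0 -> {for x0, continuous f} ->
  {for x0, continuous (fun x => (f x)^-1)}.
Proof. by move=> f0 cf; exact: continuousV. Qed.

Let cont_near (f g : T -> R) : (\forall x \near x0, f x = g x) ->
  {for x0, continuous f} -> {for x0, continuous g}.
Proof.
move=> fg; rewrite /prop_for /continuous_at /= -(nbhs_singleton fg).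
apply: cvg_trans.
by apply: near_eq_cvg; near=> x; rewrite (near fg x).
Unshelve. all: by end_near. Qed.

Lemma ccont_cst a : ccont x0 (fun=> a).
Proof. exact: cgood_cst. Qed.

Lemma ccontM f g : ccont x0 f -> ccont x0 g -> ccont x0 (fun x => f x * g x).
Proof. exact: cgoodM. Qed.

Lemma mxcont_cst a b (A : 'M[C]_(a, b)) : mxcont x0 (fun=> A).
Proof. exact: mxgood_cst. Qed.

Lemma mxcontD a b (F G : T -> 'M[C]_(a, b)) :
  mxcont x0 F -> mxcont x0 G -> mxcont x0 (fun x => F x + G x).
Proof. exact: mxgoodD. Qed.

Lemma mxcontZ a b f (F : T -> 'M[C]_(a, b)) :
  ccont x0 f -> mxcont x0 F -> mxcont x0 (fun x => f x *: F x).
Proof. exact: mxgoodZ. Qed.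

Lemma mxcontM a b c (F : T -> 'M[C]_(a, b)) (G : T -> 'M[C]_(b, c)) :
  mxcont x0 F -> mxcont x0 G -> mxcont x0 (fun x => F x *m G x).
Proof. exact: mxgoodM. Qed.

(** A nonzero determinant has a nonzero real or imaginary part, and whichever it is stays nonzero
    nearby by real continuity. *)
Lemma near_unitmx a (F : T -> 'M[C]_a) : mxcont x0 F -> F x0 \in unitmx ->
  \forall x \near x0, F x \in unitmx.
Proof.
move=> cF u0; have [dR dI] : ccont x0 (fun x => \det (F x)) by exact: cgood_det.
have : \det (F x0) != 0 by rewrite -unitfE -unitmxE.
have neq0 (f : T -> R) : {for x0, continuous f} -> f x0 != 0 ->
    \forall x \near x0, f x != 0.
  by move=> cf /(cvgr_neq0 _ cf).
have [rz|rnz _] := eqVneq (complex.Re (\det (F x0))) 0; last first.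
  near=> x; rewrite unitmxE unitfE.
  have : complex.Re (\det (F x)) != 0 by near: x; exact: neq0.
  by apply: contraNneq => ->.
have [iz|inz _] := eqVneq (complex.Im (\det (F x0))) 0.
  by case: (\det (F x0)) rz iz => a' b' /= -> ->; rewrite eqxx.
near=> x; rewrite unitmxE unitfE.
have : complex.Im (\det (F x)) != 0 by near: x; exact: neq0.
by apply: contraNneq => ->.
Unshelve. all: by end_near. Qed.

Lemma mxcont_inv a (F : T -> 'M[C]_a) : F x0 \in unitmx -> mxcont x0 F ->
  mxcont x0 (fun x => invmx (F x)).
Proof.
move=> u0 cF.
exact: (mxgood_inv contC contD contM contV cont_near (near_unitmx cF u0) cF).
Qed.

End Continuity.

(** * Directional derivatives of complex matrix functions *)

Section PartialDerivatives.
Variables (R : realType) (n : nat).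
Local Notation C := R[i].
Local Notation V := 'rV[R]_n.
Implicit Types (x v : V).

Definition cder x v (f : V -> C) (df : C) : Prop :=
  is_derive x v (fun y => complex.Re (f y)) (complex.Re df) /\
  is_derive x v (fun y => complex.Im (f y)) (complex.Im df).

Lemma cder_cst x v a : cder x v (fun=> a) 0.
Proof. by split; exact: is_derive_cst. Qed.

Lemma cderD x v f g df dg : cder x v f df -> cder x v g dg ->
  cder x v (fun y => f y + g y) (df + dg).
Proof.
move=> [f1 f2] [g1 g2]; split.
  rewrite (_ : (fun y => _) = (fun y => complex.Re (f y)) \+
                              (fun y => complex.Re (g y))); last first.
    by apply/funext => y /=; case: (f y) (g y) => [? ?] [? ?].
  by case: (df) (dg) f1 g1 => [? ?] [? ?] f1 g1 /=; exact: is_deriveD.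
rewrite (_ : (fun y => _) = (fun y => complex.Im (f y)) \+
                            (fun y => complex.Im (g y))); last first.
  by apply/funext => y /=; case: (f y) (g y) => [? ?] [? ?].
by case: (df) (dg) f2 g2 => [? ?] [? ?] f2 g2 /=; exact: is_deriveD.
Qed.

Lemma is_deriveM_fun x v (f g : V -> R) df dg :
  is_derive x v f df -> is_derive x v g dg ->
  is_derive x v (fun y => f y * g y) (f x * dg + df * g x).
Proof.
move=> f1 g1; rewrite [df * _]mulrC; exact: (is_deriveM f1 g1).
Qed.

Lemma is_deriveN_fun x v (f : V -> R) df :
  is_derive x v f df -> is_derive x v (fun y => - f y) (- df).
Proof. move=> f1; exact: (is_deriveN f1). Qed.

Lemma is_deriveD_fun x v (f g : V -> R) df dg :
  is_derive x v f df -> is_derive x v g dg ->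
  is_derive x v (fun y => f y + g y) (df + dg).
Proof. move=> f1 g1; exact: (is_deriveD f1 g1). Qed.

Lemma cderM x v f g df dg : cder x v f df -> cder x v g dg ->
  cder x v (fun y => f y * g y) (f x * dg + df * g x).
Proof.
move=> [f1 f2] [g1 g2]; split.
  rewrite (_ : (fun y => _) = (fun y => complex.Re (f y) * complex.Re (g y)
     + - (complex.Im (f y) * complex.Im (g y)))); last first.
    by apply/funext => y; case: (f y) (g y) => [? ?] [? ?].
  apply: (is_derive_eq (is_deriveD_fun (is_deriveM_fun f1 g1)
    (is_deriveN_fun (is_deriveM_fun f2 g2)))).
  case: (f x) (g x) (df) (dg) => [? ?] [? ?] [? ?] [? ?] /=.
  by rewrite opprD addrACA.
rewrite (_ : (fun y => _) = (fun y => complex.Re (f y) * complex.Im (g y)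
   + complex.Im (f y) * complex.Re (g y))); last first.
  by apply/funext => y; case: (f y) (g y) => [? ?] [? ?].
apply: (is_derive_eq (is_deriveD_fun (is_deriveM_fun f1 g2)
  (is_deriveM_fun f2 g1))).
case: (f x) (g x) (df) (dg) => [? ?] [? ?] [? ?] [? ?] /=.
by rewrite addrACA.
Qed.

Lemma cder_sum x v I (s : seq I) (P : pred I) (F : I -> V -> C) D :
  (forall i, cder x v (F i) (D i)) ->
  cder x v (fun y => \sum_(i <- s | P i) F i y) (\sum_(i <- s | P i) D i).
Proof.
move=> FD; elim: s => [|i s IH].
  rewrite big_nil (_ : (fun y => _) = fun=> 0); first exact: cder_cst.
  by apply/funext => y; rewrite big_nil.
rewrite big_cons (_ : (fun y => _) =
  fun y => if P i then F i y + \sum_(j <- s | P j) F j y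
           else \sum_(j <- s | P j) F j y); last first.
  by apply/funext => y; rewrite big_cons.
by case: ifP => // _; exact: cderD.
Qed.

Lemma cder_near x v f g df : (\forall y \near x, f y = g y) ->
  cder x v f df -> cder x v g df.
Proof.
move=> fg [f1 f2]; split; [apply: near_eq_is_derive f1|apply: near_eq_is_derive f2];
  by near=> y; rewrite (near fg y).
Unshelve. all: by end_near. Qed.

(** Only the derivative along v is assumed, not differentiability, so the difference quotients are
    compared directly: the one with step h is la times the one of f with step la h. *)
Lemma is_derive_dilation x v la (f : V -> R) df : la != 0 ->
  is_derive (la *: x) v f df -> is_derive x v (fun y => f (la *: y)) (la * df).
Proof.
move=> la0 [dfx <-].
pose q (h : R) := h^-1 *: ((f \o shift (la *: x)) (h *: v) - f (la *: x)).
have cq : q @ 0^' --> 'D_v f (la *: x) by exact: dfx.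
have cla : la * h @[h --> 0^'] --> (0 : R)^'.
  move=> A /= A0; have : \forall h \near (0 : R), la * h != 0 -> A (la * h).
    have cl : la * h @[h --> (0 : R)] --> (0 : R).
      by rewrite -[X in _ --> X](mulr0 la); apply: cvgM; [exact: cvg_cst|].
    exact: cl A0.
  rewrite /nbhs /= /dnbhs /within /= => H; near=> h => h0.
  by have := near H h; apply => //; rewrite mulf_neq0.
have cql : la * q (la * h) @[h --> 0^'] --> la * 'D_v f (la *: x).
  apply: cvgM; first exact: cvg_cst.
  exact: (cvg_comp _ _ cla cq).
have E : (fun h => h^-1 *: (((fun y => f (la *: y)) \o shift x) (h *: v)
             - f (la *: x))) = (fun h => la * q (la * h)).
  apply/funext => h; rewrite /q /= (scalerDr la) scalerA.
  have [->|h0] := eqVneq h 0.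
    by rewrite !mulr0 !scale0r !add0r subrr !scaler0 mulr0.
  by rewrite -[_ *: _ in RHS]/(_ * _) mulrA invfM mulVKf// mulrC.
apply: DeriveDef; rewrite /derivable /derive E; first by apply: cvgP cql.
exact: cvg_lim cql.
Unshelve. all: by end_near. Qed.

Definition pd_is i x a b (F : V -> 'M[C]_(a, b)) (D : 'M[C]_(a, b)) : Prop :=
  forall k l, cder x (delta_mx 0 i) (fun y => F y k l) (D k l).

Lemma pd_is_near i x a b (F G : V -> 'M[C]_(a, b)) D :
  (\forall y \near x, F y = G y) -> pd_is i x F D -> pd_is i x G D.
Proof.
move=> FG FD k l; apply: cder_near (FD k l).
by near=> y; rewrite (near FG y).
Unshelve. all: by end_near. Qed.

Lemma pd_is_cst i x a b (A : 'M[C]_(a, b)) : pd_is i x (fun=> A) 0.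
Proof. by move=> k l; rewrite mxE; exact: cder_cst. Qed.

Lemma pd_isD i x a b (F G : V -> 'M[C]_(a, b)) D E :
  pd_is i x F D -> pd_is i x G E -> pd_is i x (fun y => F y + G y) (D + E).
Proof.
move=> FD GE k l; rewrite mxE (_ : (fun y => _) = fun y => F y k l + G y k l).
  exact: cderD.
by apply/funext => y; rewrite mxE.
Qed.

Lemma pd_isM i x a b c (F : V -> 'M[C]_(a, b)) (G : V -> 'M[C]_(b, c)) D E :
  pd_is i x F D -> pd_is i x G E ->
  pd_is i x (fun y => F y *m G y) (F x *m E + D *m G x).
Proof.
move=> FD GE k l; rewrite !mxE -big_split /=.
rewrite (_ : (fun y => _) = fun y => \sum_j F y k j * G y j l).
  by apply: cder_sum => j; exact: cderM.
by apply/funext => y; rewrite mxE.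
Qed.

Lemma linear_mx_entries a b c d (Phi : {linear 'M[C]_(a, b) -> 'M[C]_(c, d)})
    (A : 'M[C]_(a, b)) k l :
  Phi A k l = \sum_i \sum_j A i j * Phi (delta_mx i j) k l.
Proof.
rewrite {1}(matrix_sum_delta A) linear_sum summxE; apply: eq_bigr => i _.
by rewrite linear_sum summxE; apply: eq_bigr => j _; rewrite linearZ mxE.
Qed.

Lemma pd_is_comp i x a b c d la
    (Phi : {linear 'M[C]_(a, b) -> 'M[C]_(c, d)}) F D : la != 0 ->
  pd_is i (la *: x) F D ->
  pd_is i x (fun y => Phi (F (la *: y))) (la%:C *: Phi D).
Proof.
move=> la0 FD k l; rewrite mxE linear_mx_entries mulr_sumr.
rewrite (_ : (fun y => _) =
    fun y => \sum_e \sum_f F (la *: y) e f * Phi (delta_mx e f) k l); last first.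
  by apply/funext => y; rewrite linear_mx_entries.
apply: cder_sum => e; rewrite mulr_sumr; apply: cder_sum => f.
have : cder x (delta_mx 0 i) (fun y => F (la *: y) e f) (la%:C * D e f).
  have [d1 d2] := FD e f; split.
    apply: is_derive_eq; first exact: is_derive_dilation d1.
    by case: (D e f) => ? ? /=; rewrite mul0r subr0.
  apply: is_derive_eq; first exact: is_derive_dilation d2.
  by case: (D e f) => ? ? /=; rewrite mul0r addr0.
move=> /cderM /(_ (@cder_cst x (delta_mx 0 i) (Phi (delta_mx e f) k l))).
by rewrite mulr0 add0r mulrA.
Qed.

(** The cofactor formula gives existence of the derivative; its value then follows by
    differentiating the product of F with its inverse, which is constant near x. *)
Lemma pd_is_inv i x a (F : V -> 'M[C]_a) D :
  (\forall y \near x, F y \in unitmx) -> pd_is i x F D ->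
  pd_is i x (fun y => invmx (F y)) (- (invmx (F x) *m D *m invmx (F x))).
Proof.
move=> uF FD.
have gF : mxgood (fun f : V -> R => derivable f x (delta_mx 0 i)) F.
  by move=> k l; have [d1 d2] := FD k l; split; exact: ex_derive.
have : mxgood (fun f : V -> R => derivable f x (delta_mx 0 i))
    (fun y => invmx (F y)).
  have hC (e : R) : derivable (fun=> e : R) x (delta_mx 0 i : V) by [].
  have hD (f h : V -> R) := @derivableD _ _ _ f h x (delta_mx 0 i).
  have hM (f h : V -> R) := @derivableM _ _ f h x (delta_mx 0 i).
  have hV (f : V -> R) := @derivableV _ _ f x (delta_mx 0 i).
  have hN (f h : V -> R) := @near_eq_derivable _ _ _ f h x (delta_mx 0 i).
  exact: (mxgood_inv hC hD hM hV hN uF gF).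
move=> gI.
have [E IE] : exists E, pd_is i x (fun y => invmx (F y)) E.
  exists (\matrix_(k, l) ('D_(delta_mx 0 i) (fun y => complex.Re (invmx (F y) k l)) x
      +i* 'D_(delta_mx 0 i) (fun y => complex.Im (invmx (F y) k l)) x)).
  by move=> k l; rewrite mxE; have [d1 d2] := gI k l; split; exact: derivableP.
suff <- : E = - (invmx (F x) *m D *m invmx (F x)) by [].
have ux := nbhs_singleton uF.
have := pd_isM FD IE => H.
have {}H : pd_is i x (fun=> 1%:M) (F x *m E + D *m invmx (F x)).
  by apply: pd_is_near H; near=> y; rewrite mulmxV//; near: y.
have : F x *m E + D *m invmx (F x) = 0.
  apply/matrixP => k l; have [d1 d2] := H k l.
  have [e1 e2] := @pd_is_cst i x a a 1%:M k l.
  have := @derive_val _ _ _ _ _ _ _ d1; have := @derive_val _ _ _ _ _ _ _ d2.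
  rewrite (@derive_val _ _ _ _ _ _ _ e1) (@derive_val _ _ _ _ _ _ _ e2) => r1 r2.
  by move: r1 r2; case: (_ k l) (_ k l) => [? ?] [? ?] /= <- <-.
move/eqP; rewrite addr_eq0 => /eqP /(congr1 (mulmx (invmx (F x)))).
by rewrite mulmxA mulVmx// mul1mx mulmxN mulmxA.
Unshelve. all: by end_near. Qed.

End PartialDerivatives.

(** * Iterated partial derivatives *)

Section IteratedPartials.
Variables (R : realType) (n : nat).
Local Notation C := R[i].
Local Notation V := 'rV[R]_n.

Definition pd a b (i : 'I_n) (F : V -> 'M[C]_(a, b)) : V -> 'M[C]_(a, b) :=
  fun x => \matrix_(k, l)
    ('D_(delta_mx 0 i) (fun y => complex.Re (F y k l)) x
     +i* 'D_(delta_mx 0 i) (fun y => complex.Im (F y k l)) x).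

Definition pds a b (s : seq 'I_n) (F : V -> 'M[C]_(a, b)) := foldr (@pd a b) F s.

Definition mseq m (al : mindex n m) : seq 'I_n :=
  flatten [seq nseq (al i) i | i <- enum 'I_n].

Lemma count_mseq m (al : mindex n m) i : count_mem i (mseq al) = al i.
Proof.
rewrite /mseq count_flatten -map_comp sumnE big_map big_enum /= (bigD1 i)//=.
rewrite count_nseq /= eqxx mul1n big1 ?addn0// => j /negbTE ji.
by rewrite count_nseq /= ji.
Qed.

Lemma size_mseq m (al : mindex n m) : size (mseq al) = weight al.
Proof.
rewrite /mseq size_flatten /shape -map_comp sumnE big_map big_enum /=.
by apply: eq_bigr => i _; rewrite /= size_nseq.
Qed.

Lemma pds_iter_partial a b s (F : V -> 'M[C]_(a, b)) x k l :
  pds s F x k l = iter_partial s (fun y => complex.Re (F y k l)) x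
               +i* iter_partial s (fun y => complex.Im (F y k l)) x.
Proof.
elim: s x => [|i s IH] x /=; first by case: (F x k l).
rewrite mxE; congr (_ +i* _);
  apply: (congr1 (fun f : V -> R => 'D_(delta_mx 0 i) f x));
  by apply/funext => y; rewrite IH.
Qed.

Lemma Dmx_pds m (al : mindex n m) a b (F : V -> 'M[C]_(a, b)) :
  Dmx al F = pds (mseq al) F.
Proof.
by apply/funext => x; apply/matrixP => k l; rewrite mxE pds_iter_partial.
Qed.

Lemma pd_is_val i x a b (F : V -> 'M[C]_(a, b)) D : pd_is i x F D -> pd i F x = D.
Proof.
move=> FD; apply/matrixP => k l; rewrite mxE; have [d1 d2] := FD k l.
rewrite (@derive_val _ _ _ _ _ _ _ d1) (@derive_val _ _ _ _ _ _ _ d2).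
by case: (D k l).
Qed.

(* Existence of all iterated partial derivatives; unlike [smooth_mx_on] it does
   not ask for their continuity. *)
Definition pd_smooth a b (W : set V) (F : V -> 'M[C]_(a, b)) :=
  forall s i x, W x -> pd_is i x (pds s F) (pd i (pds s F) x).

Lemma pd_smooth_iter_partial a b W (F : V -> 'M[C]_(a, b)) :
  (forall k l s i x, W x ->
     derivable (iter_partial s (fun y => complex.Re (F y k l))) x (delta_mx 0 i) /\
     derivable (iter_partial s (fun y => complex.Im (F y k l))) x (delta_mx 0 i)) ->
  pd_smooth W F.
Proof.
move=> sF s i x Wx k l; have [dR dI] := sF k l s i x Wx.
rewrite mxE; split => /=; apply: derivableP.
  rewrite (_ : (fun y => _) = iter_partial s (fun y => complex.Re (F y k l)))//.
  by apply/funext => y; rewrite pds_iter_partial.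
rewrite (_ : (fun y => _) = iter_partial s (fun y => complex.Im (F y k l)))//.
by apply/funext => y; rewrite pds_iter_partial.
Qed.

Lemma smooth_mx_on_pd_smooth a b W (F : V -> 'M[C]_(a, b)) :
  smooth_mx_on W F -> pd_smooth W F.
Proof.
move=> sF; apply: pd_smooth_iter_partial => k l s i x Wx.
have [sR sI] := sF k l.
by have [_ /(_ i) dR] := sR s x Wx; have [_ /(_ i) dI] := sI s x Wx.
Qed.

Lemma smooth_mx_on_cont a b W (F : V -> 'M[C]_(a, b)) x :
  smooth_mx_on W F -> W x -> mxcont x F.
Proof.
move=> sF Wx k l; have [sR sI] := sF k l.
have [cR _] := sR [::] x Wx; have [cI _] := sI [::] x Wx.
by split.
Qed.

Lemma pd_smooth_pd a b i W (F : V -> 'M[C]_(a, b)) :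
  pd_smooth W F -> pd_smooth W (pd i F).
Proof.
move=> sF s j x Wx; rewrite (_ : pds s (pd i F) = pds (rcons s i) F).
  exact: sF.
by rewrite /pds -cats1 foldr_cat.
Qed.

Lemma near_open_eq a b (W : set V) (F G : V -> 'M[C]_(a, b)) x : open W -> W x ->
  (forall y, W y -> F y = G y) -> \forall y \near x, F y = G y.
Proof.
move=> oW Wx FG; have : nbhs x W by exact: open_nbhs_nbhs.
by apply: filterS => y; exact: FG.
Qed.

(** Induction principle: a class stable under partial derivation on W contains, up to equality on W,
    all iterated partials of its members. Values off W are irrelevant because W is open. *)
Lemma pds_family a b (W : set V) (Q : (V -> 'M[C]_(a, b)) -> Prop) :
  open W ->
  (forall F, Q F -> forall i, exists2 G, Q G & forall x, W x -> pd_is i x F (G x)) ->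
  forall F F0, Q F0 -> (forall x, W x -> F x = F0 x) ->
  forall s, exists2 G, Q G & forall x, W x -> pds s F x = G x.
Proof.
move=> oW QW F F0 Q0 FF0; elim=> [|i s [G QG FG]] /=; first by exists F0.
have [H QH GH] := QW G QG i; exists H => // x Wx.
apply: pd_is_val; apply: pd_is_near (GH x Wx).
by apply: near_open_eq oW Wx _ => y Wy; rewrite FG.
Qed.

Lemma pd_smooth_family a b (W : set V) (Q : (V -> 'M[C]_(a, b)) -> Prop) :
  open W ->
  (forall F, Q F -> forall i, exists2 G, Q G & forall x, W x -> pd_is i x F (G x)) ->
  forall F F0, Q F0 -> (forall x, W x -> F x = F0 x) -> pd_smooth W F.
Proof.
move=> oW QW F F0 Q0 FF0 s i x Wx.
have [G QG FG] := pds_family oW QW Q0 FF0 s.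
have [H QH GH] := QW G QG i.
have FH : pd_is i x (pds s F) (H x).
  apply: pd_is_near (GH x Wx).
  by apply: near_open_eq oW Wx _ => y Wy; rewrite FG.
by rewrite (pd_is_val FH).
Qed.

Lemma open_dilation (la : R) (W : set V) :
  open W -> open [set x : V | W (la *: x)].
Proof.
move=> oW; apply: (@open_comp _ _ (fun x : V => la *: x) W) => // x _.
exact: scaler_continuous.
Qed.

Lemma pds_comp a b c d (W : set V) la
    (Phi : {linear 'M[C]_(a, b) -> 'M[C]_(c, d)}) F F' :
  la != 0 -> open W -> pd_smooth W F ->
  (forall y, W (la *: y) -> F' y = Phi (F (la *: y))) ->
  forall s y, W (la *: y) ->
    pds s F' y = la%:C ^+ size s *: Phi (pds s F (la *: y)).
Proof.
move=> la0 oW sF FF'; elim=> [|i s IH] y Wy /=; first by rewrite scale1r FF'.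
(* The power of la accumulated so far is absorbed into the linear map, so that the one-step chain
   rule applies again. *)
pose Psi A := la%:C ^+ size s *: Phi A.
have PsiL : linear Psi.
  by move=> u A B; rewrite /Psi linearP scalerDr !scalerA mulrC.
pose PL := GRing.isLinear.Build C _ _ _ Psi PsiL.
pose PsiF : {linear 'M[C]_(a, b) -> 'M[C]_(c, d)} := HB.pack Psi PL.
have := @pd_is_comp _ _ i y _ _ _ _ la PsiF _ _ la0 (sF s i _ Wy).
rewrite exprS -scalerA => H; apply: pd_is_val; apply: pd_is_near H.
by apply: near_open_eq (open_dilation oW) Wy _ => z Wz; rewrite IH.
Qed.

Lemma pds_linear a b c d (W : set V)
    (Phi : {linear 'M[C]_(a, b) -> 'M[C]_(c, d)}) F F' :
  open W -> pd_smooth W F -> (forall y, W y -> F' y = Phi (F y)) ->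
  forall s y, W y -> pds s F' y = Phi (pds s F y).
Proof.
move=> oW sF FF' s y Wy.
rewrite (@pds_comp _ _ _ _ W 1 Phi F F') ?scale1r ?expr1n ?scale1r ?oner_eq0//.
by move=> z; rewrite scale1r; exact: FF'.
Qed.

End IteratedPartials.

(** * Derivatives of divided-power monomials *)

Section Monomials.
Variables (R : realType) (n : nat).
Local Notation C := R[i].
Local Notation V := 'rV[R]_n.

Definition dpow (t : R) (j : nat) : R := t ^+ j / j`!%:R.

(** The dilation la and the centre c are there to cover both uses: the test functions of [op_coeffs]
    precomposed with a dilation, and, with la = 1 and c = 0, the monomials of the symbols. *)
Definition monomial (la : R) (c : V) (e : 'I_n -> nat) (y : V) : R :=
  \prod_k dpow (la * y 0 k - c 0 k) (e k).

Lemma is_derive_coord (x : V) i :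
  is_derive x (delta_mx 0 i) (fun y : V => y 0 i) (1 : R).
Proof.
have E : \forall h \near (0 : R)^', 1 = h^-1 *:
    (((fun y : V => y 0 i) \o shift x) (h *: delta_mx 0 i) - x 0 i).
  near=> h; rewrite /= !mxE !eqxx mulr1 addrK /GRing.scale /= mulVf//.
  by near: h; exact: nbhs_dnbhs_neq.
have c1 : (h^-1 *: (((fun y : V => y 0 i) \o shift x) (h *: delta_mx 0 i) - x 0 i))
    @[h --> (0 : R)^'] --> (1 : R).
  by apply: (cvg_trans (near_eq_cvg E)); exact: cvg_cst.
by apply: DeriveDef; [apply: cvgP c1|exact: cvg_lim c1].
Unshelve. all: by end_near. Qed.

Lemma is_derive_invariant (x v : V) (f : V -> R) :
  (forall h, f (h *: v + x) = f x) -> is_derive x v f 0.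
Proof.
move=> fE; have E : (fun h => h^-1 *: ((f \o shift x) (h *: v) - f x)) = cst 0.
  by apply/funext => h; rewrite /= fE subrr scaler0.
apply: DeriveDef; rewrite /derivable /derive E; first exact: is_cvg_cst.
exact: lim_cst.
Qed.

Lemma is_derive_dpow (x v : V) (f : V -> R) df j : is_derive x v f df ->
  is_derive x v (fun y => dpow (f y) j.+1) (df * dpow (f x) j).
Proof.
move=> fd; have pw k : is_derive x v (fun y => f y ^+ k.+1) (k.+1%:R * f x ^+ k * df).
  elim: k => [|k IH]; first by rewrite expr0 !mul1r.
  rewrite (_ : (fun y => _) = fun y => f y * f y ^+ k.+1).
    apply: (is_derive_eq (is_deriveM_fun fd IH)).
    by rewrite -[k.+2%:R]natr1 exprS; ring.
  by apply/funext => y; rewrite -exprS.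
rewrite /dpow; have := is_deriveM_fun (pw j) (is_derive_cst (j.+1`!%:R^-1 : R) x v).
move=> H; apply: (is_derive_eq H); rewrite mulr0 add0r factS natrM invfM.
have a0 : j.+1%:R != 0 :> R by rewrite pnatr_eq0.
have b0 : j`!%:R != 0 :> R by rewrite pnatr_eq0 -lt0n fact_gt0.
move: (j.+1%:R) (j`!%:R) (f x ^+ j) a0 b0 => p q r p0 q0.
by rewrite /cst; field; rewrite ?p0 ?q0.
Qed.

Lemma is_derive_monomial la c e i x :
  is_derive x (delta_mx 0 i) (monomial la c e)
    (if (e i == 0)%N then 0
     else la * monomial la c (fun k => (e k - (k == i))%N) x).
Proof.
pose A (y : V) := dpow (la * y 0 i - c 0 i) (e i).
pose B (y : V) := \prod_(k | k != i) dpow (la * y 0 k - c 0 k) (e k).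
have -> : monomial la c e = fun y => A y * B y.
  by apply/funext => y; rewrite /monomial (bigD1 i).
have Bd : is_derive x (delta_mx 0 i) B 0.
  apply: is_derive_invariant => h; apply: eq_bigr => k /negbTE ki.
  by rewrite !mxE eqxx ki mulr0 add0r.
have ld : is_derive x (delta_mx 0 i) (fun y : V => la * y 0 i - c 0 i) la.
  have H1 := is_deriveM_fun (is_derive_cst la x (delta_mx 0 i)) (is_derive_coord x i).
  have H2 := is_deriveD_fun H1 (is_derive_cst (- c 0 i) x (delta_mx 0 i)).
  by apply: (is_derive_eq H2); rewrite mul0r !addr0 mulr1.
case: (eqVneq (e i) 0) => [ei|].
  have -> : A = cst 1 by apply/funext => y; rewrite /A ei /dpow expr0 divr1.
  have H := is_deriveM_fun (is_derive_cst (1 : R) x (delta_mx 0 i)) Bd.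
  by apply: (is_derive_eq H); rewrite mulr0 mul0r addr0.
case ei: (e i) => [//|j] _.
have Ad : is_derive x (delta_mx 0 i) A (la * dpow (la * x 0 i - c 0 i) j).
  by rewrite /A ei; exact: is_derive_dpow.
apply: (is_derive_eq (is_deriveM_fun Ad Bd)).
rewrite mulr0 add0r -mulrA /monomial [in RHS](bigD1 i)//= eqxx ei subn1 /=.
congr (_ * (_ * _)); apply: eq_bigr => k /negbTE ki.
by rewrite ki subn0.
Qed.

(** The guard keeps truncated subtraction from turning an exponent differentiated too often into 0
    instead of killing the monomial. *)
Lemma iter_partial_monomial la c e s :
  iter_partial s (monomial la c e) =
  fun y => if [forall k, count_mem k s <= e k]%N
    then la ^+ size s * monomial la c (fun k => (e k - count_mem k s)%N) y else 0.
Proof.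
elim: s => [|i s IH] /=.
  apply/funext => y; rewrite (_ : [forall k, _]); last by apply/forallP.
  rewrite mul1r; congr (monomial _ _ _ _).
  by apply/funext => k; rewrite subn0.
apply/funext => y; rewrite IH.
case: (boolP [forall k, count_mem k s <= e k]%N) => [/forallP le_e|nle]; last first.
  rewrite (_ : [forall k, _] = false); first exact: derive_cst.
  apply: contraNF nle => /forallP H; apply/forallP => k.
  exact: leq_trans (leq_addl _ _) (H k).
have H := is_deriveM_fun (is_derive_cst (la ^+ size s) y (delta_mx 0 i))
  (is_derive_monomial la c (fun k => (e k - count_mem k s)%N) i y).
rewrite (@derive_val _ _ _ _ _ _ _ H) mul0r addr0.
case: ifPn => [ei|ei].
  rewrite mulr0 (_ : [forall k, _] = false)//.
  apply/negbTE; rewrite negb_forall; apply/existsP; exists i.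
  by rewrite eqxx -ltnNge add1n ltnS -subn_eq0.
rewrite (_ : [forall k, _]); last first.
  apply/forallP => k; have [<-|ik] := eqVneq i k; last exact: le_e.
  by rewrite add1n ltnNge -subn_eq0.
rewrite mulrA exprSr; congr (_ * monomial _ _ _ _); apply/funext => k.
by rewrite addnC subnDA eq_sym.
Qed.

Lemma monomial_center la c e y : la *: y = c ->
  monomial la c e y = ([forall k, e k == 0%N])%:R.
Proof.
move=> <-; rewrite /monomial; case: (boolP [forall k, _]) => [/forallP e0|].
  rewrite big1// => k _; rewrite (eqP (e0 k)) /dpow expr0 divr1//.
rewrite negb_forall => /existsP[k ek]; rewrite (bigD1 k)//= /dpow !mxE subrr.
by rewrite expr0n (negbTE ek) !mul0r.
Qed.

Lemma iter_partial0 s : iter_partial s (fun _ : V => 0 : R) = fun=> 0.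
Proof.
elim: s => [|i s IH] //=; apply/funext => y; rewrite IH; exact: derive_cst.
Qed.

Lemma monomial_pd_smooth a b la (c : V) (e : 'I_a -> 'I_b -> 'I_n -> nat)
    (F : V -> 'M[C]_(a, b)) :
  (forall y k l, F y k l = (monomial la c (e k l) y)%:C) ->
  pd_smooth [set: V] F.
Proof.
move=> FE; apply: pd_smooth_iter_partial => k l s i x _.
rewrite (_ : (fun y => _) = monomial la c (e k l)); last first.
  by apply/funext => y; rewrite FE.
rewrite (_ : (fun y => complex.Im _) = fun=> 0); last first.
  by apply/funext => y; rewrite FE.
rewrite iter_partial0 iter_partial_monomial; split; last first.
  exact: derivable_cst.
case: [forall j, _]; last exact: derivable_cst.
have H := is_deriveM_fun (is_derive_cst (la ^+ size s) x (delta_mx 0 i))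
  (is_derive_monomial la c (fun j => (e k l j - count_mem j s)%N) i x).
exact: (@ex_derive _ _ _ _ _ _ _ H).
Qed.

End Monomials.

(** * Noncommutative polynomials in the resolvent *)

Section ResolventPolynomials.
Variables (R : realType) (n d : nat).
Local Notation C := R[i].
Local Notation V := 'rV[R]_n.
Variables (W : set V) (A : V -> 'M[C]_d).
Hypothesis W_open : open W.
Hypothesis A_smooth : pd_smooth W A.
Hypothesis A_cont : forall x, W x -> mxcont x A.

Definition resolvent (x : V) (mu : C) : 'M[C]_d := invmx (A x - mu%:M).

Definition regular (mu : C) : set V := [set x | W x /\ A x - mu%:M \in unitmx].

(* Noncommutative polynomials in smooth functions of x and the resolvent of A,
   all of whose monomials have degree at least k in the resolvent. *)
Inductive resolvent_poly : nat -> (V -> C -> 'M[C]_d) -> Prop :=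
| rpoly0 k : resolvent_poly k (fun _ _ => 0)
| rpolyD k F G : resolvent_poly k F -> resolvent_poly k G ->
    resolvent_poly k (fun x mu => F x mu + G x mu)
| rpoly_smooth a : pd_smooth W a -> resolvent_poly 0 (fun x _ => a x)
| rpoly_resolvent : resolvent_poly 1 resolvent
| rpolyM k l F G : resolvent_poly k F -> resolvent_poly l G ->
    resolvent_poly (k + l) (fun x mu => F x mu *m G x mu)
| rpolyW k l F : (k <= l)%N -> resolvent_poly l F -> resolvent_poly k F.

Lemma pd_smooth_cst (M : 'M[C]_d) : pd_smooth W (fun=> M).
Proof.
apply: (@pd_smooth_family _ _ _ _ W (fun F => exists M', F = fun=> M')) => //.
  move=> F [M' ->] i; exists (fun=> 0); first by exists 0.
  by move=> x _; exact: pd_is_cst.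
by exists M.
Qed.

Lemma rpoly_cst (M : 'M[C]_d) : resolvent_poly 0 (fun _ _ => M).
Proof. exact: (rpoly_smooth (pd_smooth_cst M)). Qed.

Lemma open_regular mu : open (regular mu).
Proof.
rewrite openE => x [Wx ux]; rewrite /interior.
have nW : nbhs x W by exact: open_nbhs_nbhs.
have nu : \forall y \near x, A y - mu%:M \in unitmx.
  apply: (@near_unitmx _ _ x _ (fun y => A y - mu%:M)) => //.
  by apply: mxcontD; [exact: A_cont|exact: mxcont_cst].
by near=> y; split; near: y.
Unshelve. all: by end_near. Qed.

Lemma pd_is_resolvent i x mu : regular mu x ->
  pd_is i x (resolvent^~ mu)
    ((- 1%:M) *m (resolvent x mu *m (pd i A x *m resolvent x mu))).
Proof.
move=> rx; rewrite mulNmx mul1mx mulmxA; apply: pd_is_inv.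
  have : nbhs x (regular mu) by apply: open_nbhs_nbhs; split => //; exact: open_regular.
  by apply: filterS => y [].
rewrite -[pd i A x]addr0; apply: pd_isD; last exact: pd_is_cst.
by apply: (A_smooth [::]); case: rx.
Qed.

(** The derivative of the resolvent is minus resolvent, derivative of A, resolvent; so derivation
    never lowers the degree. G is chosen before mu, so that one polynomial and later one bound serve
    all spectral parameters. *)
Lemma rpoly_pd k F i : resolvent_poly k F -> exists2 G, resolvent_poly k G &
  forall mu x, regular mu x -> pd_is i x (F^~ mu) (G x mu).
Proof.
elim=> {k F}.
- move=> k; exists (fun _ _ => 0); first exact: rpoly0.
  by move=> mu x _; exact: pd_is_cst.
- move=> k F G _ [F' rF' FF'] _ [G' rG' GG'].
  exists (fun x mu => F' x mu + G' x mu); first exact: rpolyD.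
  by move=> mu x rx; apply: pd_isD; [exact: FF'|exact: GG'].
- move=> a sa; exists (fun x _ => pd i a x).
    exact: (rpoly_smooth (pd_smooth_pd i sa)).
  by move=> mu x [Wx _]; exact: (sa [::]).
- exists (fun x mu => (- 1%:M) *m (resolvent x mu *m (pd i A x *m resolvent x mu))).
    apply: (@rpolyW _ 2) => //.
    apply: (rpolyM (rpoly_cst (- 1%:M)) (rpolyM rpoly_resolvent _)).
    exact: (rpolyM (rpoly_smooth (pd_smooth_pd i A_smooth)) rpoly_resolvent).
  by move=> mu x; exact: pd_is_resolvent.
- move=> k l F G rF [F' rF' FF'] rG [G' rG' GG'].
  exists (fun x mu => F x mu *m G' x mu + F' x mu *m G x mu).
    by apply: rpolyD; exact: rpolyM.
  by move=> mu x rx; apply: pd_isM; [exact: FF'|exact: GG'].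
- move=> k l F kl _ [G rG FG]; exists G => //; exact: rpolyW rG.
Qed.

(** The equality is asked only at regular points: elsewhere [invmx] has a conventional value and the
    derivatives in the recursion are not controlled. *)
Definition on_regular k (f : V -> C -> 'M[C]_d) := exists2 F,
  resolvent_poly k F & forall mu x, regular mu x -> f x mu = F x mu.

Lemma on_regularM k l f g : on_regular k f -> on_regular l g ->
  on_regular (k + l) (fun x mu => f x mu *m g x mu).
Proof.
move=> [F rF fF] [G rG gG]; exists (fun x mu => F x mu *m G x mu).
  exact: rpolyM.
by move=> mu x rx; rewrite fF// gG.
Qed.

Lemma on_regularZ k c f : on_regular k f ->
  on_regular k (fun x mu => c *: f x mu).
Proof.
move=> [F rF fF]; exists (fun x mu => c%:M *m F x mu).
  exact: (rpolyM (rpoly_cst _) rF).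
by move=> mu x rx; rewrite fF// mul_scalar_mx.
Qed.

Lemma on_regular_sum k I (s : seq I) (P : pred I) (f : I -> V -> C -> 'M[C]_d) :
  (forall i, P i -> on_regular k (f i)) ->
  on_regular k (fun x mu => \sum_(i <- s | P i) f i x mu).
Proof.
move=> rf; elim: s => [|i s [G rG GE]].
  exists (fun _ _ => 0); first exact: rpoly0.
  by move=> mu x _; rewrite big_nil.
have [Pi|nPi] := boolP (P i).
  have [F rF FE] := rf i Pi; exists (fun x mu => F x mu + G x mu).
    exact: rpolyD.
  by move=> mu x rx; rewrite big_cons Pi FE// GE.
by exists G => // mu x rx; rewrite big_cons (negbTE nPi) GE.
Qed.

Lemma on_regular_pds k f s : on_regular k f ->
  on_regular k (fun x mu => pds s (f^~ mu) x).
Proof.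
move=> [F rF fF]; elim: s => [|i s [G rG GE]] /=; first by exists F.
have [H rH HE] := rpoly_pd i rG; exists H => // mu x rx.
apply: pd_is_val; apply: pd_is_near (HE mu x rx).
by apply: (near_open_eq (F := G^~ mu) (@open_regular mu) rx) => y ry; rewrite GE.
Qed.

Lemma on_regular_pd_smooth k f mu : on_regular k f ->
  pd_smooth (regular mu) (f^~ mu).
Proof.
move=> [F rF fF]; apply: (@pd_smooth_family _ _ _ _ _
    (fun F' => exists k G, resolvent_poly k G /\ F' = G^~ mu)); last first.
- by move=> x; exact: fF.
- by exists k, F.
- move=> F' [k' [G [rG ->]]] i; have [H rH HE] := rpoly_pd i rG.
  exists (H^~ mu); first by exists k', H.
  by move=> x rx; exact: HE.
- exact: open_regular.
Qed.

Local Notation normc := ComplexField.Normc.normc.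

Lemma normc_ge0 (z : C) : 0 <= normc z.
Proof. by case: z => a b; exact: sqrtr_ge0. Qed.

Lemma normc_sum I (s : seq I) (P : pred I) (f : I -> C) :
  normc (\sum_(i <- s | P i) f i) <= \sum_(i <- s | P i) normc (f i).
Proof.
elim/big_ind2: _ => [|a b e f0 ab ef|//]; first by rewrite ComplexField.Normc.normc0.
by apply: le_trans (le_normcD _ _) _; exact: lerD.
Qed.

Lemma mulmx_bound a b c (F : 'M[C]_(a, b)) (G : 'M[C]_(b, c)) K L :
  (forall i j, normc (F i j) <= K) -> (forall i j, normc (G i j) <= L) ->
  forall i j, normc ((F *m G) i j) <= b%:R * (K * L).
Proof.
move=> FK GL i j; rewrite mxE; apply: le_trans (normc_sum _ _ _) _.
rewrite -[b in b%:R]card_ord -sumr_const mulr_suml.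
apply: ler_sum => k _; rewrite mul1r ComplexField.Normc.normcM.
by apply: ler_pM; rewrite ?normc_ge0.
Qed.

(** K depends on x and B0 but not on mu. The ceiling B0 lets a monomial of higher degree l be
    bounded by the power k of B, at the price of the constant [B0 ^+ (l - k)]. *)
Lemma rpoly_bound k F x (B0 : R) : resolvent_poly k F -> 0 <= B0 ->
  exists2 K, 0 <= K & forall mu B, B <= B0 ->
    (forall i j, normc (resolvent x mu i j) <= B) ->
    0 <= B -> forall i j, normc (F x mu i j) <= K * B ^+ k.
Proof.
move=> rF B00; elim: rF => {k F}.
- move=> k; exists 0 => // mu B _ _ _ i j.
  by rewrite mxE ComplexField.Normc.normc0 mul0r.
- move=> k F G _ [K K0 FK] _ [L L0 GL]; exists (K + L); first exact: addr_ge0.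
  move=> mu B BB0 rB B_ge0 i j; rewrite mxE mulrDl.
  by apply: le_trans (le_normcD _ _) _; apply: lerD; [exact: FK|exact: GL].
- move=> a _; exists (\sum_i \sum_j normc (a x i j)).
    by do 2 (apply: sumr_ge0 => ? _); exact: normc_ge0.
  move=> mu B _ _ _ i j; rewrite mulr1 (bigD1 i)//= (bigD1 j)//= -addrA lerDl.
  apply: addr_ge0; first by apply: sumr_ge0 => ? _; exact: normc_ge0.
  by do 2 (apply: sumr_ge0 => ? _); exact: normc_ge0.
- by exists 1 => // mu B _ rB _ i j; rewrite mul1r.
- move=> k l F G _ [K K0 FK] _ [L L0 GL]; exists (d%:R * (K * L)).
    by rewrite !mulr_ge0.
  move=> mu B BB0 rB B_ge0 i j; rewrite -mulrA exprD mulrACA.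
  by apply: mulmx_bound => i' j'; [exact: FK|exact: GL].
- move=> k l F kl _ [K K0 FK]; exists (K * B0 ^+ (l - k)).
    by rewrite mulr_ge0// exprn_ge0.
  move=> mu B BB0 rB B_ge0 i j; apply: le_trans (FK _ _ BB0 rB B_ge0 i j) _.
  rewrite -mulrA ler_wpM2l// -{1}(subnK kl) exprD ler_wpM2r ?exprn_ge0//.
  by rewrite lerXn2r// nnegrE.
Qed.

Lemma rpoly_cont (T : topologicalType) (t0 : T) (f : T -> C) k F x :
  resolvent_poly k F -> ccont t0 f -> A x - (f t0)%:M \in unitmx ->
  mxcont t0 (fun t => F x (f t)).
Proof.
move=> rF cf ux; elim: rF => {k F}.
- by move=> k; exact: mxcont_cst.
- by move=> k F G _ cF _ cG; exact: mxcontD.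
- by move=> a _; exact: mxcont_cst.
- apply: mxcont_inv => //; apply: mxcontD; first exact: mxcont_cst.
  rewrite (_ : (fun t => _) = fun t => f t *: - 1%:M).
    by apply: mxcontZ => //; exact: mxcont_cst.
  by apply/funext => t; rewrite scalerN scalemx1.
- by move=> k l F G _ cF _ cG; exact: mxcontM.
- by [].
Qed.

End ResolventPolynomials.

(** * Derivatives of the symbol in the covector variable *)

Section SymbolCoefficients.
Variables (R : realType) (n m : nat).
Local Notation C := R[i].
Local Notation V := 'rV[R]_n.

(** Collecting all monomials in one row makes the symbol a linear image of it, so that a single
    application of [pds_linear] differentiates it. *)
Let monomials (eta : V) : 'rV[C]_#|mindex n m| :=
  \row_b (monomial 1 0 (fun k => (enum_val b : mindex n m) k : nat) eta)%:C.

Let normalization (al : mindex n m) : C :=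
  'i ^+ weight al * (\prod_k (al k)`!%:R)%:C.

Definition symbol_coef (s : seq 'I_n) (xi : V) (al : mindex n m) : C :=
  normalization al * pds s monomials xi 0 (enum_rank al).

Let monomialsE (al : mindex n m) (eta : V) :
  \prod_k ('i * (eta 0 k)%:C) ^+ al k
  = normalization al * monomials eta 0 (enum_rank al).
Proof.
rewrite mxE enum_rankK /normalization /monomial.
rewrite !rmorph_prod /= /weight -prodrXr -!big_split /=.
apply: eq_bigr => k _; rewrite mxE subr0 mul1r /dpow exprMn -mulrA; congr (_ * _).
by rewrite -rmorphM /= mulrCA divff ?mulr1 ?rmorphXn// pnatr_eq0 -lt0n fact_gt0.
Qed.

(** The scalars [symbol_coef] depend neither on Q nor on x, so they are common to the operator and
    its rescaling and never have to be computed. *)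
Lemma pds_hom_symbol d (Q : coeffs R n m d) s a x xi :
  pds s (fun eta => hom_symbol Q a x eta) xi =
  \sum_(al : mindex n m | (weight al + a == m)%N) symbol_coef s xi al *: Q al x.
Proof.
pose Phi (v : 'rV[C]_#|mindex n m|) : 'M[C]_d :=
  \sum_(al : mindex n m | (weight al + a == m)%N)
    (normalization al * v 0 (enum_rank al)) *: Q al x.
have PhiL : linear Phi.
  move=> c u v; rewrite /Phi scaler_sumr -big_split /=; apply: eq_bigr => al _.
  by rewrite !mxE mulrDr scalerDl scalerA mulrCA.
pose PL := GRing.isLinear.Build C _ _ _ Phi PhiL.
pose PhiF : {linear 'rV[C]_#|mindex n m| -> 'M[C]_d} := HB.pack Phi PL.
have ms : pd_smooth [set: V] monomials.
  apply: (@monomial_pd_smooth _ _ _ _ 1 0 (fun _ b k => (enum_val b : mindex n m) k : nat)).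
  by move=> y k l; rewrite mxE.
rewrite (@pds_linear _ _ _ _ _ _ [set: V] PhiF monomials) //; first exact: openT.
move=> eta _; apply: eq_bigr => al _.
by rewrite monomialsE.
Qed.

End SymbolCoefficients.

(** * Finite linear combinations of smooth or continuous functions *)

Section SmoothCombinations.
Variables (R : realType) (n : nat) (W : set 'rV[R]_n).
Hypothesis W_open : open W.

Lemma pd_smooth_sum a b (I : Type) (s : seq I) (P : pred I) (c : I -> R[i])
    (F : I -> 'rV[R]_n -> 'M[R[i]]_(a, b)) :
  (forall i, pd_smooth W (F i)) ->
  pd_smooth W (fun x => \sum_(i <- s | P i) c i *: F i x).
Proof.
move=> sF; apply: (@pd_smooth_family _ _ _ _ W (fun G =>
    exists2 F' : I -> 'rV[R]_n -> 'M[R[i]]_(a, b), (forall i, pd_smooth W (F' i))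
      & G = fun x => \sum_(i <- s | P i) c i *: F' i x)) => //; last by exists F.
move=> G [F' sF' ->] j.
exists (fun x => \sum_(i <- s | P i) c i *: pd j (F' i) x).
  by exists (fun i => pd j (F' i)) => // i; exact: pd_smooth_pd.
move=> x Wx k l; rewrite summxE.
rewrite (_ : (fun y => _) = fun y => \sum_(i <- s | P i) c i * F' i y k l).
  apply: cder_sum => i; rewrite mxE.
  have := cderM (cder_cst x (delta_mx 0 j) (c i)) (sF' i [::] j x Wx k l).
  by rewrite mul0r addr0.
by apply/funext => y; rewrite summxE; apply: eq_bigr => i _; rewrite mxE.
Qed.

Lemma mxcont_sum (T : topologicalType) (x : T) a b (I : Type) (s : seq I)
    (P : pred I) (c : I -> R[i]) (F : I -> T -> 'M[R[i]]_(a, b)) :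
  (forall i, mxcont x (F i)) ->
  mxcont x (fun y => \sum_(i <- s | P i) c i *: F i y).
Proof.
move=> cF; elim: s => [|i s IH].
  rewrite (_ : (fun y => _) = fun=> 0); first exact: mxcont_cst.
  by apply/funext => y; rewrite big_nil.
have [Pi|nPi] := boolP (P i).
  rewrite (_ : (fun y => _) = fun y => c i *: F i y + \sum_(i <- s | P i) c i *: F i y).
    by apply: mxcontD => //; apply: mxcontZ => //; exact: ccont_cst.
  by apply/funext => y; rewrite big_cons Pi.
rewrite (_ : (fun y => _) = fun y => \sum_(i <- s | P i) c i *: F i y)//.
by apply/funext => y; rewrite big_cons (negbTE nPi).
Qed.

End SmoothCombinations.

(** * Resolvent symbols as resolvent polynomials *)

Section ResolventSymbols.
Variables (R : realType) (n m d : nat) (Q : coeffs R n m d).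
Local Notation C := R[i].
Local Notation V := 'rV[R]_n.
Variable W : set V.
Hypothesis W_open : open W.
Hypothesis Q_smooth : forall al, smooth_mx_on W (Q al).

Lemma resolvent_uptoE k j : (j <= k)%N ->
  resolvent_upto Q k j = resolvent_symbol Q j.
Proof.
rewrite /resolvent_symbol; elim: k => [|k IH] jk.
  by move: jk; rewrite leqn0 => /eqP ->.
have [jk'|kj] := leqP j k; last by rewrite (eqP (_ : j == k.+1)) ?eqn_leq ?jk.
rewrite -IH//; apply/funext => x; apply/funext => xi; apply/funext => mu.
by rewrite /= jk'.
Qed.

Lemma resolvent_symbolS j x xi mu :
  resolvent_symbol Q j.+1 x xi mu =
  - invmx (hom_symbol Q 0 x xi - mu%:M) *m
  \sum_(b < j.+1) \sum_(a < j.+2)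
    \sum_(al : mindex n j.+1 | (a + b + weight al == j.+1)%N)
      ((- 'i) ^+ weight al / (mfact al)%:R) *:
        (pds (mseq al) (fun eta => hom_symbol Q a x eta) xi *m
         pds (mseq al) (fun y => resolvent_symbol Q b y xi mu) x).
Proof.
rewrite {1}/resolvent_symbol /= ltnn; congr (_ *m _).
apply: eq_bigr => b _; apply: eq_bigr => a _; apply: eq_bigr => al _.
rewrite !Dmx_pds; congr (_ *: (_ *m pds _ _ _)).
by apply/funext => y; rewrite resolvent_uptoE// -ltnS.
Qed.

Lemma hom_symbol_pd_smooth xi : pd_smooth W (fun x => hom_symbol Q 0 x xi).
Proof. by apply: pd_smooth_sum => // al; exact: smooth_mx_on_pd_smooth. Qed.

Lemma hom_symbol_cont xi x : W x -> mxcont x (fun x => hom_symbol Q 0 x xi).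
Proof. by move=> Wx; apply: mxcont_sum => al; exact: smooth_mx_on_cont Wx. Qed.

(** For j > 0 the recursion multiplies a resolvent by derivatives of earlier symbols, each of degree
    at least 1. The resulting degree 2 is the source of the quadratic decay along the ray. *)
Lemma resolvent_symbol_on_regular j xi :
  on_regular W (fun x => hom_symbol Q 0 x xi) (if j is 0 then 1 else 2)
    (fun x mu => resolvent_symbol Q j x xi mu).
Proof.
have sA := hom_symbol_pd_smooth xi; have cA := @hom_symbol_cont xi.
have res1 : on_regular W (fun x => hom_symbol Q 0 x xi) 1
    (fun x mu => invmx (hom_symbol Q 0 x xi - mu%:M)).
  by exists (resolvent (fun x => hom_symbol Q 0 x xi)) => //; exact: rpoly_resolvent.
elim/ltn_ind: j => -[_|j IH]; first exact: res1.
have rb b : (b < j.+1)%N -> on_regular W (fun x => hom_symbol Q 0 x xi) 1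
    (fun x mu => resolvent_symbol Q b x xi mu).
  move=> bj; have [F rF FE] := IH b bj; exists F => //.
  by apply: rpolyW rF; case: (b).
pose S x mu : 'M[C]_d := \sum_(b < j.+1) \sum_(a < j.+2)
    \sum_(al : mindex n j.+1 | (a + b + weight al == j.+1)%N)
      ((- 'i) ^+ weight al / (mfact al)%:R) *:
        (pds (mseq al) (fun eta => hom_symbol Q a x eta) xi *m
         pds (mseq al) (fun y => resolvent_symbol Q b y xi mu) x).
have rS : on_regular W (fun x => hom_symbol Q 0 x xi) 1 S.
  apply: on_regular_sum => b _; apply: on_regular_sum => a _.
  apply: on_regular_sum => al _; apply: on_regularZ => //.
  apply: (@on_regularM _ _ _ _ _ 0 1); last first.
    by apply: on_regular_pds => //; exact: rb.
  exists (fun x _ => pds (mseq al) (fun eta => hom_symbol Q a x eta) xi) => //.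
  apply: rpoly_smooth; rewrite (_ : (fun x => _) = fun x =>
    \sum_(be : mindex n m | (weight be + a == m)%N)
       symbol_coef (mseq al) xi be *: Q be x).
    by apply: pd_smooth_sum => // be; exact: smooth_mx_on_pd_smooth.
  by apply/funext => x; rewrite pds_hom_symbol.
have := on_regularZ W_open (-1) (on_regularM res1 rS).
move=> [F rF FE]; exists F => // mu x rx.
by rewrite -FE// resolvent_symbolS -/(S x mu) scaleN1r mulNmx.
Qed.

End ResolventSymbols.

(** * Behaviour of resolvent symbols under rescaling *)

Section Comparison.
Variables (R : realType) (n m d d' : nat).
Local Notation C := R[i].
Local Notation V := 'rV[R]_n.
Variables (Q : coeffs R n m d) (Q' : coeffs R n m d') (W : set V) (la : R).
Variable Phi : {linear 'M[C]_d -> 'M[C]_d'}.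
Hypothesis W_open : open W.
Hypothesis Q_smooth : forall al, smooth_mx_on W (Q al).
Hypothesis la_gt0 : 0 < la.
Hypothesis Phi1 : Phi 1%:M = 1%:M.
Hypothesis PhiM : forall A B, Phi (A *m B) = Phi A *m Phi B.
Hypothesis Q'E : forall al y, (weight al <= m)%N -> W (la *: y) ->
  Q' al y = (la ^- weight al)%:C *: Phi (Q al (la *: y)).

Let laC_neq0 k : la%:C ^+ k != 0 :> C.
Proof. by rewrite expf_neq0// (inj_eq (@complexI R)) gt_eqF. Qed.

Lemma alg_invmx A : A \in unitmx -> invmx (Phi A) = Phi (invmx A).
Proof.
move=> uA; have PA : Phi A *m Phi (invmx A) = 1%:M by rewrite -PhiM mulmxV.
by rewrite -[LHS]mulmx1 -PA mulKmx//; case: (mulmx1_unit PA).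
Qed.

Lemma alg_scalar c : Phi c%:M = c%:M.
Proof. by rewrite -[in LHS]scalemx1 linearZ /= Phi1 scalemx1. Qed.

Lemma pds_hom_symbol_rescaled s a y xi : W (la *: y) ->
  pds s (fun eta => hom_symbol Q' a y eta) xi =
  (la%:C ^+ a / la%:C ^+ m) *:
    Phi (pds s (fun eta => hom_symbol Q a (la *: y) eta) xi).
Proof.
move=> Wy; rewrite !pds_hom_symbol linear_sum scaler_sumr.
apply: eq_bigr => al /eqP am; rewrite Q'E//; last first.
  by have := leq_addr a (weight al); rewrite am.
have lam : la%:C ^+ m = la%:C ^+ weight al * la%:C ^+ a :> C by rewrite -exprD am.
rewrite [Phi (_ *: _)]linearZ /= !scalerA; congr (_ *: _); rewrite [RHS]mulrC.
congr (_ * _).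
by rewrite lam invfM mulrCA mulfV// mulr1 fmorphV rmorphXn.
Qed.

Lemma resolvent_symbol_rescaled j y xi mu :
  regular W (fun x => hom_symbol Q 0 x xi) (la%:C ^+ m * mu) (la *: y) ->
  resolvent_symbol Q' j y xi mu =
  la%:C ^+ (m + j) *:
    Phi (resolvent_symbol Q j (la *: y) xi (la%:C ^+ m * mu)).
Proof.
have la0 : la != 0 by rewrite gt_eqF.
(* The principal symbol of Q' minus mu equals la^-m times the image under Phi of the principal
   symbol of Q minus la^m mu. *)
have inv_rescaled z : regular W (fun x => hom_symbol Q 0 x xi) (la%:C ^+ m * mu) (la *: z) ->
    invmx (hom_symbol Q' 0 z xi - mu%:M) =
    la%:C ^+ m *: Phi (invmx (hom_symbol Q 0 (la *: z) xi - (la%:C ^+ m * mu)%:M)).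
  move=> [Wz uz]; have := @pds_hom_symbol_rescaled [::] 0 z xi Wz => /= ->.
  rewrite expr0 mul1r -(alg_invmx uz) raddfB /= alg_scalar.
  rewrite -[mu in LHS](mulKf (laC_neq0 m)) -[X in _ - X]scale_scalar_mx -scalerBr.
  set B := Phi _ - _; have uB : B \in unitmx.
    have -> : B = Phi (hom_symbol Q 0 (la *: z) xi - (la%:C ^+ m * mu)%:M).
      by rewrite raddfB /= alg_scalar.
    have PA := PhiM (hom_symbol Q 0 (la *: z) xi - (la%:C ^+ m * mu)%:M)
      (invmx (hom_symbol Q 0 (la *: z) xi - (la%:C ^+ m * mu)%:M)).
    by move: PA; rewrite mulmxV// Phi1 => /esym /mulmx1_unit [].
  rewrite invmxZ; last by rewrite unitmxZ// unitfE invr_eq0.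
  by congr (_ *: _); exact: invrK.
elim/ltn_ind: j y => -[_|j IH] y ry; first by rewrite addn0; exact: inv_rescaled.
rewrite !resolvent_symbolS (inv_rescaled _ ry) PhiM raddfN /= -!scalerN -scalemxAl.
rewrite exprD -scalerA; congr (_ *: _); rewrite scalemxAr; congr (_ *m _).
rewrite linear_sum scaler_sumr; apply: eq_bigr => b _.
rewrite linear_sum scaler_sumr; apply: eq_bigr => a _.
rewrite linear_sum scaler_sumr; apply: eq_bigr => al /eqP abal.
rewrite linearZ /= PhiM pds_hom_symbol_rescaled//; last by case: ry.
(* By induction the earlier symbol is this linear map applied after the dilation, which is the form
   that [pds_comp] differentiates. *)
pose Psi A := la%:C ^+ (m + b) *: Phi A.
have PsiL : linear Psi.
  by move=> u A B; rewrite /Psi linearP scalerDr !scalerA mulrC.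
pose PL := GRing.isLinear.Build C _ _ _ Psi PsiL.
pose PsiF : {linear 'M[C]_d -> 'M[C]_d'} := HB.pack Psi PL.
rewrite (@pds_comp _ _ _ _ _ _ (regular W (fun x => hom_symbol Q 0 x xi) (la%:C ^+ m * mu))
  la PsiF (fun x => resolvent_symbol Q b x xi (la%:C ^+ m * mu))) //; last first.
- by move=> z rz; rewrite IH.
- apply: (@on_regular_pd_smooth _ _ _ _ _ W_open _ _ _ _ _
    (resolvent_symbol_on_regular W_open Q_smooth b xi)).
    exact: hom_symbol_pd_smooth.
  by move=> x; exact: hom_symbol_cont.
- by apply: open_regular => // x; exact: hom_symbol_cont.
rewrite size_mseq /= /Psi -!scalemxAl -!scalemxAr !scalerA; congr (_ *: _).
(* The three powers come from the symbol component, the earlier resolvent symbol and the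
   x-derivatives; the summation condition makes them add up to j + 1. *)
have -> : la%:C ^+ j.+1 = la%:C ^+ a * la%:C ^+ b * la%:C ^+ weight al :> C.
  by rewrite -!exprD abal.
rewrite exprD; have := laC_neq0 m; move: (la%:C ^+ m) => u u0.
by move: (_ / (mfact al)%:R) => q; field.
Qed.

End Comparison.

(** * Coefficients of the rescaled operator *)

Section RescaledCoefficients.
Variables (R : realType) (n m : nat).
Local Notation C := R[i].
Local Notation V := 'rV[R]_n.

(** At the centre only be = al survives: one derivative too many gives 0, one too few leaves a
    factor that vanishes there. *)
Lemma Dmx_monomial (la : R) (x z : V) (al be : mindex n m) p (v : 'cV[C]_p) :
  la *: z = x ->
  Dmx be (fun y => (monomial la x (fun k => al k : nat) y)%:C *: v) z
  = (la ^+ weight be * (be == al)%:R)%:C *: v.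
Proof.
move=> zx; rewrite Dmx_pds.
pose F (y : V) : 'M[C]_1 := const_mx (monomial la x (fun k => al k : nat) y)%:C.
pose Phi (A : 'M[C]_1) : 'cV[C]_p := A 0 0 *: v.
have PhiL : linear Phi by move=> u A B; rewrite /Phi !mxE scalerDl scalerA.
pose PL := GRing.isLinear.Build C _ _ _ Phi PhiL.
pose PhiF : {linear 'M[C]_1 -> 'cV[C]_p} := HB.pack Phi PL.
have sF : pd_smooth [set: V] F.
  apply: (@monomial_pd_smooth _ _ _ _ la x (fun _ _ k => al k : nat)).
  by move=> y k l; rewrite mxE.
rewrite (@pds_linear _ _ _ _ _ _ [set: V] PhiF F) //; last 2 first.
- exact: openT.
- by move=> y _; rewrite /= /Phi mxE.
rewrite /= /Phi pds_iter_partial; congr (_ *: _).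
rewrite (_ : (fun y => _) = monomial la x (fun k => al k : nat)); last first.
  by apply/funext => y; rewrite mxE.
rewrite (_ : (fun y => complex.Im _) = fun=> 0); last first.
  by apply/funext => y; rewrite mxE.
rewrite iter_partial0 iter_partial_monomial; congr (_ +i* _).
rewrite (monomial_center _ zx) size_mseq.
have [->|beal] := eqVneq be al.
  rewrite (_ : [forall k, _]); last by apply/forallP => k; rewrite count_mseq.
  rewrite (_ : [forall k, _])//.
  by apply/forallP => k; rewrite count_mseq subnn.
case: ifPn => [/forallP le_al|_]; last by rewrite mulr0.
rewrite (_ : [forall k, _] = false)//; apply: contraNF beal => /forallP al_le.
apply/eqP/ffunP => k; apply/val_inj/eqP => /=.
have := le_al k; have := al_le k; rewrite !count_mseq subn_eq0 [in X in _ -> _ -> X]eqn_leq.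
by move=> -> ->.
Qed.

Variables (n_even : ~~ odd n) (ga : 'I_n -> 'M[C]_(2 ^ n./2)).
Hypothesis cc : clifford_rep ga.
Local Notation d := (2 ^ n./2)%N.
Variables (la : R) (la_gt0 : 0 < la).

Definition degree_scaling (c : R) : 'M[C]_(fdim n) :=
  diag_mx (\row_a (c ^+ #|fset_of a|)%:C).

Lemma degree_scalingE c p (B : 'M[C]_(fdim n, p)) a b :
  (degree_scaling c *m B) a b = (c ^+ #|fset_of a|)%:C * B a b.
Proof. by rewrite mul_diag_mx !mxE. Qed.

Lemma mul_degree_scalingE c p (B : 'M[C]_(p, fdim n)) a b :
  (B *m degree_scaling c) a b = B a b * (c ^+ #|fset_of b|)%:C.
Proof. by rewrite mul_mx_diag !mxE. Qed.

Lemma degree_scalingK c : c != 0 ->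
  degree_scaling c *m degree_scaling c^-1 = 1%:M.
Proof.
move=> c0; apply/matrixP => a b; rewrite degree_scalingE !mxE.
case: eqP => [->|]; last by rewrite mulr0.
by rewrite -rmorphM /= -exprMn mulfV// expr1n.
Qed.

Definition rescaled_spin_to_form (A : 'M[C]_d) : 'M[C]_(fdim n) :=
  degree_scaling la^-1 *m spin_to_form ga A *m degree_scaling la.

Lemma rescaled_spin_to_form_is_linear : linear rescaled_spin_to_form.
Proof.
move=> u A B; rewrite /rescaled_spin_to_form linearP mulmxDr mulmxDl.
by rewrite -scalemxAr -scalemxAl.
Qed.

HB.instance Definition _ := GRing.isLinear.Build C 'M[C]_d 'M[C]_(fdim n) _
  rescaled_spin_to_form rescaled_spin_to_form_is_linear.

Let la_neq0 : la != 0. Proof. by rewrite gt_eqF. Qed.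

Let scalingVK : degree_scaling la^-1 *m degree_scaling la = 1%:M.
Proof. by rewrite -{2}[la]invrK degree_scalingK// invr_eq0. Qed.

Lemma rescaled_spin_to_form1 : rescaled_spin_to_form 1%:M = 1%:M.
Proof. by rewrite /rescaled_spin_to_form spin_to_form1// mulmx1. Qed.

Lemma rescaled_spin_to_formM A B : rescaled_spin_to_form (A *m B) =
  rescaled_spin_to_form A *m rescaled_spin_to_form B.
Proof.
rewrite /rescaled_spin_to_form spin_to_formM//.
move: (spin_to_form ga A) (spin_to_form ga B) => X Y.
by rewrite !mulmxA -(mulmxA _ (degree_scaling la)) degree_scalingK// mulmx1.
Qed.

(** This is the map Psi that later carries values found for the rescaled operator back to P. *)
Definition rescaled_form_to_spin (B : 'M[C]_(fdim n)) : 'M[C]_d :=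
  form_to_spin ga (degree_scaling la *m B *m degree_scaling la^-1).

Lemma rescaled_form_to_spin_is_linear : linear rescaled_form_to_spin.
Proof.
move=> u A B; rewrite /rescaled_form_to_spin mulmxDr mulmxDl.
by rewrite -scalemxAr -scalemxAl linearP.
Qed.

HB.instance Definition _ := GRing.isLinear.Build C 'M[C]_(fdim n) 'M[C]_d _
  rescaled_form_to_spin rescaled_form_to_spin_is_linear.

Lemma rescaled_spin_to_formK : cancel rescaled_spin_to_form rescaled_form_to_spin.
Proof.
move=> A; rewrite -[RHS](spin_to_formK n_even cc) /rescaled_form_to_spin.
rewrite /rescaled_spin_to_form; congr form_to_spin.
move: (spin_to_form ga A) => X.
rewrite !mulmxA degree_scalingK// mul1mx -mulmxA degree_scalingK//.
exact: mulmx1.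
Qed.

Lemma rescaled_spin_to_form_top A :
  rescaled_spin_to_form A (fidx [set: 'I_n]) (fidx finset.set0) =
  (la ^- n)%:C * ((- (2 * 'i)) ^- (n./2) * str ga A).
Proof.
rewrite -spin_to_form_str// /rescaled_spin_to_form.
move: (spin_to_form ga A) => X; rewrite mul_degree_scalingE degree_scalingE.
by rewrite !fidxK cards0 expr0 mulr1 cardsT card_ord exprVn.
Qed.

Lemma op_coeffs_rescaled (PI : mindex n m -> {set 'I_n} -> V -> C) theta
    (al : mindex n m) x : (weight al <= m)%N ->
  op_coeffs (fop (U_sharp la (f_sharp la (cg PI theta)))) al x =
  (la ^- weight al)%:C *: rescaled_spin_to_form
    (\sum_(I : {set 'I_n}) PI al I (la *: x) *: cliff_prod ga I).
Proof.
move=> alm; have la0 : la != 0 by rewrite gt_eqF.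
apply/matrixP => i j; rewrite [LHS]mxE /= [LHS]mxE.
set w := (X in diff_apply _ X).
(* After the pull-back the test function centred at x is dilated by la^-1, so its centre is the
   point la x at which the operator is evaluated. *)
have wE : w = fun y => (monomial la^-1 x (fun k => al k : nat) y)%:C *:
    ((la ^+ #|fset_of j|)%:C *: delta_mx j 0).
  apply/funext => y; apply/matrixP => a b; rewrite !mxE mulrCA; congr (_%:C * _).
    by apply: eq_bigr => k _; rewrite mxE.
  by rewrite ord1; case: eqVneq => [->|]; rewrite ?andbT ?mulr0.
have xE : la^-1 *: (la *: x) = x by rewrite scalerA mulVf// scale1r.
rewrite /diff_apply (bigD1 al)//= [X in _ + X]big1; last first.
  move=> be; rewrite andbC => /andP[beal _].
  by rewrite wE (Dmx_monomial _ _ _ xE) (negbTE beal) mulr0 scale0r mulmx0.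
rewrite addr0 wE (Dmx_monomial _ _ _ xE) eqxx mulr1 -!scalemxAr.
have -> : \sum_(I : {set 'I_n}) PI al I (la *: x) *: cliff_prod (form_cliff R (n:=n)) I
    = spin_to_form ga (\sum_(I : {set 'I_n}) PI al I (la *: x) *: cliff_prod ga I).
  rewrite linear_sum; apply: eq_bigr => I _.
  by rewrite linearZ /= spin_to_form_prod.
rewrite /rescaled_spin_to_form; move: (spin_to_form ga _) => B.
rewrite -colE; set u := (la^-1 ^+ _)%:C; set v := (la ^+ #|fset_of j|)%:C.
have -> : (u *: (v *: col j B)) i 0 = u * (v * B i j) by rewrite !mxE.
rewrite [RHS]mxE mul_degree_scalingE degree_scalingE /u -!exprVn mulrCA.
by congr (_ * _); rewrite [v * _]mulrC mulrA.
Qed.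

End RescaledCoefficients.

(** * Dilation of integrals over a half-line *)

Section HalfLineIntegrals.
Variable R : realType.
Local Notation mu := (@lebesgue_measure R).

Definition cont_pos (g : R -> R) := forall t, 0 < t -> {for t, continuous g}.

Lemma cont_pos_within (g : R -> R) (rho : R) : 0 < rho -> cont_pos g ->
  {within `[rho, +oo[, continuous g}.
Proof.
move=> r0 cg; apply: continuous_in_subspaceT => t.
by rewrite inE/= in_itv/= andbT => rt; apply: cg; exact: lt_le_trans rt.
Qed.

Lemma cont_pos_measurable (g : R -> R) (rho : R) : 0 < rho -> cont_pos g ->
  measurable_fun (`[rho, +oo[ : set R) g.
Proof.
move=> r0 cg; apply: subspace_continuous_measurable_fun => //.
exact: cont_pos_within.
Qed.

Lemma is_derive_dil (s x : R) : is_derive x 1 (fun x : R => s * x) s.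
Proof.
have H := @is_deriveZ R R R id s x 1 1 (is_derive_id x 1).
by apply: (is_derive_eq H); rewrite /GRing.scale /= mulr1.
Qed.

Lemma derive1_dilation (s : R) : derive1 (fun x : R => s * x) = fun=> s.
Proof.
apply/funext => x; rewrite derive1E.
by rewrite (@derive_val _ _ _ _ _ _ _ (is_derive_dil s x)).
Qed.

Lemma ge0_integral_dilation (g : R -> R) (s rho : R) : 0 < s -> 0 < rho ->
  cont_pos g -> (forall t, 0 <= g t) ->
  (\int[mu]_(t in `[(s * rho)%R, +oo[) (g t)%:E =
   s%:E * \int[mu]_(t in `[rho, +oo[) (g (s * t)%R)%:E)%E.
Proof.
move=> s0 r0 cg g0.
have cgs : cont_pos (fun t => g (s * t)).
  move=> t t0; apply: continuous_comp; last by apply: cg; rewrite mulr_gt0.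
  by apply: cvgM; [exact: cvg_cst|].
have mgs : measurable_fun (`[rho, +oo[ : set R) (fun t => (g (s * t))%:E).
  by apply/measurable_EFinP; exact: cont_pos_measurable.
rewrite (@increasing_ge0_integration_by_substitutiony _ (fun x => s * x) g rho).
- rewrite derive1_dilation -ge0_integralZl//; last 2 first.
  + by move=> t _; rewrite lee_fin.
  + by rewrite lee_fin ltW.
  by apply: eq_integral => t _; rewrite -EFinM mulrC.
- by move=> x y _ _ xy; rewrite ltr_pM2l.
- by rewrite derive1_dilation => x _; exact: cvg_cst.
- by rewrite derive1_dilation; exact: is_cvg_cst.
- by rewrite derive1_dilation; exact: is_cvg_cst.
- split.
    by move=> x _; exact: (@ex_derive _ _ _ _ _ _ _ (is_derive_dil s x)).
  apply: cvg_at_right_filter; apply: cvgM; first exact: cvg_cst.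
  exact: cvg_id.
- by apply: gt0_cvgMry => //; exact: cvg_id.
- by apply: cont_pos_within => //; rewrite mulr_gt0.
- by [].
Qed.

Lemma integrable_ge0_dilation (g : R -> R) (s rho : R) : 0 < s -> 0 < rho ->
  cont_pos g -> mu.-integrable `[s * rho, +oo[ (EFin \o g) ->
  mu.-integrable `[rho, +oo[ (EFin \o (fun t => g (s * t))).
Proof.
move=> s0 r0 cg /integrableP[_ fin].
have cgs : cont_pos (fun t => g (s * t)).
  move=> t t0; apply: continuous_comp; last by apply: cg; rewrite mulr_gt0.
  by apply: cvgM; [exact: cvg_cst|].
apply/integrableP; split.
  by apply/measurable_EFinP; exact: cont_pos_measurable.
have cn : cont_pos (fun t => `|g t|).
  by move=> t t0; apply: continuous_comp; [exact: cg|exact: norm_continuous].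
have := @ge0_integral_dilation (fun t => `|g t|) s rho s0 r0 cn (fun=> normr_ge0 _).
have -> : (\int[mu]_(t in `[(s * rho)%R, +oo[) (`|g t|%R)%:E =
    \int[mu]_(t in `[(s * rho)%R, +oo[) `|(EFin \o g) t|)%E by [].
move=> E; move: fin; rewrite E => lt.
rewrite ltNge leye_eq; apply: contraTN lt => /eqP /= ->.
by rewrite gt0_muley ?lte_fin.
Qed.

(** The substitution for nonnegative functions is applied to the positive and negative parts,
    written as half of [|g|] plus or minus g so that they are visibly continuous. *)
Lemma Rintegral_dilation (g : R -> R) (s rho : R) : 0 < s -> 0 < rho ->
  cont_pos g -> mu.-integrable `[s * rho, +oo[ (EFin \o g) ->
  \int[mu]_(t in `[s * rho, +oo[) g t
  = s * \int[mu]_(t in `[rho, +oo[) g (s * t).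
Proof.
move=> s0 r0 cg ig.
have igs := integrable_ge0_dilation s0 r0 cg ig.
pose gp t := (g t + `|g t|) / 2; pose gn t := (`|g t| - g t) / 2.
have cn : cont_pos (fun t => `|g t|).
  by move=> t t0; apply: continuous_comp; [exact: cg|exact: norm_continuous].
have cp : cont_pos gp.
  move=> t t0; apply: cvgM; last exact: cvg_cst.
  by apply: cvgD; [exact: cg|exact: cn].
have cm : cont_pos gn.
  move=> t t0; apply: cvgM; last exact: cvg_cst.
  by apply: cvgB; [exact: cn|exact: cg].
have p0 t : 0 <= gp t.
  by rewrite divr_ge0// -lerBlDl sub0r -normrN ler_norm.
have n0 t : 0 <= gn t by rewrite divr_ge0// subr_ge0 ler_norm.
have gE t : g t = gp t - gn t by rewrite /gp /gn; field.
have int_part (D : set R) (f h : R -> R) : measurable D ->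
    mu.-integrable D (EFin \o f) -> measurable_fun D h ->
    (forall t, 0 <= h t) -> (forall t, h t <= `|f t|) ->
    mu.-integrable D (EFin \o h).
  move=> mD fi mh h0 hf; apply: (@le_integrable _ _ _ mu D mD _ (EFin \o f)) => //.
    exact/measurable_EFinP.
  by move=> t _; rewrite /= lee_fin ger0_norm.
have pl t : gp t <= `|g t|.
  by rewrite ler_pdivrMr// mulr_natr mulr2n lerD2r ler_norm.
have nl t : gn t <= `|g t|.
  rewrite ler_pdivrMr// mulr_natr mulr2n lerD2l.
  by rewrite -normrN ler_norm.
have R1 (h : R -> R) : cont_pos h -> (forall t, 0 <= h t) ->
    \int[mu]_(t in `[s * rho, +oo[) h t = s * \int[mu]_(t in `[rho, +oo[) h (s * t).
  move=> ch h0; rewrite /Rintegral ge0_integral_dilation//.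
  have := integral_ge0 mu (D := (`[rho, +oo[ : set R))
    (f := fun t => (h (s * t))%:E) (fun t _ => (h0 (s * t) : (0 <= (h (s * t))%:E)%E)).
  case: (\int[mu]_(t in _) _)%E => [a||] //= _.
  by rewrite gt0_muley ?lte_fin//= mulr0.
have sr : 0 < s * rho by rewrite mulr_gt0.
have mgs (h : R -> R) : cont_pos h ->
    measurable_fun (`[rho, +oo[ : set R) (fun t => h (s * t)).
  move=> ch; apply: cont_pos_measurable => // t t0.
  apply: continuous_comp; last by apply: ch; rewrite mulr_gt0.
  by apply: cvgM; [exact: cvg_cst|].
transitivity (\int[mu]_(t in `[s * rho, +oo[) (gp t - gn t)).
  by apply: eq_Rintegral => t _; exact: gE.
rewrite RintegralB//; last 2 first.
- by apply: int_part ig _ _ _ => //; exact: cont_pos_measurable.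
- by apply: int_part ig _ _ _ => //; exact: cont_pos_measurable.
rewrite !R1// -mulrBr -RintegralB//; last 2 first.
- by apply: int_part igs _ _ _ => //; exact: mgs.
- by apply: int_part igs _ _ _ => //; exact: mgs.
by congr (_ * _); apply: eq_Rintegral => t _; rewrite -gE.
Qed.

End HalfLineIntegrals.

(** * An integrable majorant on the positive half-line *)

Section DominatingFunction.
Variable R : realType.
Local Notation mu := (@lebesgue_measure R).

(** This is t^(-1/2)/(1+t), integrable both at 0 and at infinity, so its integrals from rho are
    bounded uniformly as rho shrinks. *)
Definition dominant (t : R) : R := expR (- (ln t / 2)) / (1 + t).

Let q (t : R) := expR (ln t / 2).

Let q_sq (t : R) : 0 < t -> q t ^+ 2 = t.
Proof. by move=> t0; rewrite /q -expRM_natl -mulr_natl mulrC divfK// lnK. Qed.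

Let q_cont : cont_pos q.
Proof.
move=> t t0; apply: continuous_comp; last exact: continuous_expR.
by apply: cvgM; [exact: continuous_ln|exact: cvg_cst].
Qed.

Lemma dominant_cont : cont_pos dominant.
Proof.
have -> : dominant = fun t => (q t)^-1 * (1 + t)^-1.
  by apply/funext => x; rewrite /q -expRN.
move=> t t0; apply: continuousM; apply: continuousV.
- by rewrite gt_eqF// expR_gt0.
- exact: q_cont.
- by rewrite gt_eqF// addr_gt0.
- by apply: continuousD; [exact: cst_continuous|].
Qed.

Lemma dominant_ge0 (t : R) : 0 <= t -> 0 <= dominant t.
Proof. by move=> t0; rewrite divr_ge0 ?expR_ge0// addr_ge0. Qed.

(** The substitution t = q^2 turns the majorant into 2/(1+q^2). *)
Let primitive (t : R) : R := 2 * atan (q t).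

Let is_derive_primitive (t : R) : 0 < t -> is_derive t 1 primitive (dominant t).
Proof.
move=> t0.
have H1 : is_derive t (1 : R) (fun x : R => ln x / 2) (t^-1 / 2).
  have l := is_derive1_ln t0.
  have H := @is_deriveZ R R R (@ln R) 2^-1 t 1 _ l.
  rewrite (_ : (fun x : R => _) = 2^-1 \*: (@ln R)).
    by apply: (is_derive_eq H); rewrite /GRing.scale /= mulrC.
  by apply/funext => x; rewrite /= /GRing.scale /= mulrC.
have H2 : is_derive t (1 : R) q (q t * (t^-1 / 2)).
  have H := @is_derive1_comp R (@expR R) (fun x => ln x / 2) t _ _
    (is_derive_expR _) H1.
  by apply: (is_derive_eq H); rewrite /GRing.scale /= mulrC.
have H3 := @is_derive1_comp R (@atan R) q t _ _ (is_derive1_atan _) H2.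
have H4 := @is_deriveZ R R R _ 2 t 1 _ H3.
apply: (is_derive_eq H4); rewrite /GRing.scale /= q_sq// /dominant expRN -/(q t).
have qt0 : q t != 0 by rewrite gt_eqF// expR_gt0.
have : q t ^+ 2 = t by exact: q_sq.
have t1 : 1 + t != 0 by rewrite gt_eqF// addr_gt0.
have tn : t != 0 by rewrite gt_eqF.
move=> E; have -> : t^-1 = (q t)^-1 * (q t)^-1 by rewrite -[in LHS]E expr2 invfM.
by move: (q t) qt0 => y y0; field; rewrite t1 y0.
Qed.

Let cvg_primitive : primitive x @[x --> +oo] --> (pi : R).
Proof.
have qy : q x @[x --> +oo] --> +oo.
  apply/cvgryPge => A; near=> x.
  have x0 : 0 < x by near: x; exact: nbhs_pinfty_gt.
  have xA : A ^+ 2 <= x by near: x; apply: nbhs_pinfty_ge; rewrite num_real.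
  rewrite leNgt; apply/negP => qA.
  have := q_sq x0; have := expR_ge0 (ln x / 2); rewrite -/(q x) => p E; nra.
rewrite [X in _ --> X](_ : pi = 2 * (pi / 2)); last by field.
apply: cvgM; first exact: cvg_cst.
exact: (cvg_comp _ _ qy (@cvgy_atan R)).
Unshelve. all: by end_near. Qed.

Lemma integral_dominant (rho : R) : 0 < rho ->
  (\int[mu]_(t in `[rho, +oo[) (dominant t)%:E = pi%:E - (primitive rho)%:E)%E.
Proof.
move=> r0; apply: ge0_continuous_FTC2y.
- by move=> t rt; rewrite dominant_ge0// ltW// (lt_le_trans r0).
- by apply: cont_pos_within => //; exact: dominant_cont.
- exact: cvg_primitive.
- move=> t rt; exact: (@ex_derive _ _ _ _ _ _ _ (is_derive_primitive (lt_trans r0 rt))).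
- apply: cvg_at_right_filter; apply: cvgM; first exact: cvg_cst.
  apply: continuous_comp; first exact: q_cont.
  exact: continuous_atan.
- move=> t; rewrite in_itv /= andbT => rt; rewrite derive1E.
  by rewrite (@derive_val _ _ _ _ _ _ _ (is_derive_primitive (lt_trans r0 rt))).
Qed.

Lemma integrable_dominant (rho : R) : 0 < rho ->
  mu.-integrable `[rho, +oo[ (EFin \o dominant).
Proof.
move=> r0; apply/integrableP; split.
  by apply/measurable_EFinP; apply: cont_pos_measurable => //; exact: dominant_cont.
have -> : (\int[mu]_(t in `[rho, +oo[) `|(EFin \o dominant) t|
    = \int[mu]_(t in `[rho, +oo[) (dominant t)%:E)%E.
  apply: eq_integral => t; rewrite inE /= in_itv /= andbT => rt.
  by rewrite ger0_norm// dominant_ge0// ltW// (lt_le_trans r0).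
by rewrite integral_dominant// -EFinB ltry.
Qed.

Lemma Rintegral_dominant (rho : R) : 0 < rho ->
  \int[mu]_(t in `[rho, +oo[) dominant t <= pi.
Proof.
move=> r0; rewrite /Rintegral integral_dominant// -EFinB /= gerBl.
by rewrite mulr_ge0// -(@atan0 R) le_atan// expR_ge0.
Qed.

Lemma inv_sqr_le_dominant (t : R) : 0 < t -> (1 + t) ^- 2 <= dominant t.
Proof.
move=> t0; have t1 : 0 < 1 + t by rewrite addr_gt0.
rewrite /dominant expr2 invfM ler_pM2r ?invr_gt0// expRN lef_pV2 ?posrE ?expR_gt0//.
rewrite -/(q t) -[X in _ + X](q_sq t0); nra.
Qed.

(** For t <= 1 the bound on u gives t^-u <= t^(-1/2); for t > 1 simply t^-u <= 1. *)
Lemma powN_le_dominant (t u : R) : 0 < t -> 0 <= u <= 2^-1 ->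
  expR (- u * ln t) * (1 + t) ^- 2 <= dominant t.
Proof.
move=> t0 /andP[u0 u1]; have t1 : 0 < 1 + t by rewrite addr_gt0.
have [tl|tg] := leP t 1.
  have l0 : ln t <= 0 by exact: ln_le0.
  have t1' := ltW t1; apply: ler_pM; rewrite ?expR_ge0 ?invr_ge0 ?exprn_ge0//.
    by rewrite ler_expR; nra.
  by rewrite expr2 invfM ler_piMl ?invr_ge0// invf_le1// lerDl ltW.
apply: le_trans (inv_sqr_le_dominant t0).
rewrite ler_piMl ?invr_ge0 ?exprn_ge0 ?(ltW t1)//.
by rewrite -expR0 ler_expR mulNr oppr_le0 mulr_ge0// ln_ge0// ltW.
Qed.

End DominatingFunction.

(** * Complex exponential and complex-valued integrals *)

Section ComplexIntegrals.
Variable R : realType.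
Local Notation C := R[i].
Local Notation mu := (@lebesgue_measure R).
Local Notation normc := ComplexField.Normc.normc.

Lemma normc_Re (z : C) : `|complex.Re z| <= normc z.
Proof. by case: z => a b /=; rewrite -sqrtr_sqr ler_wsqrtr// lerDl sqr_ge0. Qed.

Lemma normc_Im (z : C) : `|complex.Im z| <= normc z.
Proof. by case: z => a b /=; rewrite -sqrtr_sqr ler_wsqrtr// lerDr sqr_ge0. Qed.

Lemma normc_le (z : C) : normc z <= `|complex.Re z| + `|complex.Im z|.
Proof.
case: z => a b /=; rewrite -[leRHS]ger0_norm ?addr_ge0// -sqrtr_sqr ler_wsqrtr//.
rewrite sqrrD !real_normK ?num_real// [_ + _ *+ 2]addrC -addrA lerDr.
by rewrite mulrn_wge0// mulr_ge0.
Qed.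

Lemma normc_real (a : R) : normc a%:C = `|a|.
Proof. by rewrite /= expr0n addr0 sqrtr_sqr. Qed.

Lemma cexpD (a b : C) : cexp (a + b) = cexp a * cexp b.
Proof.
case: a b => [a a'] [b b']; rewrite /cexp /= expRD cosD sinD; simpc.
by congr (_ +i* _); ring.
Qed.

Lemma cexp0 : cexp (0 : C) = 1.
Proof. by rewrite /cexp /= expR0 cos0 sin0; simpc. Qed.

Lemma normc_cexp (z : C) : normc (cexp z) = expR (complex.Re z).
Proof.
rewrite /cexp ComplexField.Normc.normcM normc_real ger0_norm ?expR_ge0//=.
by rewrite cos2Dsin2 sqrtr1 mulr1.
Qed.

Lemma ccont_cexp (T : topologicalType) (t : T) (w : T -> C) :
  ccont t w -> ccont t (fun x => cexp (w x)).
Proof.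
move=> [wR wI]; apply: ccontM; split=> /=.
- by apply: continuous_comp; [exact: wR|exact: continuous_expR].
- exact: cst_continuous.
- by apply: continuous_comp; [exact: wI|exact: continuous_cos].
- by apply: continuous_comp; [exact: wI|exact: continuous_sin].
Qed.

Definition cintegrable (D : set R) (f : R -> C) :=
  mu.-integrable D (EFin \o (fun t => complex.Re (f t))) /\
  mu.-integrable D (EFin \o (fun t => complex.Im (f t))).

Variables (D : set R) (mD : measurable (D : set (measurableTypeR R))).

Lemma eq_cint f g : (forall t, D t -> f t = g t) -> cint D f = cint D g.
Proof.
by move=> fg; congr (_ +i* _); apply: eq_Rintegral => t;
  rewrite inE => Dt; rewrite fg.
Qed.

Lemma cintegrable0 : cintegrable D (fun=> 0).
Proof. by split; exact: integrable0. Qed.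

Lemma cint0 : cint D (fun=> 0) = 0 :> C.
Proof. by rewrite /cint /= Rintegral_cst// mul0r. Qed.

Lemma cintegrableD f g : cintegrable D f -> cintegrable D g ->
  cintegrable D (fun t => f t + g t).
Proof.
move=> [f1 f2] [g1 g2]; split.
  have := integrableD mD f1 g1; apply: eq_integrable => // t _ /=.
  by case: (f t) (g t) => [? ?] [? ?].
have := integrableD mD f2 g2; apply: eq_integrable => // t _ /=.
by case: (f t) (g t) => [? ?] [? ?].
Qed.

Lemma cintD f g : cintegrable D f -> cintegrable D g ->
  cint D (fun t => f t + g t) = cint D f + cint D g.
Proof.
move=> [f1 f2] [g1 g2]; rewrite /cint; simpc; congr (_ +i* _).
  rewrite -RintegralD//; apply: eq_Rintegral => t _.
  by case: (f t) (g t) => [? ?] [? ?].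
rewrite -RintegralD//; apply: eq_Rintegral => t _.
by case: (f t) (g t) => [? ?] [? ?].
Qed.

Lemma cintegrableZ c f : cintegrable D f -> cintegrable D (fun t => c * f t).
Proof.
case: c => a b [f1 f2]; split.
  have := integrableB mD (integrableZl mD a f1) (integrableZl mD b f2).
  by apply: eq_integrable => // t _ /=; case: (f t).
have := integrableD mD (integrableZl mD a f2) (integrableZl mD b f1).
by apply: eq_integrable => // t _ /=; case: (f t).
Qed.

Lemma cintZ c f : cintegrable D f -> cint D (fun t => c * f t) = c * cint D f.
Proof.
case: c => a b [f1 f2].
have i1 := integrableZl mD a f1; have i2 := integrableZl mD b f2.
have i3 := integrableZl mD a f2; have i4 := integrableZl mD b f1.
rewrite /cint; simpc; congr (_ +i* _).
  rewrite -!RintegralZl// -RintegralB//; apply: eq_Rintegral => t _.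
  by case: (f t).
rewrite -!RintegralZl// -RintegralD//; apply: eq_Rintegral => t _.
by case: (f t).
Qed.

(** The factor 2 comes from estimating real and imaginary parts separately. *)
Lemma cint_le f h (K : R) : cintegrable D f ->
  mu.-integrable D (EFin \o h) -> (forall t, D t -> normc (f t) <= h t) ->
  \int[mu]_(t in D) h t <= K -> normc (cint D f) <= 2 * K.
Proof.
move=> [f1 f2] ih fh hK; apply: le_trans (normc_le _) _.
have bound (g : R -> R) : mu.-integrable D (EFin \o g) ->
    (forall t, D t -> `|g t| <= h t) -> `|\int[mu]_(t in D) g t| <= K.
  move=> ig gh; apply: le_trans (le_normr_Rintegral mD ig) _.
  apply: le_trans hK; apply: le_Rintegral => //.
  exact: (integrable_norm ig).
rewrite mulr_natl mulr2n; apply: lerD => /=; apply: bound => // t Dt.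
  exact: le_trans (normc_Re _) (fh t Dt).
exact: le_trans (normc_Im _) (fh t Dt).
Qed.

Lemma cintegrable_dom (f : R -> C) (h : R -> R) : mu.-integrable D (EFin \o h) ->
  measurable_fun (D : set (measurableTypeR R))
    (fun t => complex.Re (f t) : measurableTypeR R) ->
  measurable_fun (D : set (measurableTypeR R))
    (fun t => complex.Im (f t) : measurableTypeR R) ->
  (forall t, D t -> normc (f t) <= h t) -> cintegrable D f.
Proof.
move=> ih mR mI fh.
split; apply: (@le_integrable _ _ _ mu D mD _ (EFin \o h)) => //;
  try exact/measurable_EFinP; move=> t Dt /=; rewrite lee_fin.
  apply: le_trans (normc_Re _) (le_trans (fh t Dt) (ler_norm _)).
apply: le_trans (normc_Im _) (le_trans (fh t Dt) (ler_norm _)).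
Qed.

End ComplexIntegrals.

(** * Dilation of complex half-line integrals *)

Section Dilation.
Variable R : realType.
Local Notation C := R[i].

Definition ccont_pos (f : R -> C) := forall t : R, 0 < t -> ccont t f.

Lemma cint_dilation (f : R -> C) (s rho : R) : 0 < s -> 0 < rho ->
  ccont_pos f -> cintegrable `[s * rho, +oo[ f ->
  cintegrable `[rho, +oo[ (fun t => f (s * t)) /\
  cint `[rho, +oo[ (fun t => f (s * t)) = (s^-1)%:C * cint `[s * rho, +oo[ f.
Proof.
move=> s0 r0 cf [f1 f2].
have c1 : cont_pos (fun t => complex.Re (f t)) by move=> t t0; case: (cf t t0).
have c2 : cont_pos (fun t => complex.Im (f t)) by move=> t t0; case: (cf t t0).
split.
  split; [exact: (integrable_ge0_dilation s0 r0 c1 f1)|].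
  exact: (integrable_ge0_dilation s0 r0 c2 f2).
rewrite /cint (Rintegral_dilation s0 r0 c1 f1) (Rintegral_dilation s0 r0 c2 f2).
by simpc; rewrite !mulKf ?gt_eqF.
Qed.

End Dilation.

(** * Contour integrals around the cut *)

Section Contour.
Variables (R : realType) (theta : R).
Local Notation C := R[i].
Local Notation mu := (@lebesgue_measure R).
Local Notation normc := ComplexField.Normc.normc.

(** The argument phi of the logarithm is separate from theta: on the two sides of the cut the points
    are the same and only phi differs, by 2 pi. *)
Definition ray_integrand (z : C) (phi : R) (f : C -> C) (t : R) : C :=
  cexp (z * (ln t +i* phi)) * f (ray t theta) * ray 1 theta.

Definition arc_integrand (z : C) (rho : R) (f : C -> C) (al : R) : C :=
  cexp (z * (ln rho +i* al)) * f (ray rho al) * ('i * ray rho al).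

Lemma contour_intE rho z f : contour_int theta rho z f =
  - cint `[rho, +oo[ (ray_integrand z theta f)
  - cint `[theta - 2 * pi, theta] (arc_integrand z rho f)
  + cint `[rho, +oo[ (ray_integrand z (theta - 2 * pi) f).
Proof. by []. Qed.

(* Continuity and the bound on the contours which make [contour_int] converge
   absolutely, with the decay needed at z = 0. *)
Record contour_regular (K delta : R) (f : C -> C) : Prop := ContourRegular {
  ray_cont : forall t : R, 0 < t -> ccont t (fun t => f (ray t theta)) ;
  ray_bound : forall t, 0 < t -> normc (f (ray t theta)) <= K * (1 + t) ^- 2 ;
  arc_cont : forall rho (al : R), 0 < rho < delta ->
    ccont al (fun al => f (ray rho al)) ;
  arc_bound : forall rho al, 0 < rho < delta -> normc (f (ray rho al)) <= K }.

Lemma normc_ray (t al : R) : normc (ray t al) = `|t|.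
Proof.
by rewrite /ray ComplexField.Normc.normcM normc_real normc_cexp expR0 mulr1.
Qed.

Lemma ray_scale (s t al : R) : ray (s * t) al = s%:C * ray t al.
Proof. by rewrite /ray rmorphM mulrA. Qed.

Lemma normc_i : normc ('i : C) = 1.
Proof.
have /eqP := ComplexField.Normc.normcM ('i : C) 'i.
rewrite -expr2 sqrCi normcN ComplexField.Normc.normc1 eq_sym -expr2 sqrp_eq1.
  by move/eqP.
exact: normc_ge0.
Qed.

Lemma ray_integrand_cont K delta z phi f : contour_regular K delta f ->
  ccont_pos (ray_integrand z phi f).
Proof.
move=> rf t t0; apply: ccontM; last exact: ccont_cst.
apply: ccontM; last exact: (ray_cont rf).
apply: ccont_cexp; apply: ccontM; first exact: ccont_cst.
by split; [exact: continuous_ln|exact: cst_continuous].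
Qed.

Lemma normc_ray_integrand z phi f t : normc (ray_integrand z phi f t) =
  expR (complex.Re z * ln t) * expR (- (complex.Im z * phi)) * normc (f (ray t theta)).
Proof.
rewrite /ray_integrand 2!ComplexField.Normc.normcM normc_ray normr1 mulr1.
by rewrite normc_cexp; case: z => a b /=; rewrite expRD.
Qed.

Lemma ray_integrable K delta z phi f (rho : R) : contour_regular K delta f ->
  complex.Re z <= 0 -> 0 < rho -> cintegrable `[rho, +oo[ (ray_integrand z phi f).
Proof.
move=> rf z0 r0.
have cf := ray_integrand_cont z phi rf.
(* Since Re z <= 0, the modulus of the power is largest at the lower end rho of the ray. *)
pose k := expR (complex.Re z * ln rho) * expR (- (complex.Im z * phi)) * K.
have K0 : 0 <= K.
  have := ray_bound rf ltr01; have := normc_ge0 (f (ray 1 theta)) => a b.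
  by have := le_trans a b; rewrite pmulr_lge0// invr_gt0 exprn_gt0// addr_gt0.
apply: (@cintegrable_dom _ _ _ _ (fun t => k * dominant t)) => //.
- by have := integrableZl _ k (integrable_dominant r0); apply.
- by apply: cont_pos_measurable => // t t0; case: (cf t t0).
- by apply: cont_pos_measurable => // t t0; case: (cf t t0).
- move=> t; rewrite /= in_itv /= andbT => rt; have t0 := lt_le_trans r0 rt.
  rewrite normc_ray_integrand /k -[leRHS]mulrA; apply: ler_pM.
  + by rewrite mulr_ge0 ?expR_ge0.
  + exact: normc_ge0.
  + by rewrite ler_wpM2r ?expR_ge0// ler_expR ler_wnM2l// ler_ln ?posrE.
  + apply: le_trans (ray_bound rf t0) _; rewrite ler_wpM2l//.
    exact: inv_sqr_le_dominant.
Qed.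

Lemma arc_integrand_cont K delta z rho f (al : R) : contour_regular K delta f ->
  0 < rho < delta -> ccont al (arc_integrand z rho f).
Proof.
move=> rf rd; apply: ccontM.
  apply: ccontM; last exact: (arc_cont rf).
  apply: ccont_cexp; apply: ccontM; first exact: ccont_cst.
  by split; [exact: cst_continuous|].
apply: ccontM; first exact: ccont_cst.
apply: ccontM; first exact: ccont_cst.
by apply: ccont_cexp; split; [exact: cst_continuous|].
Qed.

Lemma arc_integrable K delta z rho f : contour_regular K delta f ->
  0 < rho < delta -> cintegrable `[theta - 2 * pi, theta] (arc_integrand z rho f).
Proof.
move=> rf rd; split; apply: continuous_compact_integrable;
  try exact: segment_compact; apply: continuous_subspaceT => al;
  by case: (arc_integrand_cont z al rf rd).
Qed.

Lemma cint_sum I (s : seq I) (D : set R) (c : I -> C) (f : I -> R -> C) :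
  measurable (D : set (measurableTypeR R)) ->
  (forall i, cintegrable D (f i)) ->
  cintegrable D (fun t => \sum_(i <- s) c i * f i t) /\
  cint D (fun t => \sum_(i <- s) c i * f i t) = \sum_(i <- s) c i * cint D (f i).
Proof.
move=> mD fi; elim: s => [|i s [IH1 IH2]].
  rewrite big_nil (_ : (fun t => _) = fun=> 0); last first.
    by apply/funext => t; rewrite big_nil.
  by split; [exact: cintegrable0|exact: cint0].
rewrite (_ : (fun t => _) = fun t => c i * f i t + \sum_(i <- s) c i * f i t).
  split; first by apply: cintegrableD => //; exact: cintegrableZ.
  by rewrite big_cons cintD//; [rewrite IH2 cintZ|exact: cintegrableZ].
by apply/funext => t; rewrite big_cons.
Qed.

Lemma contour_int_sum I (s : seq I) (c : I -> C) (f : I -> C -> C) (K : I -> R)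
    (delta : R) z (rho : R) :
  (forall i, contour_regular (K i) delta (f i)) ->
  complex.Re z <= 0 -> 0 < rho < delta ->
  contour_int theta rho z (fun w => \sum_(i <- s) c i * f i w)
  = \sum_(i <- s) c i * contour_int theta rho z (f i).
Proof.
move=> rf z0 rd; have r0 : 0 < rho by case/andP: rd.
rewrite contour_intE.
have rayE phi : cint `[rho, +oo[ (ray_integrand z phi
      (fun w => \sum_(i <- s) c i * f i w))
    = \sum_(i <- s) c i * cint `[rho, +oo[ (ray_integrand z phi (f i)).
  rewrite -(cint_sum s c _ _).2//; last by move=> i; exact: ray_integrable (rf i) z0 r0.
  apply: eq_cint => t _; rewrite /ray_integrand mulr_sumr mulr_suml.
  by apply: eq_bigr => i _; ring.
have arcE : cint `[theta - 2 * pi, theta] (arc_integrand z rho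
      (fun w => \sum_(i <- s) c i * f i w))
    = \sum_(i <- s) c i * cint `[theta - 2 * pi, theta] (arc_integrand z rho (f i)).
  rewrite -(cint_sum s c _ _).2//; last by move=> i; exact: arc_integrable (rf i) rd.
  apply: eq_cint => t _; rewrite /arc_integrand mulr_sumr mulr_suml.
  by apply: eq_bigr => i _; ring.
rewrite !rayE arcE -!sumrN -!big_split /=; apply: eq_bigr => i _.
by rewrite contour_intE; ring.
Qed.

Lemma contour_regular_sum I (s : seq I) (c : I -> C) (f : I -> C -> C)
    (K : I -> R) (delta : R) :
  (forall i, contour_regular (K i) delta (f i)) ->
  contour_regular (\sum_(i <- s) normc (c i) * K i) delta
    (fun w => \sum_(i <- s) c i * f i w).
Proof.
move=> rf; split.
- move=> t t0; apply: cgood_sum; try by [].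
  + by move=> a; exact: cst_continuous.
  + by move=> g h cg ch; exact: continuousD.
  + by move=> i; apply: ccontM; [exact: ccont_cst|exact: (ray_cont (rf i))].
- move=> t t0; apply: le_trans (normc_sum _ _ _) _; rewrite mulr_suml.
  apply: ler_sum => i _; rewrite ComplexField.Normc.normcM -mulrA.
  by rewrite ler_wpM2l ?normc_ge0//; exact: ray_bound (rf i) _ t0.
- move=> rho al rd; apply: cgood_sum; try by [].
  + by move=> a; exact: cst_continuous.
  + by move=> g h cg ch; exact: continuousD.
  + by move=> i; apply: ccontM; [exact: ccont_cst|exact: (arc_cont (rf i))].
- move=> rho al rd; apply: le_trans (normc_sum _ _ _) _.
  apply: ler_sum => i _; rewrite ComplexField.Normc.normcM.
  by rewrite ler_wpM2l ?normc_ge0//; exact: arc_bound (rf i) _ _ rd.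
Qed.

Lemma eq_contour_int (rho : R) z f g : 0 < rho ->
  (forall t, 0 < t -> f (ray t theta) = g (ray t theta)) ->
  (forall al, f (ray rho al) = g (ray rho al)) ->
  contour_int theta rho z f = contour_int theta rho z g.
Proof.
move=> r0 fg1 fg2; rewrite !contour_intE; congr (- _ - _ + _).
- apply: eq_cint => t; rewrite /= in_itv /= andbT => rt.
  by rewrite /ray_integrand fg1// (lt_le_trans r0).
- by apply: eq_cint => al _; rewrite /arc_integrand fg2.
- apply: eq_cint => t; rewrite /= in_itv /= andbT => rt.
  by rewrite /ray_integrand fg1// (lt_le_trans r0).
Qed.

(** The substitution w -> s w carries the contour of radius rho to that of radius s rho. The power
    contributes s^-z and the differential 1/s. *)
Lemma contour_int_dilation K delta (s rho : R) z f :
  contour_regular K delta f -> complex.Re z <= 0 -> 0 < s -> 0 < rho ->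
  s * rho < delta ->
  contour_int theta rho z (fun w => f (s%:C * w)) =
  cexp (- z * (ln s)%:C) * (s^-1)%:C * contour_int theta (s * rho) z f.
Proof.
move=> rf z0 s0 r0 srd; have sr0 : 0 < s * rho by rewrite mulr_gt0.
have expE t al : 0 < t -> cexp (z * (ln t +i* al)) =
    cexp (- z * (ln s)%:C) * cexp (z * (ln (s * t) +i* al)).
  move=> t0; rewrite -cexpD lnM ?posrE//; congr cexp.
  by case: z {z0} => a b; simpc; congr (_ +i* _); ring.
have rayE phi : cint `[rho, +oo[ (ray_integrand z phi (fun w => f (s%:C * w)))
    = cexp (- z * (ln s)%:C) * (s^-1)%:C *
      cint `[s * rho, +oo[ (ray_integrand z phi f).
  have [fi fE] := cint_dilation s0 r0 (ray_integrand_cont z phi rf)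
    (ray_integrable phi rf z0 sr0).
  rewrite -mulrA -fE -cintZ//; apply: eq_cint => t; rewrite /= in_itv /= andbT => rt.
  rewrite /ray_integrand expE ?(lt_le_trans r0)// ray_scale; ring.
have arcE : cint `[theta - 2 * pi, theta] (arc_integrand z rho (fun w => f (s%:C * w)))
    = cexp (- z * (ln s)%:C) * (s^-1)%:C *
      cint `[theta - 2 * pi, theta] (arc_integrand z (s * rho) f).
  rewrite -cintZ//; last by apply: (arc_integrable _ rf); rewrite sr0.
  apply: eq_cint => al _; rewrite /arc_integrand expE// ray_scale.
  have sE : (s^-1)%:C * s%:C = 1 :> C by rewrite -rmorphM /= mulVf ?gt_eqF.
  rewrite -[LHS]mulr1 -sE; ring.
by rewrite !contour_intE !rayE arcE; ring.
Qed.

Lemma contour_int_bound K delta f u (rho : R) : contour_regular K delta f ->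
  0 < u <= 2^-1 -> 0 < rho < delta -> rho <= 1 ->
  normc (contour_int theta rho (- u)%:C f) <=
  2 * K * pi * normc (cexp (0 +i* (2 * pi * u)) - 1) +
  2 * (2 * pi * K * expR (ln rho / 2)).
Proof.
move=> rf /andP[u0 u1] rd r1; have /andP[r0 rdelta] := rd.
have z0 : complex.Re ((- u)%:C : C) <= 0 by rewrite /= oppr_le0 ltW.
have K0 : 0 <= K by apply: le_trans (normc_ge0 _) (arc_bound rf 0 rd).
set w := cexp (0 +i* (2 * pi * u)).
(* On the outgoing side the integrand is a constant multiple of the incoming one, with a factor
   tending to 1 as u tends to 0; this is the cancellation across the cut. *)
have gE : ray_integrand (- u)%:C (theta - 2 * pi) f =
    fun t => w * ray_integrand (- u)%:C theta f t.
  apply/funext => t; rewrite /ray_integrand [RHS]mulrA [w * _]mulrA -cexpD; congr (cexp _ * _ * _).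
  by simpc; congr (_ +i* _); ring.
have ig := ray_integrable theta rf z0 r0.
rewrite contour_intE gE cintZ//; set I1 := cint _ _; set I2 := cint _ _.
have -> : - I1 - I2 + w * I1 = (w - 1) * I1 - I2 by ring.
apply: le_trans (le_normcD _ _) _; rewrite normcN ComplexField.Normc.normcM mulrC.
apply: lerD.
  rewrite ler_wpM2r ?normc_ge0// -!mulrA.
  apply: (@cint_le _ _ _ _ (fun t => K * dominant t)) => //.
  - by have := integrableZl _ K (integrable_dominant r0); apply.
  - move=> t; rewrite /= in_itv /= andbT => rt; have t0 := lt_le_trans r0 rt.
    rewrite normc_ray_integrand /= mul0r oppr0 expR0 mulr1.
    have u01 : 0 <= u <= 2^-1 by rewrite ltW.
    apply: le_trans (ler_wpM2l (expR_ge0 _) (ray_bound rf t0)) _.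
    rewrite mulrCA ler_wpM2l//; exact: powN_le_dominant.
  - rewrite RintegralZl//; last exact: integrable_dominant.
    by rewrite ler_wpM2l// Rintegral_dominant.
apply: (@cint_le _ _ _ _ (fun=> K * expR (ln rho / 2))) => //.
- exact: arc_integrable rf rd.
- apply: continuous_compact_integrable; first exact: segment_compact.
  by apply: continuous_subspaceT => x; exact: cst_continuous.
- move=> al _; rewrite /arc_integrand ComplexField.Normc.normcM.
  rewrite [normc (cexp _ * _)]ComplexField.Normc.normcM.
  rewrite [normc ('i * _)]ComplexField.Normc.normcM normc_i mul1r.
  rewrite normc_ray (gtr0_norm r0) normc_cexp mulrAC mulrC.
  apply: ler_pM; rewrite ?normc_ge0 ?mulr_ge0 ?expR_ge0 ?(ltW r0)//.
    exact: (arc_bound rf al rd).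
  (* On the circle rho^-u times rho is at most rho^(1/2), because u <= 1/2 and rho <= 1. *)
  rewrite -{2}(lnK r0) -expRD ler_expR /= mul0r subr0.
  by have l0 := ln_le0 r1; nra.
- rewrite Rintegral_cst//.
  have muE : mu `[theta - 2 * pi, theta] = (2 * pi)%:E.
    rewrite lebesgue_measure_itv /= lte_fin.
    have -> : theta - 2 * pi < theta by rewrite ltrBlDr ltrDl mulr_gt0// pi_gt0.
    by rewrite -EFinB; congr EFin; lra.
  rewrite [X in fine X](_ : _ = (2 * pi)%:E); last exact: muE.
  by rewrite /=; lra.
Qed.

End Contour.

(** * Decay of the resolvent of a matrix along a ray *)

Section ResolventDecay.
Variable R : realType.
Local Notation C := R[i].
Local Notation normc := ComplexField.Normc.normc.

Definition mxnorm1 a b (M : 'M[C]_(a, b)) : R := \sum_i \sum_j normc (M i j).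

Lemma mxnorm1_ge0 a b (M : 'M[C]_(a, b)) : 0 <= mxnorm1 M.
Proof. by do 2 (apply: sumr_ge0 => ? _); exact: normc_ge0. Qed.

Lemma le_mxnorm1 a b (M : 'M[C]_(a, b)) i j : normc (M i j) <= mxnorm1 M.
Proof.
rewrite /mxnorm1 (bigD1 i)//= (bigD1 j)//= -addrA lerDl.
apply: addr_ge0; first by apply: sumr_ge0 => ? _; exact: normc_ge0.
by do 2 (apply: sumr_ge0 => ? _); exact: normc_ge0.
Qed.

Lemma mxnorm1D a b (M N : 'M[C]_(a, b)) : mxnorm1 (M + N) <= mxnorm1 M + mxnorm1 N.
Proof.
rewrite -big_split; apply: ler_sum => i _; rewrite -big_split; apply: ler_sum => j _.
by rewrite mxE; exact: le_normcD.
Qed.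

Lemma mxnorm1Z a b c (M : 'M[C]_(a, b)) : mxnorm1 (c *: M) = normc c * mxnorm1 M.
Proof.
rewrite mulr_sumr; apply: eq_bigr => i _; rewrite mulr_sumr.
by apply: eq_bigr => j _; rewrite mxE ComplexField.Normc.normcM.
Qed.

Lemma mxnorm1M a b c (M : 'M[C]_(a, b)) (N : 'M[C]_(b, c)) :
  mxnorm1 (M *m N) <= mxnorm1 M * mxnorm1 N.
Proof.
rewrite /mxnorm1 mulr_suml; apply: ler_sum => i _.
apply: (@le_trans _ _ (\sum_j \sum_k normc (M i k) * normc (N k j))).
  apply: ler_sum => j _; rewrite mxE; apply: le_trans (normc_sum _ _ _) _.
  by apply: ler_sum => k _; rewrite ComplexField.Normc.normcM.
rewrite exchange_big mulr_suml; apply: ler_sum => k _; rewrite -mulr_sumr.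
rewrite ler_wpM2l ?normc_ge0// (bigD1 k)//= lerDl.
by do 2 (apply: sumr_ge0 => ? _); exact: normc_ge0.
Qed.

Lemma mxnorm1_eq0 a b (M : 'M[C]_(a, b)) : mxnorm1 M <= 0 -> M = 0.
Proof.
move=> M0; apply/matrixP => i j; rewrite mxE; apply: ComplexField.Normc.eq0_normc.
by apply/eqP; rewrite eq_le normc_ge0 andbT (le_trans (le_mxnorm1 M i j)).
Qed.

Lemma unitmx_eigenvalue d (A : 'M[C]_d) c :
  (A - c%:M \in unitmx) = ~~ eigenvalue A c.
Proof. by rewrite -row_free_unit -kermx_eq0 negbK. Qed.

(** A Neumann estimate without the series: an eigenvector v for c satisfies v = c v A^-1 and would
    have norm at most half its own, and the inverse B satisfies B = A^-1 + c A^-1 B. *)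
Lemma unitmx_small_shift d (A : 'M[C]_d) c : A \in unitmx ->
  normc c * mxnorm1 (invmx A) <= 2^-1 ->
  A - c%:M \in unitmx /\ mxnorm1 (invmx (A - c%:M)) <= 2 * mxnorm1 (invmx A).
Proof.
move=> uA cA; have uc : A - c%:M \in unitmx.
  rewrite unitmx_eigenvalue; apply/negP => /eigenvalueP[v vA] /eqP; apply.
  apply: mxnorm1_eq0.
  have vE : v = c *: (v *m invmx A) by rewrite scalemxAl -vA mulmxK.
  have : mxnorm1 v <= normc c * (mxnorm1 v * mxnorm1 (invmx A)).
    by rewrite {1}vE mxnorm1Z ler_wpM2l ?normc_ge0// mxnorm1M.
  by have := mxnorm1_ge0 v; nra.
split=> //; set B := invmx (A - c%:M).
have BE : B = invmx A + c *: (invmx A *m B).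
  have : invmx A *m ((A - c%:M) *m B) = invmx A by rewrite mulmxV// mulmx1.
  rewrite mulmxA mulmxBr mulVmx// mulmxBl mul1mx mul_mx_scalar -scalemxAl.
  by move=> E; rewrite -[X in X + _]E subrK.
have : mxnorm1 B <= mxnorm1 (invmx A)
    + normc c * (mxnorm1 (invmx A) * mxnorm1 B).
  rewrite {1}BE; apply: le_trans (mxnorm1D _ _) _; rewrite mxnorm1Z lerD2l.
  by rewrite ler_wpM2l ?normc_ge0// mxnorm1M.
by have := mxnorm1_ge0 B; nra.
Qed.

Lemma ray0 al : ray (0 : R) al = 0.
Proof. by rewrite /ray mul0r. Qed.

Lemma ccont_ray (theta t : R) : ccont t (fun t => ray t theta).
Proof.
apply: ccontM; last exact: ccont_cst.
by split; [|exact: cst_continuous].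
Qed.

Lemma ccont_near (T : topologicalType) (t : T) (f g : T -> C) :
  (\forall s \near t, f s = g s) -> ccont t f -> ccont t g.
Proof.
move=> fg [f1 f2]; split.
  rewrite /prop_for /continuous_at /= -(nbhs_singleton fg).
  apply: cvg_trans f1; apply: near_eq_cvg; near=> x.
  by rewrite (near fg x).
rewrite /prop_for /continuous_at /= -(nbhs_singleton fg).
apply: cvg_trans f2; apply: near_eq_cvg; near=> x.
by rewrite (near fg x).
Unshelve. all: by end_near. Qed.

Lemma mxcont_resolvent_ray d (A : 'M[C]_d) theta (t : R) :
  A - (ray t theta)%:M \in unitmx ->
  mxcont t (fun t => invmx (A - (ray t theta)%:M)).
Proof.
move=> u; apply: mxcont_inv => //; apply: mxcontD; first exact: mxcont_cst.
rewrite (_ : (fun t => _) = fun t => ray t theta *: - 1%:M).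
  by apply: mxcontZ; [exact: ccont_ray|exact: mxcont_cst].
by apply/funext => s; rewrite scalerN scalemx1.
Qed.

Lemma resolvent_decay d (A : 'M[C]_d) (theta : R) :
  (forall t, 0 <= t -> A - (ray t theta)%:M \in unitmx) ->
  exists B, exists2 delta, 0 < delta &
  [/\ 0 <= B,
     forall t, 0 < t -> forall i j,
       normc (invmx (A - (ray t theta)%:M) i j) <= B / (1 + t)
   & forall rho al, 0 < rho < delta -> A - (ray rho al)%:M \in unitmx /\
       forall i j, normc (invmx (A - (ray rho al)%:M) i j) <= B].
Proof.
move=> uA; have uA0 : A \in unitmx.
  by have := uA 0 (lexx _); rewrite ray0 raddf0 subr0.
pose N t := mxnorm1 (invmx (A - (ray t theta)%:M)).
pose T := 1 + 2 * mxnorm1 A.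
have T1 : 1 <= T by rewrite lerDl mulr_ge0// mxnorm1_ge0.
pose D := mxnorm1 (1%:M : 'M[C]_d).
have D0 : 0 <= D by exact: mxnorm1_ge0.
have large t : T <= t -> N t <= (4 * D) / (1 + t).
  move=> Tt; have t0 : 0 < t by lra.
  have u := uA t (ltW t0); set B := invmx (A - (ray t theta)%:M).
  have : ray t theta *: B = A *m B + (-1) *: 1%:M.
    have := mulmxV u; rewrite mulmxBl mul_scalar_mx => E.
    by rewrite scaleN1r -[in RHS]E opprB addrC subrK.
  move=> /(congr1 (@mxnorm1 d d)); rewrite mxnorm1Z normc_ray gtr0_norm// => E.
  have : t * mxnorm1 B <= mxnorm1 A * mxnorm1 B + D.
    rewrite E; apply: le_trans (mxnorm1D _ _) _; apply: lerD; first exact: mxnorm1M.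
    by rewrite mxnorm1Z normcN ComplexField.Normc.normc1 mul1r.
  have B0 := mxnorm1_ge0 B; have A0 := mxnorm1_ge0 A.
  rewrite ler_pdivlMr; last by lra.
  rewrite /N -/B; move: Tt; rewrite /T => Tt; nra.
have [M MN] : exists M, forall t, 0 <= t <= T -> N t <= M.
  (* Continuity is known for real and imaginary parts, so the norm is replaced by this larger
     continuous function before taking a maximum. *)
  pose f t : R := \sum_i \sum_j
    (`|complex.Re (invmx (A - (ray t theta)%:M) i j)| +
     `|complex.Im (invmx (A - (ray t theta)%:M) i j)|).
  have Nf t : N t <= f t.
    by apply: ler_sum => i _; apply: ler_sum => j _; exact: normc_le.
  have cf : {within `[0, T], continuous f}.
    apply: continuous_in_subspaceT => t; rewrite inE /= in_itv /= => /andP[t0 _].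
    have cr := mxcont_resolvent_ray (uA t t0).
    have sum_cont (I : Type) (s : seq I) (F : I -> R -> R) :
        (forall i, {for t, continuous (F i)}) ->
        {for t, continuous (fun t => \sum_(i <- s) F i t)}.
      move=> cF; elim: s => [|i s IH].
        rewrite (_ : (fun t => _) = fun=> 0); first exact: cst_continuous.
        by apply/funext => x; rewrite big_nil.
      rewrite (_ : (fun t => _) = fun t => F i t + \sum_(i <- s) F i t).
        exact: continuousD.
      by apply/funext => x; rewrite big_cons.
    apply: (sum_cont) => i; apply: (sum_cont) => j; have [c1 c2] := cr i j.
    by apply: continuousD; apply: continuous_comp => //; exact: norm_continuous.
  have T0 : 0 <= T by lra.
  have [c _ fc] := EVT_max T0 cf; exists (f c) => t tT.
  by apply: le_trans (Nf t) _; apply: fc; rewrite in_itv.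
have M0 : 0 <= M.
  by apply: le_trans (mxnorm1_ge0 _) (MN 0 _); rewrite lexx /=; lra.
pose K := mxnorm1 (invmx A); have K0 : 0 <= K by exact: mxnorm1_ge0.
(* One term for each region: large t, bounded t, small circle. The radius makes rho K at most 1/2,
   as [unitmx_small_shift] requires. *)
exists (4 * D + M * (1 + T) + 2 * K); exists ((2 * (1 + K))^-1).
  by rewrite invr_gt0; lra.
split.
- by rewrite !addr_ge0 ?mulr_ge0//; lra.
- move=> t t0 i j; apply: le_trans (le_mxnorm1 _ _ _) _; rewrite -/(N t).
  have t1 : 0 < 1 + t by lra.
  have [Tt|tT] := leP T t.
    apply: le_trans (large t Tt) _; rewrite ler_pM2r ?invr_gt0// -addrA lerDl.
    by rewrite addr_ge0 ?mulr_ge0//; lra.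
  have NM : N t <= M by apply: MN; rewrite (ltW t0) (ltW tT).
  rewrite ler_pdivlMr//.
  have : N t * (1 + t) <= M * (1 + T).
    by apply: ler_pM => //; [exact: mxnorm1_ge0|lra|lra].
  by lra.
- move=> rho al /andP[r0 rd].
  have [] := @unitmx_small_shift d A (ray rho al) uA0.
    rewrite normc_ray gtr0_norm// -/K.
    have : rho * (2 * (1 + K)) < 1 by rewrite -ltr_pdivlMr ?mul1r//; lra.
    by nra.
  move=> u NB; split=> // i j; apply: le_trans (le_mxnorm1 _ _ _) _.
  apply: le_trans NB _; rewrite -/K lerDr addr_ge0 ?mulr_ge0//; lra.
Qed.

End ResolventDecay.

(** * Power symbols and their limit at exponent zero *)

Section PowerSymbols.
Variables (R : realType) (n m d : nat) (Q : coeffs R n m d) (theta : R).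
Local Notation C := R[i].
Local Notation V := 'rV[R]_n.
Local Notation normc := ComplexField.Normc.normc.
Variable W : set V.
Hypothesis W_open : open W.
Hypothesis Q_smooth : forall al, smooth_mx_on W (Q al).

Lemma resolvent_symbol_contour_regular j x xi : (0 < j)%N -> W x ->
  (forall t, 0 <= t -> hom_symbol Q 0 x xi - (ray t theta)%:M \in unitmx) ->
  exists K, exists2 delta, 0 < delta &
    (forall a b, contour_regular theta K delta
       (fun mu => resolvent_symbol Q j x xi mu a b)) /\
    (forall rho al, 0 < rho < delta ->
       hom_symbol Q 0 x xi - (ray rho al)%:M \in unitmx).
Proof.
move=> j0 Wx uray.
have sA := hom_symbol_pd_smooth W_open Q_smooth xi.
have cA := @hom_symbol_cont _ _ _ _ _ _ Q_smooth xi.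
have [F rF FE] := resolvent_symbol_on_regular W_open Q_smooth j xi.
have {}rF : resolvent_poly W (fun x => hom_symbol Q 0 x xi) 2 F by case: j j0 rF FE.
have [B [delta delta0 [B0 Bray Barc]]] := resolvent_decay uray.
have [K K0 FK] := rpoly_bound x rF B0.
exists (K * B ^+ 2), delta => //; split; last first.
  by move=> rho al rd; case: (Barc rho al rd).
move=> a b; split.
- move=> t t0.
  apply: (@ccont_near _ _ t (fun t => F x (ray t theta) a b)).
    near=> s; rewrite FE//; split=> //; apply: uray.
    by apply: ltW; near: s; exact: lt_nbhsr.
  have := @rpoly_cont _ _ _ _ _ _ t (fun t => ray t theta) _ _ x rF (ccont_ray _ _).
  by move=> /(_ (uray t (ltW t0))); apply.
- move=> t t0; have t1 : 0 < 1 + t by rewrite addr_gt0.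
  rewrite FE; last by split=> //; apply: uray; exact: ltW.
  have Bt : B / (1 + t) <= B.
    by rewrite ler_pdivrMr// ler_peMr// lerDl ltW.
  have := FK (ray t theta) (B / (1 + t)) Bt (Bray t t0) (divr_ge0 B0 (ltW t1)) a b.
  by rewrite exprMn -exprVn mulrA.
- move=> rho al rd.
  apply: (@ccont_near _ _ al (fun al => F x (ray rho al) a b)).
    near=> s; rewrite FE//; split=> //; by case: (Barc rho s rd).
  have cr : ccont al (fun al => ray rho al).
    apply: ccontM; first exact: ccont_cst.
    by apply: ccont_cexp; split; [exact: cst_continuous|].
  have := @rpoly_cont _ _ _ _ _ _ al (fun al => ray rho al) _ _ x rF cr.
  by case: (Barc rho al rd) => u _ /(_ u); apply.
- move=> rho al rd; have [u Bu] := Barc rho al rd.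
  by rewrite FE//; exact: FK.
Unshelve. all: by end_near. Qed.

Lemma near_at_right0P (P : R -> Prop) : (\forall rho \near (0 : R)^'+, P rho) <->
  exists2 e : R, 0 < e & forall rho, 0 < rho < e -> P rho.
Proof.
split=> [|[e e0 He]].
  rewrite /at_right /within /= => /nbhs_ballP[e /= e0 He]; exists e => // rho.
  move=> /andP[r0 re]; apply: He => //=.
  by rewrite /ball /= sub0r normrN gtr0_norm.
near=> rho; apply: He; apply/andP; split.
  by near: rho; exact: nbhs_right_gt.
by near: rho; exact: nbhs_right_lt.
Unshelve. all: by end_near. Qed.

Definition power_contour j x xi z rho : 'M[C]_d :=
  \matrix_(a, b) ('i / (2 * pi)%:C *
    contour_int theta rho z (fun mu => resolvent_symbol Q j x xi mu a b)).

Lemma power_symbol_unique j x xi z v :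
  (\forall rho \near (0 : R)^'+, v = power_contour j x xi z rho) ->
  power_symbol Q theta j x xi z = v.
Proof.
move=> vE; apply: xget_unique => // v' v'E.
have : \forall rho \near (0 : R)^'+, v' = v.
  by near=> rho; rewrite (near v'E rho) // (near vE rho).
by move=> /near_at_right0P[e e0 /(_ (e / 2))]; apply; apply/andP; split; lra.
Unshelve. all: by end_near. Qed.

(** The bound on the contour integral is used with a radius chosen after u, so the arc term can be
    made as small as desired for each fixed u. *)
Lemma power_symbol_to0 j x xi : (0 < j)%N -> W x ->
  (forall t, 0 <= t -> hom_symbol Q 0 x xi - (ray t theta)%:M \in unitmx) ->
  forall a b eps, 0 < eps -> exists2 e, 0 < e & forall u, 0 < u < e ->
    normc (power_symbol Q theta j x xi (- u)%:C a b) <= eps.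
Proof.
move=> j0 Wx uray a b eps eps0.
have [K [delta delta0 [rK _]]] := resolvent_symbol_contour_regular j0 Wx uray.
have K0 : 0 <= K.
  have rd : 0 < delta / 2 < delta by apply/andP; split; lra.
  exact: le_trans (normc_ge0 _) (arc_bound (rK a b) 0 rd).
have pi0 := pi_gt0 R; have pi_ge := ltW pi0.
pose c := (2 * pi)^-1 * (2 * K * pi) : R; pose c' := (2 * pi)^-1 * (2 * (2 * pi * K)) : R.
have c0 : 0 <= c by rewrite !mulr_ge0 ?invr_ge0 ?mulr_ge0.
have c'0 : 0 <= c' by rewrite !mulr_ge0 ?invr_ge0 ?mulr_ge0.
pose D u := `|cos (2 * pi * u) - 1| + `|sin (2 * pi * u)| : R.
have D0 : D u @[u --> (0 : R)] --> (0 : R).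
  have cD : {for (0 : R), continuous D}.
    apply: continuousD; apply: continuous_comp; try exact: norm_continuous.
      apply: continuousB; last exact: cst_continuous.
      apply: continuous_comp; last exact: continuous_cos.
      by apply: continuousM; [exact: cst_continuous|].
    apply: continuous_comp; last exact: continuous_sin.
    by apply: continuousM; [exact: cst_continuous|].
  have := cD; rewrite /prop_for /continuous_at /= {2}/D mulr0 cos0 sin0 subrr.
  by rewrite !normr0 addr0.
pose eps1 := eps / (2 * (c + c' + 1)).
have e1 : 0 < eps1 by rewrite divr_gt0//; lra.
have /nbhs_ballP[e /= e0 De] : \forall u \near (0 : R), D u < eps1.
  have := @cvgr_lt _ _ _ _ _ _ D0 eps1 e1; exact.
exists (Num.min e 2^-1); first by rewrite lt_min e0 invr_gt0 ltr0n.
move=> u /andP[u0]; rewrite lt_min => /andP[ue u2].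
have Du : D u < eps1.
  by apply: De; rewrite /ball /= sub0r normrN gtr0_norm.
(* If the contour integral does not stabilize for small radii, the power symbol is the default 0 and
   the estimate is trivial. *)
have [[v vE]|nv] := pselect (exists v,
    \forall rho \near (0 : R)^'+, v = power_contour j x xi (- u)%:C rho); last first.
  rewrite /power_symbol; rewrite xgetPN; last by move=> v vE; apply: nv; exists v.
  by rewrite mxE ComplexField.Normc.normc0 ltW.
rewrite (power_symbol_unique vE).
move/near_at_right0P : vE => [e' e'0 vE].
(* Small enough for the stable value, for the bound on the circle, for rho <= 1, and for rho^(1/2)
   <= eps1. *)
pose rho := Num.min (Num.min (e' / 2) (delta / 2)) (Num.min 1 (eps1 ^+ 2)).
have r0 : 0 < rho.
  by rewrite !lt_min !divr_gt0//= ltr01 exprn_gt0.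
have [r1 r2 r3 r4] : [/\ rho <= e' / 2, rho <= delta / 2, rho <= 1 & rho <= eps1 ^+ 2].
  by split; rewrite !ge_min lexx ?orbT.
rewrite (vE rho); last by apply/andP; split=> //; lra.
have rd : 0 < rho < delta by apply/andP; split=> //; lra.
have u2' : 0 < u <= 2^-1 by rewrite u0 ltW.
rewrite mxE ComplexField.Normc.normcM.
have nE : normc ('i / (2 * pi)%:C : C) = (2 * pi)^-1.
  rewrite ComplexField.Normc.normcM normc_i mul1r ComplexField.Normc.normcV.
  by rewrite normc_real gtr0_norm// mulr_gt0.
rewrite nE; have := contour_int_bound (rK a b) u2' rd r3.
set I := normc _; set w := normc (cexp _ - 1) => Ib.
have wD : w <= D u.
  apply: le_trans (normc_le _) _; rewrite /cexp /= expR0 /=; simpc.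
  by rewrite /D; simpc.
have sq : expR (ln rho / 2) <= eps1.
  rewrite leNgt; apply/negP => lt.
  have : expR (ln rho / 2) ^+ 2 = rho.
    by rewrite -expRM_natl -mulr_natl mulrC divfK// lnK.
  nra.
have w0 : 0 <= w by exact: normc_ge0.
have x0 := expR_ge0 (ln rho / 2).
apply: (@le_trans _ _ (c * w + c' * expR (ln rho / 2))).
  have -> : c * w + c' * expR (ln rho / 2) = (2 * pi)^-1 *
      (2 * K * pi * w + 2 * (2 * pi * K * expR (ln rho / 2))).
    by rewrite /c /c'; ring.
  by rewrite ler_wpM2l// invr_ge0 mulr_ge0// ltW.
have E : 2 * (c + c' + 1) * eps1 = eps.
  by rewrite /eps1 mulrC divfK// gt_eqF//; lra.
rewrite -E; nra.
Unshelve. all: by end_near. Qed.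

End PowerSymbols.

(** * Behaviour of power symbols under rescaling *)

Section PowerSymbolComparison.
Variables (R : realType) (n m d d' : nat).
Local Notation C := R[i].
Local Notation V := 'rV[R]_n.
Variables (Q : coeffs R n m d) (Q' : coeffs R n m d') (W : set V) (la theta : R).
Variables (Phi : {linear 'M[C]_d -> 'M[C]_d'}) (Psi : {linear 'M[C]_d' -> 'M[C]_d}).
Hypothesis W_open : open W.
Hypothesis Q_smooth : forall al, smooth_mx_on W (Q al).
Hypothesis la_gt0 : 0 < la.
Hypothesis Phi1 : Phi 1%:M = 1%:M.
Hypothesis PhiM : forall A B, Phi (A *m B) = Phi A *m Phi B.
Hypothesis PhiK : cancel Phi Psi.
Hypothesis Q'E : forall al y, (weight al <= m)%N -> W (la *: y) ->
  Q' al y = (la ^- weight al)%:C *: Phi (Q al (la *: y)).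
Variables (j : nat) (y xi : V).
Hypothesis j_gt0 : (0 < j)%N.
Hypothesis Wy : W (la *: y).
Hypothesis y_regular : forall t, 0 <= t ->
  hom_symbol Q 0 (la *: y) xi - (ray t theta)%:M \in unitmx.

Let s := la ^+ m.

(** This is la^(j - m z), kept as the factor of the resolvent symbol times the two factors of the
    contour substitution with s = la^m. *)
Definition dilation_factor (z : C) : C :=
  (la ^+ (m + j))%:C * (cexp (- z * (ln (la ^+ m))%:C) * (la ^- m)%:C).

Let s_gt0 : 0 < s. Proof. by rewrite exprn_gt0. Qed.

Lemma cexp_neq0 (z : C) : cexp z != 0.
Proof.
apply: contraTneq (expR_gt0 (complex.Re z)) => E.
by rewrite -normc_cexp E ComplexField.Normc.normc0 ltxx.
Qed.

Lemma dilation_factor_neq0 z : dilation_factor z != 0.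
Proof.
have laC (k : nat) : (la ^+ k)%:C != 0 :> C.
  by rewrite (inj_eq (@complexI R)) expf_neq0// gt_eqF.
have laV : (la ^- m)%:C != 0 :> C.
  by rewrite (inj_eq (@complexI R)) invr_eq0 expf_neq0// gt_eqF.
by apply: mulf_neq0 => //; apply: mulf_neq0 => //; exact: cexp_neq0.
Qed.

Lemma power_contour_rescaled : exists2 e : R, 0 < e &
  forall z rho, complex.Re z <= 0 -> 0 < rho < e ->
  power_contour Q' theta j y xi z rho =
  dilation_factor z *: Phi (power_contour Q theta j (la *: y) xi z (s * rho)).
Proof.
have [K [delta delta0 [rK udelta]]] :=
  resolvent_symbol_contour_regular W_open Q_smooth j_gt0 Wy y_regular.
exists (delta / s); first by rewrite divr_gt0.
move=> z rho z0 /andP[r0 re].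
have srd : s * rho < delta by rewrite mulrC -ltr_pdivlMr.
have sr0 : 0 < s * rho by rewrite mulr_gt0.
apply/matrixP => a b; rewrite !mxE (linear_mx_entries Phi).
(* Each entry of the rescaled resolvent symbol is a fixed combination of entries of the original
   one, so linearity of the contour integral moves Phi outside. *)
pose k (p : 'I_d * 'I_d) : C := la%:C ^+ (m + j) * Phi (delta_mx p.1 p.2) a b.
pose f (p : 'I_d * 'I_d) (w : C) := resolvent_symbol Q j (la *: y) xi w p.1 p.2.
have resE mu : hom_symbol Q 0 (la *: y) xi - (s%:C * mu)%:M \in unitmx ->
    resolvent_symbol Q' j y xi mu a b = \sum_p k p * f p (s%:C * mu).
  rewrite /s rmorphXn /= => u.
  rewrite (resolvent_symbol_rescaled W_open Q_smooth la_gt0 Phi1 PhiM Q'E)//.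
  rewrite mxE linear_mx_entries pair_bigA mulr_sumr /=.
  by apply: eq_bigr => p _; rewrite /k /f; ring.
rewrite (@eq_contour_int _ _ _ _ _ (fun w => \sum_p k p * f p (s%:C * w)))//; last 2 first.
- by move=> t t0; apply: resE; rewrite -ray_scale; apply: y_regular; rewrite mulr_ge0 ?ltW.
- by move=> al; apply: resE; rewrite -ray_scale; apply: udelta; rewrite sr0.
have rf p : contour_regular theta K delta (f p) by exact: rK.
have rsum := contour_regular_sum (index_enum _) k rf.
have := contour_int_dilation rsum z0 s_gt0 r0 srd.
rewrite (contour_int_sum _ _ rf z0) ?sr0// => ->.
rewrite pair_bigA !mulr_sumr /=; apply: eq_bigr => p _.
rewrite mxE /k /f /dilation_factor /s; rewrite [(la ^+ (m + j))%:C]rmorphXn /=; ring.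
Qed.

Lemma power_symbol_rescaled z : complex.Re z <= 0 ->
  power_symbol Q' theta j y xi z =
  dilation_factor z *: Phi (power_symbol Q theta j (la *: y) xi z).
Proof.
move=> z0; have [e e0 pE] := power_contour_rescaled.
have [[v /near_at_right0P[e' e'0 vE]]|nv] := pselect (exists v, \forall rho \near (0 : R)^'+,
    v = power_contour Q theta j (la *: y) xi z rho).
  rewrite (@power_symbol_unique _ _ _ _ Q _ _ _ _ _ v); last first.
    by apply/near_at_right0P; exists e'.
  apply: power_symbol_unique; apply/near_at_right0P.
  exists (Num.min e (e' / s)); first by rewrite lt_min e0 divr_gt0.
  move=> rho /andP[r0]; rewrite lt_min => /andP[re re'].
  rewrite pE ?r0// -vE// mulr_gt0//=; by rewrite mulrC -ltr_pdivlMr.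
rewrite /power_symbol [in RHS]xgetPN; last by move=> v vE; apply: nv; exists v.
rewrite raddf0 scaler0 xgetPN// => v' /near_at_right0P[e' e'0 v'E]; apply: nv.
(* If only the rescaled integral stabilized, its value pulled back by Psi would be a stable value
   for Q; so both default to 0 together. *)
exists (Psi ((dilation_factor z)^-1 *: v')); apply/near_at_right0P.
exists (s * Num.min e e'); first by rewrite mulr_gt0// lt_min e0.
move=> rho /andP[r0 re].
have r1 : 0 < rho / s by rewrite divr_gt0.
have : rho / s < Num.min e e' by rewrite ltr_pdivrMr// mulrC.
rewrite lt_min => /andP[re1 re2].
have -> : v' = power_contour Q' theta j y xi z (rho / s) by apply: v'E; rewrite r1.
rewrite pE ?r1// scalerA mulVf ?dilation_factor_neq0//.
by rewrite scale1r PhiK mulrC divfK// gt_eqF.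
Qed.

End PowerSymbolComparison.

(** * Complex derivatives, seen from the negative real axis *)

Section ComplexDerivative.
Variable R : realType.
Local Notation C := R[i].
Local Notation normc := ComplexField.Normc.normc.

Lemma is_derive_littleo (f : R -> R) (df : R) : is_derive (0 : R) 1 f df ->
  forall e, 0 < e -> exists2 delta, 0 < delta &
    forall h, `|h| < delta -> `|f h - f 0 - df * h| <= e * `|h|.
Proof.
move=> [dfx dfE] e e0.
have cq : (fun h : R => h^-1 *: ((f \o shift 0) (h *: 1) - f 0)) @ 0^' --> df.
  by rewrite -dfE; exact: dfx.
move: cq => /cvgrPdist_le /(_ e e0).
rewrite /dnbhs /within /= => /nbhs_ballP[delta /= delta0 H]; exists delta => // h hd.
have [->|h0] := eqVneq h 0; first by rewrite mulr0 subr0 subrr normr0 mulr0.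
have := H h; rewrite /ball /= sub0r normrN => /(_ hd h0).
rewrite addr0 /GRing.scale /= mulr1 => Hh.
have -> : f h - f 0 - df * h = - (df - h^-1 * (f h - f 0)) * h.
  by field.
by rewrite normrM normrN ler_wpM2r.
Qed.

Lemma cexp_taylor (e : R) : 0 < e -> exists2 delta, 0 < delta &
  forall w : C, normc w < delta -> normc (cexp w - 1 - w) <= e * normc w.
Proof.
(* The real and imaginary parts of the remainder will each be bounded by 4 e1 |w|, hence the 8. *)
move=> e0; pose e1 := Num.min 1 (e / 8).
have e10 : 0 < e1 by rewrite lt_min ltr01 divr_gt0.
have e11 : e1 <= 1 by rewrite ge_min lexx.
have e18 : 8 * e1 <= e.
  by rewrite mulrC -ler_pdivlMr// ge_min lexx orbT.
have [d1 d10 H1] := is_derive_littleo (is_derive_expR (0 : R)) e10.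
have [d2 d20 H2] := is_derive_littleo (is_derive_cos (0 : R)) e10.
have [d3 d30 H3] := is_derive_littleo (is_derive_sin (0 : R)) e10.
(* The radius e1/2 is for the cross term: |exp a - 1| <= 2 |a| is then at most e1. *)
exists (Num.min (Num.min d1 d2) (Num.min d3 (e1 / 2))).
  by rewrite !lt_min d10 d20 d30 divr_gt0.
move=> w; rewrite !lt_min => /andP[/andP[w1 w2] /andP[w3 w4]].
have wR := normc_Re w; have wI := normc_Im w.
move: (H1 _ (le_lt_trans wR w1)) (H2 _ (le_lt_trans wI w2)) (H3 _ (le_lt_trans wI w3)).
rewrite expR0 mul1r cos0 sin0 oppr0 mul0r !subr0 mul1r.
move: wR wI w4; set N := normc w; set a := complex.Re w; set b := complex.Im w.
rewrite addr0 => aN bN N1 Ha Hb Hc.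
have N0 : 0 <= N by exact: normc_ge0.
have ER : complex.Re (cexp w - 1 - w) = expR a * (cos b - 1) + (expR a - 1 - a).
  rewrite /cexp /a /b; clear; case: w => a b; simpc => /=; ring.
have EI : complex.Im (cexp w - 1 - w) = expR a * (sin b - b) + (expR a - 1) * b.
  rewrite /cexp /a /b; clear; case: w => a b; simpc => /=; ring.
clearbody N a b.
have x0 : 0 < expR a by exact: expR_gt0.
have xa : `|expR a - 1| <= 2 * `|a|.
  have -> : expR a - 1 = (expR a - 1 - a) + a by ring.
  apply: le_trans (ler_normD _ _) _.
  by have := normr_ge0 a; nra.
have x3 : expR a <= 3.
  have : expR a - 1 <= 2 * `|a| by apply: le_trans (ler_norm _) xa.
  by lra.
have eN : e1 * `|a| <= e1 * N by rewrite ler_wpM2l// ltW.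
have eN' : e1 * `|b| <= e1 * N by rewrite ler_wpM2l// ltW.
apply: le_trans (normc_le _) _; rewrite ER EI.
have bR : `|expR a * (cos b - 1) + (expR a - 1 - a)| <= 4 * (e1 * N).
  apply: le_trans (ler_normD _ _) _; rewrite normrM (gtr0_norm x0).
  rewrite (_ : 4 * (e1 * N) = 3 * (e1 * N) + e1 * N); last by ring.
  apply: lerD; last exact: le_trans Ha eN.
  by apply: ler_pM; rewrite ?(ltW x0)//; exact: le_trans Hb eN'.
have bI : `|expR a * (sin b - b) + (expR a - 1) * b| <= 4 * (e1 * N).
  apply: le_trans (ler_normD _ _) _; rewrite !normrM (gtr0_norm x0).
  rewrite (_ : 4 * (e1 * N) = 3 * (e1 * N) + e1 * N); last by ring.
  apply: lerD; first by apply: ler_pM; rewrite ?(ltW x0)//; exact: le_trans Hc eN'.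
  by apply: ler_pM => //; lra.
apply: le_trans (lerD bR bI) _.
rewrite (_ : _ + _ = 8 * e1 * N); last by ring.
by rewrite ler_wpM2r.
Qed.

Lemma normC_le (z : C) (e : R) : (`|z| <= e%:C) = (normc z <= e).
Proof. exact: lecR. Qed.

Lemma normC_lt (z : C) (e : R) : (`|z| < e%:C) = (normc z < e).
Proof. exact: ltcR. Qed.

Lemma pos_complex_real (e : C) : 0 < e -> exists2 r : R, 0 < r & e = r%:C.
Proof. by case: e => a b; rewrite ltcE /= => /andP[/eqP -> a0]; exists a. Qed.

Lemma derivable_cexp (c z : C) :
  derivable ((fun w => cexp (w * c)) : C^o -> C^o) z (1 : C^o).
Proof.
apply: (cvgP (c * cexp (z * c) : C^o)).
apply/cvgrPdist_le => /= eps /pos_complex_real[e e0 ->].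
pose E := normc (cexp (z * c)).
have E0 : 0 <= E by exact: normc_ge0.
have c0 : 0 <= normc c by exact: normc_ge0.
have k0 : 0 < E * normc c + 1 by rewrite ltr_wpDl// mulr_ge0.
have [delta delta0 H] := cexp_taylor (divr_gt0 e0 k0).
rewrite /dnbhs /within /=; apply/nbhs_ballP.
exists ((delta / (normc c + 1))%:C) => /=; first by rewrite ltcR divr_gt0// ltr_wpDl.
move=> h; rewrite /ball /= sub0r normrN normC_lt => hd h0.
have hc : normc (h * c) < delta.
  rewrite ComplexField.Normc.normcM; move: hd; rewrite ltr_pdivlMr; last by lra.
  by have := normc_ge0 h; nra.
rewrite normC_le /GRing.scale /= mulr1 mulrDl cexpD.
have -> : c * cexp (z * c) - h^-1 * (cexp (h * c) * cexp (z * c) - cexp (z * c))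
    = - (h^-1 * cexp (z * c) * (cexp (h * c) - 1 - h * c)).
  by field.
rewrite normcN 2!ComplexField.Normc.normcM -/E ComplexField.Normc.normcV.
have nh : 0 < normc h.
  rewrite lt_neqAle normc_ge0 andbT eq_sym; apply: contra_neq h0.
  exact: ComplexField.Normc.eq0_normc.
have := H _ hc; rewrite ComplexField.Normc.normcM => Hb.
rewrite -mulrA ler_pdivrMl//; apply: le_trans (ler_wpM2l E0 Hb) _.
rewrite -subr_ge0.
have -> : normc h * e - E * (e / (E * normc c + 1) * (normc h * normc c))
    = normc h * (e / (E * normc c + 1)).
  by field; rewrite gt_eqF.
by rewrite mulr_ge0 ?divr_ge0 ?ltW.
Qed.

Lemma nbhs0_neg_real (P : set C^o) : nbhs (0 : C^o) P ->
  exists2 d : R, 0 < d & forall u, 0 < u < d -> P (- u)%:C.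
Proof.
move=> /nbhs_ballP[eps /= /pos_complex_real[d d0 ->] H]; exists d => // u /andP[u0 ud].
by apply: H; rewrite /ball /= sub0r normrN normC_lt normc_real normrN gtr0_norm.
Qed.

(** Takes the role of the identity theorem: a complex derivative may be computed along the negative
    reals, where the difference of f and g vanishes. *)
Lemma derive0_left (f g : C^o -> C^o) (e : R) : 0 < e ->
  derivable f 0 (1 : C^o) -> derivable g 0 (1 : C^o) ->
  (forall u, 0 < u < e -> f (- u)%:C = g (- u)%:C) ->
  f 0 = g 0 /\ derive f 0 (1 : C^o) = derive g 0 (1 : C^o).
Proof.
move=> e0 df dg fg.
pose k : C^o -> C^o := f - g.
have dk : derivable k 0 (1 : C^o) by exact: derivableB.
have k_left u : 0 < u < e -> k (- u)%:C = 0.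
  by move=> ue; rewrite /k /= fctE fg// subrr.
have pick (P : set C^o) : nbhs (0 : C^o) P -> exists2 u : R, 0 < u < e & P (- u)%:C.
  move=> /nbhs0_neg_real[d d0 Pd].
  exists (Num.min e d / 2).
    have : 0 < Num.min e d by rewrite lt_min e0.
    have : Num.min e d <= e by rewrite ge_min lexx.
    by move=> ? ?; apply/andP; split; lra.
  apply: Pd; have : 0 < Num.min e d by rewrite lt_min e0.
  have : Num.min e d <= d by rewrite ge_min lexx orbT.
  by move=> ? ?; apply/andP; split; lra.
have k0 : k 0 = 0.
  have ck : {for (0 : C^o), continuous k}.
    have /derivable1_diffP dk' := dk; exact: (differentiable_continuous dk').
  apply/eqP; apply: contraT => kn0.
  have H : nbhs (0 : C^o) [set z | k z != 0] by exact: cvgr_neq0 ck kn0.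
  by have [u ue /=] := pick _ H; rewrite k_left// eqxx.
have dk0 : derive k 0 (1 : C^o) = 0.
  apply/eqP; apply: contraT => dn0.
  have H := cvgr_neq0 _ (dk : _ --> derive k 0 (1 : C^o)) dn0.
  have {}H : nbhs (0 : C^o) [set h | h != 0 ->
    h^-1 *: ((k \o shift 0) (h *: (1 : C^o)) - k 0) != 0] by exact: H.
  have [u ue /=] := pick _ H.
  have u0 : (- u)%:C != 0 :> C.
    by rewrite (inj_eq (@complexI R)) oppr_eq0 gt_eqF//; case/andP: ue.
  move=> /(_ u0); rewrite addr0 k0 subr0 /GRing.scale /= mulr1 k_left// mulr0.
  by rewrite eqxx.
split.
  by apply/eqP; rewrite -subr_eq0; apply/eqP; exact: k0.
by apply/eqP; rewrite -subr_eq0 -deriveB//; apply/eqP; exact: dk0.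
Qed.

End ComplexDerivative.

(** * Derivative at zero of a holomorphic extension *)

Section HolomorphicExtension.
Variable R : realType.
Local Notation C := R[i].
Local Notation normc := ComplexField.Normc.normc.

Definition holomorphic_extension d (h : C -> 'M[C]_d) (H : C -> 'M[C]_d) (e : R) :=
  (forall z a b, `|z| < e%:C ->
     derivable ((fun w => H w a b) : C^o -> C^o) z (1 : C^o)) /\
  (forall z, `|z| < e%:C -> complex.Re z < 0 -> H z = h z).

Definition entry_derive0 d (H : C -> 'M[C]_d) : 'M[C]_d :=
  \matrix_(a, b) derive ((fun w => H w a b) : C^o -> C^o) (0 : C^o) (1 : C^o).

Lemma ext_deriv0_unique d (h H : C -> 'M[C]_d) e : 0 < e ->
  holomorphic_extension h H e -> ext_deriv0 h = entry_derive0 H.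
Proof.
move=> e0 [dH Hh]; apply: xget_unique.
  exists e => //; exists H; split=> // a b; by rewrite mxE.
move=> v [e' e'0 [H' [dH' H'h vE]]]; apply/matrixP => a b; rewrite vE mxE.
have m0 : 0 < Num.min e e' by rewrite lt_min e0.
have [] := @derive0_left _ (fun w => H' w a b) (fun w => H w a b) _ m0.
- by apply: dH'; rewrite normr0 ltcR.
- by apply: dH; rewrite normr0 ltcR.
- move=> u /andP[u0]; rewrite lt_min => /andP[ue ue'].
  rewrite Hh ?H'h//= ?oppr_lt0// normC_lt normc_real normrN gtr0_norm//.
- by [].
Qed.

Lemma is_derive_bigsum (x : C^o) I (s : seq I) (f : I -> C^o -> C^o) (df : I -> C^o) :
  (forall i, is_derive x (1 : C^o) (f i) (df i)) ->
  is_derive x (1 : C^o) (fun z => \sum_(i <- s) f i z) (\sum_(i <- s) df i).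
Proof.
move=> fd; elim: s => [|i s IH].
  rewrite big_nil (_ : (fun z => _) = cst 0); first exact: is_derive_cst.
  by apply/funext => z; rewrite big_nil.
rewrite big_cons (_ : (fun z => _) = f i + (fun z => \sum_(i <- s) f i z)).
  exact: is_deriveD.
by apply/funext => z; rewrite big_cons.
Qed.

Lemma is_derive_linear_entry d d' (Phi : {linear 'M[C]_d -> 'M[C]_d'})
    (H : C -> 'M[C]_d) (D : 'M[C]_d) (z : C) :
  (forall a b, is_derive (z : C^o) (1 : C^o) ((fun w => H w a b) : C^o -> C^o) (D a b)) ->
  forall a b, is_derive (z : C^o) (1 : C^o)
    ((fun w => Phi (H w) a b) : C^o -> C^o) (Phi D a b).
Proof.
move=> HD a b.
rewrite (linear_mx_entries Phi D) pair_bigA /=.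
rewrite (_ : (fun w => _) = fun w => \sum_p H w p.1 p.2 * Phi (delta_mx p.1 p.2) a b).
  apply: is_derive_bigsum => p.
  have H1 := is_deriveM (HD p.1 p.2)
    (is_derive_cst (Phi (delta_mx p.1 p.2) a b : C^o) (z : C^o) (1 : C^o)).
  apply: (is_derive_eq H1).
  by rewrite scaler0 add0r /GRing.scale /= mulrC.
by apply/funext => w; rewrite linear_mx_entries pair_bigA.
Qed.

Lemma is_deriveM_entry d (k : C -> C) (H : C -> 'M[C]_d) (dk : C) (D : 'M[C]_d) (z : C) :
  is_derive (z : C^o) (1 : C^o) (k : C^o -> C^o) dk ->
  (forall a b, is_derive (z : C^o) (1 : C^o) ((fun w => H w a b) : C^o -> C^o) (D a b)) ->
  forall a b, is_derive (z : C^o) (1 : C^o)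
    ((fun w => (k w *: H w) a b) : C^o -> C^o) (k z * D a b + H z a b * dk).
Proof.
move=> kd HD a b.
rewrite (_ : (fun w => _) = (fun w => k w * H w a b)).
  exact: (is_deriveM kd (HD a b)).
by apply/funext => w; rewrite mxE.
Qed.

(** The product rule for k and Phi H has a second term with H 0 and the derivative of k. The last
    hypothesis, smallness of h along the negative reals, removes it. *)
Lemma ext_deriv0_rescaled d d' (Phi : {linear 'M[C]_d -> 'M[C]_d'})
    (Psi : {linear 'M[C]_d' -> 'M[C]_d}) (k : C -> C)
    (h : C -> 'M[C]_d) (h' : C -> 'M[C]_d') :
  cancel Phi Psi ->
  (forall z, k z != 0) ->
  (forall z, derivable (k : C^o -> C^o) (z : C^o) (1 : C^o)) ->
  (forall z, complex.Re z < 0 -> h' z = k z *: Phi (h z)) ->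
  (forall a b eps, 0 < eps -> exists2 e : R, 0 < e &
     forall u, 0 < u < e -> normc (h (- u)%:C a b) <= eps) ->
  ext_deriv0 h' = k 0 *: Phi (ext_deriv0 h).
Proof.
move=> PhiK k0 dk h'E h0.
have fwd H e : 0 < e -> holomorphic_extension h H e ->
    holomorphic_extension h' (fun z => k z *: Phi (H z)) e /\
    entry_derive0 (fun z => k z *: Phi (H z)) = k 0 *: Phi (entry_derive0 H).
  move=> e0 [dH Hh].
  have isH z : `|z| < e%:C -> forall a b,
      is_derive (z : C^o) (1 : C^o) ((fun w => H w a b) : C^o -> C^o)
        ((\matrix_(a, b) derive ((fun w => H w a b) : C^o -> C^o) z (1 : C^o)) a b).
    by move=> ze a b; rewrite mxE; apply: DeriveDef => //; exact: dH.
  have isk z : is_derive (z : C^o) (1 : C^o) (k : C^o -> C^o)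
      (derive (k : C^o -> C^o) z (1 : C^o)) by exact: DeriveDef.
  have H00 : H 0 = 0.
    apply/matrixP => a b; rewrite mxE; apply/eqP; apply: contraT => Hn0.
    have Hc : {for (0 : C^o), continuous ((fun w => H w a b) : C^o -> C^o)}.
      by apply/differentiable_continuous/derivable1_diffP; apply: dH; rewrite normr0 ltcR.
    pose eta := normc (H 0 a b).
    have eta0 : 0 < eta.
      rewrite lt_neqAle normc_ge0 andbT eq_sym; apply: contra_neq Hn0.
      exact: ComplexField.Normc.eq0_normc.
    (* H 0 lies within eta/4 of h(-u), itself of norm at most eta/4, so the norm eta of H 0 would be
       at most eta/2. *)
    have e20 : 0 < eta / 4 by rewrite divr_gt0.
    have [e1 e10 he1] := h0 a b _ e20.
    have e2C : 0 < (eta / 4)%:C :> C by rewrite ltcR.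
    have nH : nbhs (0 : C^o) [set z | `|H 0 a b - H z a b| < (eta / 4)%:C].
      exact: (cvgrPdist_lt (F := nbhs (0 : C^o)) (fun w : C^o => H w a b : C^o) (H 0 a b)).1 Hc _ e2C.
    have [e2 e20' he2] := nbhs0_neg_real nH.
    pose u := Num.min (Num.min e1 e2) e / 2.
    have m0 : 0 < Num.min (Num.min e1 e2) e by rewrite !lt_min e10 e20' e0.
    have [m1 m2 m3] : [/\ Num.min (Num.min e1 e2) e <= e1,
        Num.min (Num.min e1 e2) e <= e2 & Num.min (Num.min e1 e2) e <= e].
      by split; rewrite !ge_min lexx ?orbT.
    have u0 : 0 < u by rewrite divr_gt0.
    have [v1 v2 v3] : [/\ u < e1, u < e2 & u < e] by split; rewrite /u; lra.
    have := he1 u; rewrite u0 v1 => /(_ isT).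
    have := he2 u; rewrite u0 v2 => /(_ isT) /=; rewrite normC_lt (Hh (- u)%:C); last 2 first.
    - by rewrite normC_lt normc_real normrN gtr0_norm.
    - by rewrite /= oppr_lt0.
    move=> c1 c2; have := le_normcD (H 0 a b - h (- u)%:C a b) (h (- u)%:C a b).
    by rewrite subrK -/eta; lra.
  split.
    split=> [z a b ze|z ze z0]; last by rewrite Hh// h'E.
    exact: (@ex_derive _ _ _ _ _ _ _
      (is_deriveM_entry (isk z) (is_derive_linear_entry Phi (isH z ze)) a b)).
  apply/matrixP => a b; rewrite mxE.
  have z0 : `|0 : C| < e%:C by rewrite normr0 ltcR.
  have D := is_deriveM_entry (isk 0) (is_derive_linear_entry Phi (isH 0 z0)) a b.
  rewrite (@derive_val _ _ _ _ _ _ _ D) H00 raddf0 !mxE mul0r addr0.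
  by [].
have [[H [e e0 Hext]]|nH] := pselect (exists H, exists2 e : R, 0 < e &
    holomorphic_extension h H e).
  have [ext E] := fwd H e e0 Hext.
  by rewrite (ext_deriv0_unique e0 ext) (ext_deriv0_unique e0 Hext).
(* Without an extension of h the right side is the default 0. An extension of h' would give one of h
   after applying Psi and dividing by k, so the left side is 0 as well. *)
rewrite /ext_deriv0 [in RHS]xgetPN; last first.
  by move=> v [e e0 [H [dH Hh _]]]; apply: nH; exists H, e.
rewrite raddf0 scaler0 xgetPN// => v' [e e0 [H' [dH' H'h _]]]; apply: nH.
exists (fun z => (k z)^-1 *: Psi (H' z)), e => //; split=> [z a b ze|z ze z0].
  have isk : is_derive (z : C^o) (1 : C^o) ((fun w => (k w)^-1) : C^o -> C^o)
      (derive ((fun w => (k w)^-1) : C^o -> C^o) z (1 : C^o)).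
    by apply: DeriveDef => //; apply: derivableV.
  have isH c e' : is_derive (z : C^o) (1 : C^o) ((fun w => H' w c e') : C^o -> C^o)
      ((\matrix_(a, b) derive ((fun w => H' w a b) : C^o -> C^o) z (1 : C^o)) c e').
    by rewrite mxE; apply: DeriveDef => //; exact: dH'.
  exact: (@ex_derive _ _ _ _ _ _ _
    (is_deriveM_entry isk (is_derive_linear_entry Psi isH) a b)).
by rewrite H'h// h'E// linearZ /= PhiK scalerA mulVf// scale1r.
Qed.

End HolomorphicExtension.

(** * Behaviour of logarithm symbols under rescaling *)

Section LogSymbolComparison.
Variables (R : realType) (n m d d' : nat).
Local Notation C := R[i].
Local Notation V := 'rV[R]_n.
Variables (Q : coeffs R n m d) (Q' : coeffs R n m d') (W : set V) (la theta : R).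
Variables (Phi : {linear 'M[C]_d -> 'M[C]_d'}) (Psi : {linear 'M[C]_d' -> 'M[C]_d}).
Hypothesis W_open : open W.
Hypothesis Q_smooth : forall al, smooth_mx_on W (Q al).
Hypothesis la_gt0 : 0 < la.
Hypothesis Phi1 : Phi 1%:M = 1%:M.
Hypothesis PhiM : forall A B, Phi (A *m B) = Phi A *m Phi B.
Hypothesis PhiK : cancel Phi Psi.
Hypothesis Q'E : forall al y, (weight al <= m)%N -> W (la *: y) ->
  Q' al y = (la ^- weight al)%:C *: Phi (Q al (la *: y)).
Variables (j : nat) (y : V).
Hypothesis j_gt0 : (0 < j)%N.
Hypothesis Wy : W (la *: y).
Hypothesis y_regular : forall xi t, xi != 0 -> 0 <= t ->
  hom_symbol Q 0 (la *: y) xi - (ray t theta)%:M \in unitmx.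

Lemma enorm_eq0 (xi : V) : (enorm xi == 0) = (xi == 0).
Proof.
rewrite /enorm sqrtr_eq0; apply/idP/eqP => [xi0|->]; last first.
  by rewrite big1// => i _; rewrite mxE expr0n.
apply/rowP => i; rewrite mxE; apply/eqP; rewrite -sqrf_eq0.
rewrite eq_le sqr_ge0 andbT; apply: le_trans xi0; rewrite (bigD1 i)//= lerDl.
by apply: sumr_ge0 => k _; exact: sqr_ge0.
Qed.

Lemma derivable_dilation_factor z :
  derivable (@dilation_factor R m la j : C^o -> C^o) (z : C^o) (1 : C^o).
Proof.
have D := @derivable_cexp R (- (ln (la ^+ m))%:C) z.
have -> : (@dilation_factor R m la j : C^o -> C^o) = (fun w =>
    (la ^+ (m + j))%:C * (la ^- m)%:C * cexp (w * - (ln (la ^+ m))%:C)).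
  by apply/funext => w; rewrite /dilation_factor mulrN mulNr; ring.
exact: (derivableM (derivable_cst ((la ^+ (m + j))%:C * (la ^- m)%:C : C^o) _ _) D).
Qed.

Lemma log_symbol_rescaled xi :
  log_symbol Q' theta j y xi =
  la%:C ^+ j *: Phi (log_symbol Q theta j (la *: y) xi).
Proof.
(* At xi = 0 the Agmon condition says nothing, but the prefactor [enorm xi ^- j] is the inverse of
   0, which is 0 by convention since j > 0. *)
rewrite /log_symbol; have [->|xi0] := eqVneq xi 0.
  rewrite (eqP (_ : enorm 0 == 0)) ?enorm_eq0//.
  by rewrite expr0n eqn0Ngt j_gt0 /= invr0 !scale0r raddf0 scaler0.
set zeta := (enorm xi)^-1 *: xi.
have zeta0 : zeta != 0 by rewrite scaler_eq0 negb_or invr_eq0 enorm_eq0 xi0.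
have reg t : 0 <= t -> hom_symbol Q 0 (la *: y) zeta - (ray t theta)%:M \in unitmx.
  by move=> t0; exact: y_regular.
rewrite (@ext_deriv0_rescaled _ _ _ Phi Psi (dilation_factor m la j)
  (power_symbol Q theta j (la *: y) zeta)) //.
- rewrite [in RHS]linearZ /= !scalerA; congr (_ *: _).
  rewrite mulrC; congr (_ * _).
  (* At z = 0 the factors la^m and la^-m cancel and la^j remains. *)
  rewrite /dilation_factor oppr0 mul0r cexp0 mul1r -rmorphM /= exprD.
  by rewrite mulrC mulKf ?rmorphXn// expf_neq0// gt_eqF.
- by move=> z; exact: dilation_factor_neq0.
- exact: derivable_dilation_factor.
- move=> z z0; apply: (@power_symbol_rescaled _ _ _ _ _ _ _ W _ _ _ Psi) => //.
  exact: ltW.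
- exact: (power_symbol_to0 W_open Q_smooth).
Qed.

End LogSymbolComparison.

(** * Constants in integrals over the sphere *)

Section SphereIntegral.
Variable R : realType.
Local Notation C := R[i].

Section ScaledIntegral.
Local Open Scope ereal_scope.
Context d (T : measurableType d) (mu : {measure set T -> \bar R}) (D : set T).
Implicit Types (f : T -> \bar R) (g : T -> R).
Import HBNNSimple.

(* No measurability is assumed: the integral of a nonnegative function is a
   supremum of integrals of simple functions. *)
Let integral_scale_le f (c : R) : (0 < c)%R -> (forall x, 0 <= f x) ->
  \int[mu]_(x in D) f x <= (c^-1)%:E * \int[mu]_(x in D) (c%:E * f x).
Proof.
move=> c0 f0; have c0' := ltW c0.
have cf0 x : 0 <= c%:E * f x by rewrite mule_ge0// lee_fin.
rewrite [leLHS]ge0_integralE//; apply/ge_ereal_sup => _ [h /= hf <-].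
rewrite -[leLHS]mul1e -[1%R](mulVf (lt0r_neq0 c0)) EFinM -muleA.
rewrite lee_wpmul2l// ?lee_fin ?invr_ge0//.
rewrite ge0_integralE// -sintegralrM; apply: ereal_sup_ubound => /=.
exists (scale_nnsfun h c0') => // x /=.
rewrite EFinM; have := hf x; rewrite /patch; case: ifP => // _ hx.
  by rewrite lee_wpmul2l// lee_fin.
have : 0 <= (h x)%:E by rewrite lee_fin.
move=> h0; have -> : (h x)%:E = 0 by apply/eqP; rewrite eq_le hx.
by rewrite mule0.
Qed.

Lemma ge0_integral_scale f (c : R) : (0 < c)%R -> (forall x, 0 <= f x) ->
  \int[mu]_(x in D) (c%:E * f x) = c%:E * \int[mu]_(x in D) f x.
Proof.
move=> c0 f0; have c0' := ltW c0; have ci0 : (0 < c^-1)%R by rewrite invr_gt0.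
apply/eqP; rewrite eq_le; apply/andP; split.
  have cf0 x : 0 <= c%:E * f x by rewrite mule_ge0// lee_fin.
  have := integral_scale_le ci0 cf0; rewrite invrK.
  rewrite (_ : \int[mu]_(x in D) ((c^-1)%:E * (c%:E * f x)) = \int[mu]_(x in D) f x)//.
  by apply: eq_integral => x _; rewrite muleA -EFinM mulVf ?gt_eqF// mul1e.
have := lee_wpmul2l (x := c%:E) _ (integral_scale_le c0 f0).
by rewrite lee_fin muleA -EFinM mulfV ?gt_eqF// mul1e; exact.
Qed.

Lemma Rintegral_opp g :
  (\int[mu]_(x in D) - g x = - \int[mu]_(x in D) g x)%R.
Proof.
rewrite /Rintegral integralE [in RHS]integralE.
have -> : (fun x => (- g x)%:E) = \- (fun x => (g x)%:E) by [].
rewrite funeposN funenegN.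
set A := \int[mu]_(x in D) _; set B := \int[mu]_(x in D) _.
have : 0 <= A by exact: integral_ge0.
have : 0 <= B by exact: integral_ge0.
by case: A => [a||]; case: B => [b||] //= _ _; rewrite ?oppr0// opprB.
Qed.

Lemma Rintegral_scale g (c : R) :
  (\int[mu]_(x in D) (c * g x) = c * \int[mu]_(x in D) g x)%R.
Proof.
have pos (c' : R) : (0 < c')%R ->
    (\int[mu]_(x in D) (c' * g x) = c' * \int[mu]_(x in D) g x)%R.
  move=> c0; have c0' := ltW c0; rewrite /Rintegral integralE [in RHS]integralE.
  have -> : (fun x => (c' * g x)%:E) = (fun x => c'%:E * (g x)%:E) by [].
  rewrite (ge0_funeposM _ c0') (ge0_funenegM _ c0').
  rewrite !ge0_integral_scale//.
  set A := \int[mu]_(x in D) _; set B := \int[mu]_(x in D) _.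
  have : 0 <= A by exact: integral_ge0.
  have : 0 <= B by exact: integral_ge0.
  case: A => [a||]; case: B => [b||] //= _ _; rewrite ?gt0_muley ?lte_fin//= ?mulr0//.
  by rewrite mulrBr.
have [c0|c0|<-] := ltgtP 0%R c; first exact: pos.
  rewrite -[c]opprK mulNr -pos ?oppr_gt0// -Rintegral_opp; congr (fine _).
  by apply: eq_integral => x _; rewrite mulNr.
rewrite mul0r; rewrite (_ : (fun x => _) = fun=> 0%R); last first.
  by apply/funext => x; rewrite mul0r.
by rewrite /Rintegral integral0.
Qed.

End ScaledIntegral.

Lemma sphere_int_rec_scale d (f : 'rV[R]_d.+1 -> R) (c : R) :
  sphere_int_rec (fun w => c * f w) = c * sphere_int_rec f.
Proof.
elim: d f => [|d IH] f /=; first by rewrite mulrDr.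
rewrite -Rintegral_scale; apply: eq_Rintegral => phi _.
by rewrite IH mulrCA.
Qed.

Lemma sphere_int_scale_real d (f : 'rV[R]_d -> C) (c : R) :
  sphere_int (fun xi => c%:C * f xi) = c%:C * sphere_int f.
Proof.
case: d f => [|d] f /=; first by rewrite mulr0.
rewrite (_ : (fun xi => complex.Re _) = fun xi => c * complex.Re (f xi)); last first.
  by apply/funext => xi; case: (f xi) => a b; simpc.
rewrite (_ : (fun xi => complex.Im _) = fun xi => c * complex.Im (f xi)); last first.
  by apply/funext => xi; case: (f xi) => a b; simpc.
by rewrite !sphere_int_rec_scale; simpc.
Qed.

(** Only the equation that ['i] squares to -1 is used: it makes the product of the parts vanish, and
    a zero imaginary part would give a real square root of -1. *)
Lemma imaginaryE : exists e : R, ('i : C) = 0 +i* e.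
Proof.
have := sqrCi C; case: ('i) => a b; rewrite expr2; simpc => -[h1 h2].
exists b; congr (_ +i* _); apply/eqP; rewrite -sqrf_eq0.
have [//|a0] := eqVneq a 0; first by move=> ->; rewrite expr0n.
have : a * b = 0 by lra.
by move/eqP; rewrite mulf_eq0 (negbTE a0) /= => /eqP b0; exfalso; move: h1; rewrite b0; nra.
Qed.

Lemma sphere_int_scale_i d (f : 'rV[R]_d -> C) :
  sphere_int (fun xi => 'i * f xi) = 'i * sphere_int f.
Proof.
have [e ->] := imaginaryE; case: d f => [|d] f /=; first by rewrite mulr0.
rewrite (_ : (fun xi => complex.Re _) = fun xi => - e * complex.Im (f xi)); last first.
  by apply/funext => xi; case: (f xi) => a b /=; ring.
rewrite (_ : (fun xi => complex.Im _) = fun xi => e * complex.Re (f xi)); last first.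
  by apply/funext => xi; case: (f xi) => a b /=; ring.
by rewrite !sphere_int_rec_scale; simpc; congr (_ +i* _); ring.
Qed.

(** A general complex factor mixes real and imaginary parts and would require additivity of the
    integral. Powers of (-2i)^-1 = i/2 only swap the two parts and scale them by reals. *)
Lemma sphere_int_scale_pow d (f : 'rV[R]_d -> C) k :
  sphere_int (fun xi => (- (2 * 'i)) ^- k * f xi) = (- (2 * 'i)) ^- k * sphere_int f.
Proof.
elim: k => [|k IH].
  rewrite invr1 mul1r; congr sphere_int; apply/funext => xi; exact: mul1r.
have E : (- (2 * 'i)) ^- k.+1 = (2^-1)%:C * ('i * (- (2 * 'i)) ^- k) :> C.
  rewrite exprS invfM mulrA; congr (_ * _).
  have w0 : - (2 * 'i) != 0 :> C by rewrite oppr_eq0 mulf_neq0 ?neq0Ci ?pnatr_eq0.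
  apply: (mulfI w0); rewrite mulfV// fmorphV rmorph_nat mulNr mulrACA -expr2 sqrCi.
  by rewrite mulfV ?pnatr_eq0// mul1r opprK.
rewrite E -!mulrA -IH -sphere_int_scale_i -sphere_int_scale_real.
by congr sphere_int; apply/funext => xi; rewrite !mulrA.
Qed.

End SphereIntegral.

(** * Determinant of the parallel frame *)

Section FrameDeterminant.
Variables (R : realType) (n : nat).
Local Notation C := R[i].
Local Notation V := 'rV[R]_n.

Lemma enormZ (t : R) (x : V) : 0 <= t -> enorm (t *: x) = t * enorm x.
Proof.
move=> t0; rewrite /enorm -[t in RHS](ger0_norm t0) -sqrtr_sqr -sqrtrM ?sqr_ge0//.
by congr Num.sqrt; rewrite mulr_sumr; apply: eq_bigr => i _; rewrite mxE exprMn.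
Qed.

Lemma eball_shrink (r t : R) (x : V) : 0 <= t <= 1 -> eball r x -> eball r (t *: x).
Proof.
move=> /andP[t0 t1]; rewrite /eball /= enormZ// => xr; apply: le_lt_trans xr.
by rewrite ler_piMl// sqrtr_ge0.
Qed.

Lemma ccont_det (T : topologicalType) (t : T) a (F : T -> 'M[C]_a) :
  mxcont t F -> ccont t (fun x => \det (F x)).
Proof.
move=> cF; apply: cgood_det => //.
- by move=> e; exact: cst_continuous.
- by move=> f g cf cg; exact: continuousD.
- by move=> f g cf cg; exact: continuousM.
Qed.

(** The determinant is 1 at the centre and has no zero on the segment to x, so the intermediate
    value theorem forbids a change of sign. *)
Lemma det_path_gt0 (F : V -> 'M[R]_n) (r : R) (x : V) :
  (forall y, eball r y -> forall k i, {for y, continuous (fun z => F z k i)}) ->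
  (forall y, eball r y -> \det (F y) != 0) -> F 0 = 1%:M -> eball r x ->
  0 < \det (F x).
Proof.
move=> cF F0 F1 xr.
pose f (t : R) := \det (F (t *: x)).
have cf : {within `[0, 1], continuous f}.
  apply: continuous_in_subspaceT => t; rewrite inE /= in_itv /= => t01.
  have tx : eball r (t *: x) by exact: eball_shrink.
  (* The closure lemmas are stated for complex matrices, so the real frame is embedded first. *)
  have cM : mxcont t (fun t => map_mx (real_complex R) (F (t *: x))).
    move=> k i; split; last first.
      rewrite (_ : (fun t => _) = fun=> 0); first exact: cst_continuous.
      by apply/funext => u; rewrite mxE.
    rewrite (_ : (fun t => _) = (fun z => F z k i) \o (fun t : R => t *: x)).
      by apply: continuous_comp; [exact: scalel_continuous|exact: cF].
    by apply/funext => u; rewrite mxE.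
  have [] := ccont_det cM.
  rewrite (_ : (fun t => complex.Re _) = f)//.
  by apply/funext => u; rewrite det_map_mx.
have f0 : f 0 = 1 by rewrite /f scale0r F1 det1.
have f1 : f 1 = \det (F x) by rewrite /f scale1r.
rewrite -f1 ltNge; apply/negP => f1le.
have [] := @IVT R f 0 1 0 ler01 cf.
  by rewrite f0 ge_min le_max f1le ler01 orbT.
move=> t; rewrite in_itv /= => t01 ft.
by have := F0 _ (eball_shrink t01 xr); rewrite -/(f t) ft eqxx.
Qed.

End FrameDeterminant.

(** The coframe matrix is the inverse of the frame matrix. Orthonormality gives [\det (fr (s y) c)
    ^+ 2 * \det (metric g c y) = 1], and positivity selects the root. *)
Lemma normal_frame_det (R : realType) (n : nat) (M : topologicalType)
    (X : smooth_structure R n M) (g : riemannian_metric X) d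
    (ga : 'I_n -> 'M[R[i]]_d) (S : spin_structure g ga)
    (p : M) (r : R) (c : chart R n M) (s : 'rV[R]_n -> spt S) :
  normal_frame p r c s -> forall x, eball r x ->
  \det (invmx (fr (s x) c)) = Num.sqrt (\det (metric g c x)).
Proof.
move=> [[r0 dE _ cs] [_ s0 _]] x xr.
have [cX sB] := lsec_base cs.
have orth y : eball r y ->
    \det (fr (s y) c) ^+ 2 * \det (metric g c y) = 1.
  move=> yr; have yd : dom c y by rewrite dE.
  have := fr_orthonormal cX yd (sB y yd) => /(congr1 determinant).
  by rewrite !det_mulmx det_tr det1 => <-; ring.
have F0 y : eball r y -> \det (fr (s y) c) != 0.
  by move=> /orth; apply: contra_eqN => /eqP ->; rewrite expr0n mul0r eq_sym oner_eq0.
have pos : 0 < \det (fr (s x) c).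
  apply: (@det_path_gt0 _ _ (fun y => fr (s y) c) r) => // y yr k i.
  have yd : dom c y by rewrite dE.
  by have /(_ [::] y yd) [] := lsec_fr cs k i.
rewrite det_inv; have := orth x xr; set D := \det (fr _ _) in pos *.
move=> E; have -> : \det (metric g c x) = D^-1 ^+ 2.
  apply: (@mulfI _ (D ^+ 2)); first by rewrite expf_neq0// gt_eqF.
  by rewrite E -exprMn mulfV ?expr1n// gt_eqF.
by rewrite sqrtr_sqr gtr0_norm// invr_gt0.
Qed.

Lemma sphere_int_dim0 (R : realType) (d : nat) (f : 'rV[R]_d -> R[i]) :
  d = 0%N -> sphere_int f = 0.
Proof. by case: d f. Qed.

Theorem corollary3p10 (R : realType) (n : nat) (n_even : ~~ odd n)
    (M : topologicalType)
    (M_compact : compact [set: M]) (M_hausdorff : hausdorff_space M)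
    (X : smooth_structure R n M) (g : riemannian_metric X)
    (ga : 'I_n -> 'M[R[i]]_(2 ^ n./2)) (ga_clifford : clifford_rep ga)
    (S : spin_structure g ga)
    (p : M) (r : R) (c : chart R n M) (s : 'rV[R]_n -> spt S)
    (normal : normal_frame p r c s)
    (m : nat) (m_gt0 : (0 < m)%N)
    (P : spinor_op S) (P_diff : diff_op m P) (P_even : even_op P)
    (theta : R) (P_agmon : agmon_angle m P theta)
    (PI : mindex n m -> {set 'I_n} -> 'rV[R]_n -> R[i])
    (P_local : represents P c s
       (fun al x => \sum_(I : {set 'I_n}) PI al I x *: cliff_prod ga I))
    (la : R) (la_gt0 : 0 < la) (la_lt1 : la < 1) :
  forall x, eball r x ->
    omega_Res m
      (U_sharp la (f_sharp la (cg PI (fun y => invmx (fr (s y) c))))) theta x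
    = (Num.sqrt (\det (metric g c (la *: x))))%:C
      * (- (2 * 'i)) ^- (n./2)
      * omega_sRes ga
          (fun al y => \sum_(I : {set 'I_n}) PI al I y *: cliff_prod ga I)
          theta (la *: x).
Proof.
move=> x xr; rewrite /omega_Res /omega_sRes.
(* For n = 0 the sphere is empty and both densities vanish; for n > 0 the comparison of symbols may
   be used with j = n, which must be positive. *)
have [n0|n0] := posnP n.
  by rewrite !sphere_int_dim0// mul0r !mulr0.
have [[r0 dE _ cs] _] := normal; have [cX sB] := lsec_base cs.
have lxr : eball r (la *: x) by apply: eball_shrink => //; rewrite !ltW.
have oW : open (dom c) by case: (charts_ok cX).
have lxd : dom c (la *: x) by rewrite dE.
set a := (fun (al : mindex n m) y => \sum_(I : {set 'I_n}) PI al I y *: cliff_prod ga I).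
(* The Agmon condition on the leading symbol, at the dilated point, is exactly invertibility along
   the ray. *)
have reg xi t : xi != 0 -> 0 <= t ->
    hom_symbol a 0 (la *: x) xi - (ray t theta)%:M \in unitmx.
  move=> xi0 t0; rewrite unitmx_eigenvalue.
  by case: P_agmon => /(_ c s a cs P_local (la *: x) xi t lxd xi0 t0).
(* Pointwise in xi the power la^n from the symbol cancels la^-n from the top-degree component, so
   only the constant and the supertrace remain under the integral. *)
have E xi : log_symbol (@op_coeffs R n m _
      (fop (U_sharp la (f_sharp la (cg PI (fun y => invmx (fr (s y) c)))))))
      theta n x xi (fidx [set: 'I_n]) (fidx finset.set0)
    = (- (2 * 'i)) ^- (n./2) * str ga (log_symbol a theta n (la *: x) xi).
  rewrite (@log_symbol_rescaled _ _ _ _ _ a _ (dom c) la theta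
    (rescaled_spin_to_form ga la) (rescaled_form_to_spin ga la)) //.
  - rewrite [LHS]mxE /= rescaled_spin_to_form_top//.
    have l0 : la ^+ n != 0 by rewrite expf_neq0// gt_eqF.
    by rewrite mulrA -rmorphXn -rmorphM /= mulfV// mul1r.
  - by case: P_local.
  - exact: rescaled_spin_to_form1.
  - exact: rescaled_spin_to_formM.
  - exact: rescaled_spin_to_formK.
  - by move=> al y alm _; exact: op_coeffs_rescaled.
rewrite (_ : (fun xi => _) = fun xi =>
    (- (2 * 'i)) ^- (n./2) * str ga (log_symbol a theta n (la *: x) xi)); last first.
  by apply/funext => xi; exact: E.
rewrite sphere_int_scale_pow /= (normal_frame_det normal lxr).
set A := sphere_int _; set B := (_%:C); set D := (_ ^- _); set K := (_%:C).
ring.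
Qed.
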